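(* Let $d\ge 1$ be an integer and let $(p,\lambda)\in\Gamma$. Let $\gamma$ be a real number with $0<\gamma<\lambda-(p-1)$ if $p>1$, or $0<\gamma\le\lambda$ if $p=1$. Then the trace operator $\mathscr{T}: W^{1,p}(\mathbb{R}^{d+1}_+,\mu_{p-1}^{\lambda})\to\mathcal{B}^{\gamma}_p(\mathbb{R}^d)$ is bounded and linear.
   Context: Notation. $\mathbb{R}^{d+1}_+=\{(x,t):x\in\mathbb{R}^d,\ t>0\}$; $m_n$ is $n$-dimensional Lebesgue measure; $\log^{\lambda}s=(\log s)^{\lambda}$; $\mathbb{N}=\{0,1,2,\dots\}$. $L^p(\mathbb{R}^d)$ is taken with respect to $m_d$. Parameter set. $\Gamma=\{(p,\lambda)\in\mathbb{R}^2: p>1,\ \lambda>p-1\}\cup\{(p,\lambda)\in\mathbb{R}^2: p=1,\ \lambda\ge 0\}$. Weights and measures. For $-1<\alpha\le p-1$ and $\lambda\in\mathbb{R}$, the weight $\omega_\alpha^\lambda:\mathbb{R}^{d+1}_+\to(0,\infty)$ is $\omega_\alpha^\lambda(x_1,\dots,x_{d+1})=|x_{d+1}|^{\alpha}\log^{\lambda}\frac{4}{|x_{d+1}|}$ if $x_{d+1}\in(0,1]$ and $=\log^{\lambda}4$ if $x_{d+1}\in(1,\infty)$. The measure $\mu_\alpha^\lambda$ on $\mathbb{R}^{d+1}_+$ is $\mu_\alpha^\lambda(E)=\frac{1}{\log^{\lambda}4}\int_E\omega_\alpha^\lambda\,dm_{d+1}$. Here $\alpha=p-1$. Sobolev space.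 For $p\in[1,\infty)$, $W^{1,p}(\mathbb{R}^{d+1}_+,\mu_\alpha^\lambda)$ is the normed space of all measurable $f\in L^1_{\rm loc}(\mathbb{R}^{d+1}_+)$ whose first-order distributional derivatives, denoted $\nabla f$, belong to $L^1_{\rm loc}(\mathbb{R}^{d+1}_+)$ and such that $\|f\|_{W^{1,p}(\mathbb{R}^{d+1}_+,\mu_\alpha^\lambda)}:=\|f\|_{L^p(\mathbb{R}^{d+1}_+,\mu_\alpha^\lambda)}+\|\nabla f\|_{L^p(\mathbb{R}^{d+1}_+,\mu_\alpha^\lambda)}<\infty$. Dyadic cubes. For $k\in\mathbb{Z}$, $\mathscr{Q}_{d,k}$ is the collection of cubes $Q=2^{-k}\big((0,1]^d+m\big)$, $m\in\mathbb{Z}^d$, with edge length $\ell(Q)=2^{-k}$. For $Q\in\mathscr{Q}_{d,k}$ put $\mathscr{W}(Q)=Q\times(2^{-k},2^{-k+1}]$ and $\mathscr{N}(Q)=\{y\in\mathbb{R}^{d+1}_+:\operatorname{dist}(y,\mathscr{W}(Q))<\frac14\ell(Q)\}$. Selected neighbors. Let $j\in\mathbb{N}$ and $Q\in\mathscr{Q}_{d,2^j}$ (so $\ell(Q)=2^{-2^j}$). A dyadic cube $Q'$ is a selected neighbor of $Q$, written $Q'\asymp Q$, if $Q'\in\mathscr{Q}_{d,2^j}\cup\mathscr{Q}_{d,2^{j-1}}$ and $\overline{Q}\cap\overline{Q'}\ne\emptyset$; by convention $\mathscr{Q}_{d,2^{-1}}:=\mathscr{Q}_{d,1}$. Besov-type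 space. For $p\in[1,\infty)$ and $\gamma>0$, $\mathcal{B}^{\gamma}_p(\mathbb{R}^d)$ is the normed space of all measurable $f\in L^1_{\rm loc}(\mathbb{R}^d)$ with $\|f\|_{\mathcal{B}^{\gamma}_p(\mathbb{R}^d)}:=\|f\|_{L^p(\mathbb{R}^d)}+\|f\|_{\dot{\mathcal{B}}^{\gamma}_p(\mathbb{R}^d)}<\infty$, where $\|f\|^p_{\dot{\mathcal{B}}^{\gamma}_p(\mathbb{R}^d)}:=\sum_{j=0}^{\infty}(2^j+2)^{\gamma}\sum_{Q\in\mathscr{Q}_{d,2^j}}m_d(Q)\sum_{Q'\asymp Q}|f_Q-f_{Q'}|^p$ and $f_Q=\frac{1}{m_d(Q)}\int_Qf\,dm_d$. Trace. For $f\in L^1_{\rm loc}(\mathbb{R}^{d+1}_+)$ and $k\in\mathbb{N}$ define $\mathscr{T}_kf:\mathbb{R}^d\to\mathbb{R}$ by $\mathscr{T}_kf=\sum_{Q\in\mathscr{Q}_{d,k}}\Big(\frac{1}{m_{d+1}(\mathscr{N}(Q))}\int_{\mathscr{N}(Q)}f\,dm_{d+1}\Big)\chi_Q$. The trace function is $\mathscr{T}f=\lim_{k\to\infty}\mathscr{T}_kf$, provided the (finite) limit exists $m_d$-a.e. in $\mathbb{R}^d$. (The claim includes that $\mathscr{T}f$ exists for every $f$ in the Sobolev space.) *)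

(* Defs.v *)
From HB Require Import structures.
From mathcomp Require Import all_boot all_order all_algebra.
From mathcomp Require Import all_classical all_reals all_analysis.
From mathcomp Require Import measurable_realfun.

Set Implicit Arguments.
Unset Strict Implicit.
Unset Printing Implicit Defensive.
Import Order.TTheory GRing.Theory Num.Theory.
Import numFieldNormedType.Exports.

Local Open Scope classical_set_scope.
Local Open Scope ring_scope.

(* R^n is 'rV[R]_n, with the library's topology and differential structure.
   Its sigma-algebra is the product (Borel) one, generated by the coordinates. *)
Definition measure_row_display : measure_display -> measure_display.
Proof. exact. Qed.

Section measurable_row.
Context {d} {T : sigmaRingType d}.
Variable n : nat.

Let coord : 'I_n -> 'rV[T]_n -> T := fun i x => x ord0 i.

Let row_set0 : g_sigma_preimage coord set0.
Proof. exact: sigma_algebra0. Qed.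

Let row_setC A : g_sigma_preimage coord A -> g_sigma_preimage coord (~` A).
Proof. exact: sigma_algebraC. Qed.

Let row_bigcup (F : _^nat) : (forall i, g_sigma_preimage coord (F i)) ->
  g_sigma_preimage coord (\bigcup_i (F i)).
Proof. exact: sigma_algebra_bigcup. Qed.

HB.instance Definition _ := @isMeasurable.Build (measure_row_display d)
  'rV[T]_n (g_sigma_preimage coord) row_set0 row_setC row_bigcup.

End measurable_row.

Lemma measurable_row_coord d (T : measurableType d) n (i : 'I_n) :
  measurable_fun [set: 'rV[T]_n] (fun x => x ord0 i).
Proof.
move=> _ Y mY; rewrite setTI; apply: sub_sigma_algebra => /=.
case: n i => [[]//|n] i; rewrite -bigcup_mkord_ord.
exists i => //=; exists Y => //; rewrite setTI.
by congr (_ @^-1` Y); apply/funext => x /=; rewrite inord_val.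
Qed.

Lemma measurable_fun_rowP d d' (S : measurableType d) (T : measurableType d')
    n (f : S -> 'rV[T]_n) :
  (forall i, measurable_fun [set: S] (fun s => f s ord0 i)) ->
  measurable_fun [set: S] f.
Proof.
case: n f => [|n] f mf; apply: measurability => // _ [B + <-].
  by rewrite big_ord0.
rewrite -bigcup_mkord_ord => -[i ni] [C mC <-].
by rewrite setTI; apply: (mf (inord i)).
Qed.

Section lebesgue_row.
Context {R : realType}.

(* R^n x R -> R^(n+1), and the two projections back. *)
Definition row_snoc n (z : 'rV[R]_n * R) : 'rV[R]_n.+1 :=
  \row_(i < n.+1) oapp (z.1 ord0) z.2 (unlift ord_max i).
Definition row_base n (y : 'rV[R]_n.+1) : 'rV[R]_n :=
  \row_(i < n) y ord0 (lift ord_max i).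
Definition height n (y : 'rV[R]_n.+1) : R := y ord0 ord_max.

Lemma row_snocK n : cancel (@row_snoc n) (fun y => (row_base y, height y)).
Proof.
move=> [x t]; congr pair; last by rewrite /height mxE unlift_none.
by apply/rowP => i; rewrite !mxE liftK.
Qed.

Lemma row_baseK n (y : 'rV[R]_n.+1) : row_snoc (row_base y, height y) = y.
Proof.
apply/rowP => i; rewrite mxE; case: unliftP => [j|] ->//=.
by rewrite mxE.
Qed.

Lemma measurable_row_snoc n : measurable_fun setT (@row_snoc n).
Proof.
apply: measurable_fun_rowP => i.
under eq_fun do rewrite mxE.
case: unliftP => [j _|_] /=; last exact: measurable_snd.
exact: (measurableT_comp (measurable_row_coord j) measurable_fst).
Qed.

Lemma measurable_row_base n : measurable_fun setT (@row_base n).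
Proof.
apply: measurable_fun_rowP => i.
under eq_fun do rewrite mxE.
exact: measurable_row_coord.
Qed.

Lemma measurable_height n : measurable_fun setT (@height n).
Proof. exact: measurable_row_coord. Qed.

Section step.
Variable n : nat.
Variable mu : {sigma_finite_measure set 'rV[R]_n -> \bar R}.

Definition snoc_measure : set 'rV[R]_n.+1 -> \bar R :=
  pushforward (mu \x @lebesgue_measure R)%E (@row_snoc n).

Let snoc_measure0 : snoc_measure set0 = 0%E.
Proof. by rewrite /snoc_measure /pushforward preimage_set0 measure0. Qed.

Let snoc_measure_ge0 A : (0 <= snoc_measure A)%E.
Proof. by rewrite /snoc_measure /pushforward measure_ge0. Qed.

Let snoc_measure_sigma_additive : semi_sigma_additive snoc_measure.
Proof.
move=> F mF tF mUF; rewrite /snoc_measure /pushforward preimage_bigcup.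
apply: measure_semi_sigma_additive.
- by move=> i; rewrite -[X in measurable X]setTI; exact: measurable_row_snoc.
- apply/trivIsetP => /= i j _ _ ij; rewrite -preimage_setI.
  by move/trivIsetP : tF => /(_ _ _ _ _ ij) ->//; rewrite preimage_set0.
- by rewrite -preimage_bigcup -[X in measurable X]setTI; exact: measurable_row_snoc.
Qed.

HB.instance Definition _ := isMeasure.Build _ _ _ snoc_measure
  snoc_measure0 snoc_measure_ge0 snoc_measure_sigma_additive.

Let snoc_measure_sigma_finite : sigma_finite setT snoc_measure.
Proof.
have /sigma_finiteP[F [UF ndF mF]] := sigma_finiteT mu.
have /sigma_finiteP[G [UG ndG mG]] := sigma_finiteT (@lebesgue_measure R).
pose split_ (y : 'rV[R]_n.+1) := (row_base y, height y).
exists (fun k => split_ @^-1` (F k `*` G k)).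
  rewrite -preimage_bigcup; apply/esym/seteqP; split => // y _ /=.
  have [i _ Fi] : (\bigcup_k F k) (row_base y) by rewrite -UF.
  have [j _ Gj] : (\bigcup_k G k) (height y) by rewrite -UG.
  exists (maxn i j) => //; split.
    by move: Fi; apply/subsetPset/ndF; rewrite leq_maxl.
  by move: Gj; apply/subsetPset/ndG; rewrite leq_maxr.
move=> k; have [mFk Fk] := mF k; have [mGk Gk] := mG k; split.
  rewrite -[X in measurable X]setTI.
  have := measurable_fun_pair (@measurable_row_base n) (@measurable_height n).
  by apply => //; exact: measurableX.
rewrite /snoc_measure /pushforward -comp_preimage.
rewrite (_ : split_ \o _ = id); last by apply/funext => z; exact: row_snocK.
by rewrite preimage_id product_measure1E// lte_mul_pinfty// ge0_fin_numE.
Qed.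

HB.instance Definition _ := Measure_isSigmaFinite.Build _ _ _ snoc_measure
  snoc_measure_sigma_finite.

End step.

(* Lebesgue measure on R^n, from the identification of R^(n+1) with R^n x R. *)
Fixpoint lebesgue_row n : {sigma_finite_measure set 'rV[R]_n -> \bar R} :=
  match n with
  | 0 => [the {sigma_finite_measure set 'rV[R]_0 -> \bar R} of \d_(0 : 'rV[R]_0)]
  | n.+1 => [the {sigma_finite_measure set 'rV[R]_n.+1 -> \bar R}
             of snoc_measure (lebesgue_row n)]
  end.

End lebesgue_row.

Section spaces.
Context {R : realType}.

Definition upper_half {d} : set 'rV[R]_d.+1 := [set y | 0 < height y].

(* The norm of 'rV[R]_n in the library is the sup norm; this is the Euclidean one. *)
Definition enorm n (x : 'rV[R]_n) : R := Num.sqrt (\sum_(i < n) x ord0 i ^+ 2).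

Definition dist_set n (y : 'rV[R]_n) (A : set 'rV[R]_n) : R :=
  inf [set enorm (y - z) | z in A].

Definition mean n (A : set 'rV[R]_n) (f : 'rV[R]_n -> R) : R :=
  (fine (lebesgue_row n A))^-1 * (\int[lebesgue_row n]_(x in A) f x).

(* The n-dimensional analogue of the library's locally_integrable. *)
Definition loc_integrable n (D : set 'rV[R]_n) (f : 'rV[R]_n -> R) : Prop :=
  measurable_fun D f /\
  forall K, K `<=` D -> compact K ->
    (\int[lebesgue_row n]_(x in K) `|f x|%:E < +oo)%E.

Fixpoint continuously_differentiable n (k : nat) (phi : 'rV[R]_n -> R) : Prop :=
  if k is k'.+1 then
    forall i : 'I_n, (forall x, derivable phi x (delta_mx ord0 i)) /\
      continuously_differentiable k' (fun x => 'D_(delta_mx ord0 i) phi x)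
  else continuous phi.

Definition closed_support n (phi : 'rV[R]_n -> R) : set 'rV[R]_n :=
  closure [set x | phi x != 0].

Definition test_function n (D : set 'rV[R]_n) (phi : 'rV[R]_n -> R) : Prop :=
  [/\ forall k, continuously_differentiable k phi,
      compact (closed_support phi) & closed_support phi `<=` D].

(* The i-th component of G is the i-th distributional derivative of f on D. *)
Definition is_weak_gradient n (D : set 'rV[R]_n) (f : 'rV[R]_n -> R)
    (G : 'rV[R]_n -> 'rV[R]_n) : Prop :=
  forall i : 'I_n, loc_integrable D (fun x => G x ord0 i) /\
    forall phi, test_function D phi ->
      \int[lebesgue_row n]_(x in D) (f x * 'D_(delta_mx ord0 i) phi x) =
      - \int[lebesgue_row n]_(x in D) (G x ord0 i * phi x).

(* Distributional derivatives are unique up to null sets, so the choice is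
   immaterial; the default value 0 is used when there is none. *)
Definition weak_gradient n (D : set 'rV[R]_n) (f : 'rV[R]_n -> R) :
    'rV[R]_n -> 'rV[R]_n :=
  xget (cst 0) [set G | is_weak_gradient D f G].

(* Only the values at points of positive height matter. *)
Definition omega d (alpha lambda : R) (y : 'rV[R]_d.+1) : R :=
  if height y <= 1
  then `|height y| `^ alpha * ln (4 / `|height y|) `^ lambda
  else ln 4 `^ lambda.

Lemma measurable_omega d alpha lambda :
  measurable_fun setT (@omega d alpha lambda).
Proof.
have mh := @measurable_height R d.
have mnh : measurable_fun setT (fun y : 'rV[R]_d.+1 => `|height y|).
  exact: measurableT_comp.
apply: measurable_fun_ifT.
- exact: measurable_fun_ler.
- apply: measurable_funM; first exact: (measurableT_comp (measurable_powR _) mnh).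
  apply: (measurableT_comp (measurable_powR _)).
  apply: (measurableT_comp (@measurable_ln R)).
  apply: measurable_funM => //.
  under eq_fun do rewrite -powR_inv1//.
  exact: (measurableT_comp (measurable_powR _) mnh).
- exact: measurable_cst.
Qed.

Lemma omega_ge0 d alpha lambda (y : 'rV[R]_d.+1) : 0 <= omega alpha lambda y.
Proof. by rewrite /omega; case: ifP => _; rewrite ?mulr_ge0 ?powR_ge0. Qed.

Lemma measurable_upper_half d : measurable (@upper_half d).
Proof.
have := @measurable_height R d measurableT _ (measurable_itv `]0, +oo[).
rewrite setTI; congr measurable.
by apply/seteqP; split => y /=; rewrite in_itv/= andbT.
Qed.

(* A measure on the whole of R^(d+1), carried by the upper half-space. *)
Definition mu_weight d (alpha lambda : R) (E : set 'rV[R]_d.+1) : \bar R :=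
  ((ln 4 `^ lambda)^-1%:E *
   \int[lebesgue_row d.+1]_(y in E `&` upper_half) (omega alpha lambda y)%:E)%E.

Section mu_weight_measure.
Variables (d : nat) (alpha lambda : R).
Local Notation mu := (@mu_weight d alpha lambda).

Let mu_weight0 : mu set0 = 0%E.
Proof. by rewrite /mu_weight set0I integral_set0 mule0. Qed.

Let mu_weight_ge0 A : (0 <= mu A)%E.
Proof.
rewrite mule_ge0 ?lee_fin ?invr_ge0 ?powR_ge0//.
by apply: integral_ge0 => y _; rewrite lee_fin omega_ge0.
Qed.

Let mu_weight_sigma_additive : semi_sigma_additive mu.
Proof.
move=> F mF tF mUF.
have -> : mu (\bigcup_n F n) = (\sum_(0 <= i <oo) mu (F i))%E.
  rewrite /mu_weight setI_bigcupl ge0_integral_bigcup//.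
  - rewrite nneseriesZl// => i _.
    by apply: integral_ge0 => y _; rewrite lee_fin omega_ge0.
  - by move=> k; apply: measurableI => //; exact: measurable_upper_half.
  - apply/measurable_EFinP.
    by apply: (measurable_funS measurableT) => //; exact: measurable_omega.
  - by move=> y _; rewrite lee_fin omega_ge0.
  - exact: trivIset_setIr.
apply: is_cvg_nneseries => i _ _; exact: mu_weight_ge0.
Qed.

HB.instance Definition _ := isMeasure.Build _ _ _ mu
  mu_weight0 mu_weight_ge0 mu_weight_sigma_additive.

End mu_weight_measure.

Definition sobolev_norm d (p alpha lambda : R) (f : 'rV[R]_d.+1 -> R) : \bar R :=
  let mu := [the {measure set 'rV[R]_d.+1 -> \bar R} of mu_weight alpha lambda] in
  ('N[mu]_(p%:E)[(EFin \o f) \_ upper_half] +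
   'N[mu]_(p%:E)[(EFin \o (fun y => enorm (weak_gradient upper_half f y)))
                   \_ upper_half])%E.

Definition sobolev d (p alpha lambda : R) (f : 'rV[R]_d.+1 -> R) : Prop :=
  [/\ loc_integrable upper_half f,
      (exists G, is_weak_gradient upper_half f G) &
      (sobolev_norm p alpha lambda f < +oo)%E].

Definition dyadic_cube d (k : int) (m : 'rV[int]_d) : set 'rV[R]_d :=
  [set x | forall i,
    2 ^ (- k) * (m ord0 i)%:~R < x ord0 i <= 2 ^ (- k) * ((m ord0 i)%:~R + 1)].

Definition dyadic d (k : int) : set (set 'rV[R]_d) :=
  [set dyadic_cube k m | m in [set: 'rV[int]_d]].

Definition whitney d (k : int) (Q : set 'rV[R]_d) : set 'rV[R]_d.+1 :=
  [set y | Q (row_base y) /\ 2 ^ (- k) < height y <= 2 ^ (- k + 1)].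

Definition whitney_nbhd d (k : int) (Q : set 'rV[R]_d) : set 'rV[R]_d.+1 :=
  [set y | 0 < height y /\ dist_set y (whitney k Q) < 2 ^ (- k) / 4].

(* 2^(j-1), with the convention that 2^(-1) stands for 1. *)
Definition prev_scale (j : nat) : int := if j is j'.+1 then (2 ^ j')%N else 1.

Definition selected_neighbors d (j : nat) (Q : set 'rV[R]_d) :
    set (set 'rV[R]_d) :=
  [set Q' | (dyadic (2 ^ j)%N `|` dyadic (prev_scale j)) Q' /\
            closure Q `&` closure Q' !=set0].

Definition besov_seminorm d (p gamma : R) (f : 'rV[R]_d -> R) : \bar R :=
  ((\sum_(0 <= j <oo) (((2 ^+ j + 2) `^ gamma)%R%:E *
     \esum_(Q in dyadic (2 ^ j)%N) (lebesgue_row d Q *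
       \esum_(Q' in selected_neighbors j Q) (`|mean Q f - mean Q' f| `^ p)%R%:E)))
   `^ p^-1)%E.

Definition besov_norm d (p gamma : R) (f : 'rV[R]_d -> R) : \bar R :=
  ('N[lebesgue_row d]_(p%:E)[EFin \o f] + besov_seminorm p gamma f)%E.

Definition besov d (p gamma : R) (f : 'rV[R]_d -> R) : Prop :=
  loc_integrable [set: 'rV[R]_d] f /\ (besov_norm p gamma f < +oo)%E.

(* The cubes of a generation are disjoint, so at most one term is nonzero. *)
Definition trace_approx d (f : 'rV[R]_d.+1 -> R) (k : nat) (x : 'rV[R]_d) : R :=
  \sum_(Q \in dyadic k) (mean (whitney_nbhd k Q) f * \1_Q x).

Definition trace_exists d (f : 'rV[R]_d.+1 -> R) : Prop :=
  {ae lebesgue_row d, forall x, cvgn (trace_approx f ^~ x)}.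

(* At points where the limit does not exist, lim takes a default value. *)
Definition trace_fun d (f : 'rV[R]_d.+1 -> R) (x : 'rV[R]_d) : R :=
  limn (trace_approx f ^~ x).

Definition Gamma : set (R * R) :=
  [set pl | (1 < pl.1 /\ pl.1 - 1 < pl.2) \/ (pl.1 = 1 /\ 0 <= pl.2)].

End spaces.

(* Main.v *)
Require Import Defs.
From mathcomp Require Import all_boot all_order all_algebra.
From mathcomp Require Import all_classical all_reals all_analysis.
From mathcomp Require Import measurable_realfun ring lra zify.
Import Order.TTheory GRing.Theory Num.Theory.
Import numFieldNormedType.Exports.
Local Open Scope classical_set_scope.
Local Open Scope ring_scope.
Set Implicit Arguments.
Unset Strict Implicit.
Unset Printing Implicit Defensive.

(** For a cube Q of side 2^-k let a_k(Q) be the average of f over the Whitney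
    neighbourhood of Q; the trace is the limit of the step functions a_k. The
    neighbourhoods of two touching cubes of one generation, or of a cube and
    one of its children, lie in a common box of side 5 * 2^-k whose points have
    height comparable to 2^-k. Poincare's and Jensen's inequalities on that box
    bound the p-th power of the difference of the two averages by the integral
    of |grad f|^p with respect to the weighted measure (adjacent_means,
    child_means). The exponent p - 1 of the height in the weight is the critical
    one: all the powers of 2^k cancel, and the only gain is the factor
    (k + 2)^-lambda due to the logarithm. Let E_k be the integral of |grad f|^p
    over the boxes of generation k. The boxes overlap boundedly, so the sum of
    the E_k is at most a multiple of the p-th power of the norm of grad f
    (sum_scale_energy), and the increments satisfy
      ||a_(k+1) - a_k||_p^p <= C (k + 2)^-lambda E_k.

    What remains is a question about sequences, and the hypotheses on p, lambda
    and gamma are the ones under which a discrete Hardy inequality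
    (hardy_weights) answers it. It shows that the a_k converge almost
    everywhere, with ||T f - a_k||_p^p at most a weighted sum of the E_i over
    i >= k (trace_remainder); with k = 0 this gives the L^p bound
    (trace_powR_integral). For the seminorm, averaging T f over a cube of
    generation 2^j and comparing with the same average over a neighbour costs at
    most the distance of T f to a_k and the difference of a_k between touching
    cubes, with k the generation of one of the two cubes
    (besov_scale_term_le). When these bounds are multiplied by (2^j + 2)^gamma
    and summed over j, every E_i still has a bounded coefficient
    (besov_sum_le).

    Poincare's inequality is derived directly from the definition of weak
    derivatives, without approximating f by smooth functions. Testing with
    products of functions of one variable shows that the integrals of f over two
    parallel slabs of thickness eps differ by at most eps times the integral of
    the corresponding partial derivative over a box that contains them
    (slab_difference). Two cells of a fine grid are joined by changing one
    coordinate at a time, and averaging over the pairs of cells meets every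
    intermediate cell equally often (grid_poincare, poincare_mean). *)

(** * Smooth functions of one variable *)

Section smooth_functions.
Context {R : realType}.
Implicit Types (f g : R -> R) (k n : nat) (t x : R).

Fixpoint smooth_upto k f : Prop :=
  if k is k'.+1 then
    (forall x, derivable f x 1) /\ smooth_upto k' (derive1 f)
  else continuous f.

Definition smooth f := forall k, smooth_upto k f.

Lemma derivable_continuous f : (forall x, derivable f x 1) -> continuous f.
Proof.
by move=> df x; apply/differentiable_continuous/derivable1_diffP.
Qed.

Lemma smooth_uptoS k f f' :
  (forall x, is_derive x 1 f (f' x)) -> smooth_upto k f' -> smooth_upto k.+1 f.
Proof.
move=> df sf'; split; first by move=> x; have := df x; case.
suff -> : derive1 f = f' by [].
by apply/funext => x; rewrite derive1E; have := df x; case.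
Qed.

Lemma smooth_uptoW k f : smooth_upto k.+1 f -> smooth_upto k f.
Proof.
elim: k f => [|k IH] f [df sf]; first exact: derivable_continuous.
by split => //; exact: IH.
Qed.

Lemma smooth_is_derive f : smooth f -> forall x, is_derive x 1 f (derive1 f x).
Proof.
move=> /(_ 1%N) [df _] x; rewrite derive1E; exact: derivableP.
Qed.

Lemma smooth_derive1 f : smooth f -> smooth (derive1 f).
Proof. by move=> sf k; have [] := sf k.+1. Qed.

Lemma smooth_continuous f : smooth f -> continuous f.
Proof. by move=> /(_ 0%N). Qed.

Lemma smooth_cst (c : R) : smooth (cst c).
Proof.
move=> k; elim: k c => [|k IH] c; first exact: cst_continuous.
exact: (smooth_uptoS (f' := cst 0)).
Qed.

Lemma smooth_id : smooth (@id R).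
Proof.
case=> [|k]; first by move=> x; exact: cvg_id.
by apply: (smooth_uptoS (f' := cst 1)) => //; exact: smooth_cst.
Qed.

Lemma smooth_uptoD k f g :
  smooth_upto k f -> smooth_upto k g -> smooth_upto k (fun x => f x + g x).
Proof.
elim: k f g => [|k IH] f g.
  by move=> cf cg x; apply: cvgD; [exact: cf|exact: cg].
move=> [df sf] [dg sg]; apply: (smooth_uptoS (f' := fun x => derive1 f x + derive1 g x)).
  by move=> x; rewrite !derive1E; apply: is_deriveD; exact: derivableP.
exact: IH.
Qed.

Lemma smooth_uptoM k f g :
  smooth_upto k f -> smooth_upto k g -> smooth_upto k (fun x => f x * g x).
Proof.
elim: k f g => [|k IH] f g.
  by move=> cf cg x; apply: cvgM; [exact: cf|exact: cg].
move=> sf sg; have [df sf'] := sf; have [dg sg'] := sg.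
apply: (smooth_uptoS (f' := fun x => f x * derive1 g x + g x * derive1 f x)).
  by move=> x; rewrite !derive1E; apply: is_deriveM; exact: derivableP.
by apply: smooth_uptoD; apply: IH => //; exact: smooth_uptoW.
Qed.

Lemma smooth_upto_comp k f g :
  smooth_upto k f -> smooth_upto k g -> smooth_upto k (f \o g).
Proof.
elim: k f g => [|k IH] f g.
  by move=> cf cg x; apply: continuous_comp; [exact: cg|exact: cf].
move=> sf sg; have [df sf'] := sf; have [dg sg'] := sg.
apply: (smooth_uptoS (f' := fun x => (derive1 f \o g) x * derive1 g x)).
  by move=> x; rewrite /= !derive1E; apply: is_derive1_comp; exact: derivableP.
by apply: smooth_uptoM => //; apply: IH => //; exact: smooth_uptoW.
Qed.

Lemma smoothD f g : smooth f -> smooth g -> smooth (fun x => f x + g x).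
Proof. by move=> sf sg k; exact: smooth_uptoD. Qed.

Lemma smoothM f g : smooth f -> smooth g -> smooth (fun x => f x * g x).
Proof. by move=> sf sg k; exact: smooth_uptoM. Qed.

Lemma smooth_comp f g : smooth f -> smooth g -> smooth (f \o g).
Proof. by move=> sf sg k; exact: smooth_upto_comp. Qed.

Lemma smoothZ (c : R) f : smooth f -> smooth (fun x => c * f x).
Proof. by apply: smoothM; exact: smooth_cst. Qed.

Lemma smoothB f g : smooth f -> smooth g -> smooth (fun x => f x - g x).
Proof.
move=> sf sg; have -> : (fun x => f x - g x) = (fun x => f x + (-1) * g x).
  by apply/funext => x; rewrite mulN1r.
by apply: smoothD => //; exact: smoothZ.
Qed.

Lemma smooth_affine (a b : R) : smooth (fun x => a * x + b).
Proof. by apply: smoothD; [apply: smoothZ; exact: smooth_id|exact: smooth_cst]. Qed.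

(** The functions t^-n exp(-1/t), extended by 0 to t <= 0: the derivative of
    the n-th one is a combination of the (n+1)-st and the (n+2)-nd, so the
    whole family is smooth by induction on the order of differentiation. *)
Definition flat_exp n t : R := if 0 < t then t^-1 ^+ n * expR (- t^-1) else 0.

Lemma flat_exp_le0 n t : t <= 0 -> flat_exp n t = 0.
Proof. by move=> t0; rewrite /flat_exp ltNge t0. Qed.

Lemma flat_exp_ge0 n t : 0 <= flat_exp n t.
Proof.
by rewrite /flat_exp; case: ifPn => // t0; rewrite mulr_ge0 ?expR_ge0// exprn_ge0// invr_ge0 ltW.
Qed.

Lemma flat_exp_gt0 n t : 0 < t -> 0 < flat_exp n t.
Proof.
by move=> t0; rewrite /flat_exp t0 mulr_gt0 ?expR_gt0// exprn_gt0// invr_gt0.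
Qed.

Lemma le_flat_exp0 s t : s <= t -> flat_exp 0 s <= flat_exp 0 t.
Proof.
move=> st; case: (lerP s 0) => [s0|s0]; first by rewrite (flat_exp_le0 _ s0) flat_exp_ge0.
have t0 : 0 < t by exact: lt_le_trans st.
by rewrite /flat_exp s0 t0 !expr0 !mul1r ler_expR lerN2 lef_pV2.
Qed.

(** The exponential beats every power of 1/t; a quadratic bound is enough for
    the derivative at 0 to exist and vanish. *)
Lemma flat_exp_le_sqr n t : flat_exp n t <= n.+2`!%:R * t ^+ 2.
Proof.
case: (lerP t 0) => [t0|t0].
  by rewrite flat_exp_le0// mulr_ge0// sqr_ge0.
rewrite /flat_exp t0; set x := t^-1; have x0 : 0 < x by rewrite invr_gt0.
have xe : x ^+ n.+2 * expR (- x) <= n.+2`!%:R.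
  have : x ^+ n.+2 / n.+2`!%:R <= expR x.
    by apply: le_trans (expR_ge1Dxn n.+1 (ltW x0)); rewrite lerDr.
  rewrite ler_pdivrMr ?ltr0n ?fact_gt0// => h.
  by rewrite expRN ler_pdivrMr ?expR_gt0// mulrC.
have -> : x ^+ n * expR (- x) = x ^+ n.+2 * expR (- x) * t ^+ 2.
  have tx : t = x^-1 by rewrite invrK.
  rewrite tx -[n.+2]addn2 exprD; field.
  by rewrite gt_eqF.
by rewrite ler_wpM2r// sqr_ge0.
Qed.

Lemma is_derive_sqr_bound f (C : R) :
  (forall t, `|f t| <= C * t ^+ 2) -> is_derive (0 : R) (1 : R) f 0.
Proof.
move=> fC.
have f0 : f 0 = 0.
  by apply/eqP; rewrite -normr_le0; have := fC 0; rewrite expr0n mulr0.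
have C0 : 0 <= C by have := fC 1; rewrite expr1n mulr1; exact: le_trans.
have hc : (fun h : R => h^-1 *: ((f \o shift (0 : R)) (h *: (1 : R)) - f (0 : R))) @ 0^' --> (0 : R).
  apply/cvgr0Pnorm_le => e e0.
  have d0 : 0 < e / (C + 1) by rewrite divr_gt0// ltr_wpDl.
  near=> h.
  rewrite /= f0 subr0 addr0 normrZ normfV.
  have hn0 : h != 0 by near: h; exact: nbhs_dnbhs_neq.
  rewrite mulrC ler_pdivrMr ?normr_gt0// [h *: _]mulr1.
  apply: (le_trans (fC h)).
  have : `|h| <= e / (C + 1) by near: h; apply: dnbhs0_le.
  rewrite ler_pdivlMr ?ltr_wpDl// => hh.
  rewrite -real_normK ?num_real// expr2 mulrA ler_wpM2r//.
  by apply: le_trans hh; rewrite mulrDr mulr1 mulrC lerDl.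
apply: DeriveDef; first by apply/cvg_ex; exists 0.
exact/cvg_lim.
Unshelve. all: by end_near. Qed.

Lemma is_derive_flat_exp n t :
  is_derive t 1 (flat_exp n) (- n%:R * flat_exp n.+1 t + flat_exp n.+2 t).
Proof.
have [t0|t0|->] := ltrgtP t 0.
- rewrite !flat_exp_le0 ?ltW// mulr0 addr0.
  apply: (@near_eq_is_derive _ _ _ (cst 0)) => //.
  near=> y; rewrite flat_exp_le0// ltW//; near: y.
  exact: lt_nbhsl.
- have tn0 : t != 0 by rewrite gt_eqF.
  apply: (@near_eq_is_derive R R R (fun y : R => y^-1 ^+ n * expR (- y^-1))).
    by near=> y; rewrite /flat_exp ifT//; near: y; exact: lt_nbhsr.
  have di : is_derive t 1 (fun y : R => y^-1) (- t ^- 2).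
    apply: DeriveDef; first exact: (derivableV (f := @id R)).
    by rewrite (deriveV (f := @id R))// derive_id [LHS]mulr1.
  have dn : is_derive t 1 (fun y : R => - y^-1) (t ^- 2).
    by apply: (@is_derive_eq _ _ _ _ _ _ _ (- - t ^- 2)) => //; rewrite opprK.
  have de : is_derive t 1 (expR \o (fun y : R => - y^-1)) (expR (- t^-1) * t ^- 2).
    exact: is_derive1_comp.
  have dp : is_derive t 1 (fun y : R => y^-1 ^+ n) (n%:R * t^-1 ^+ n.-1 * - t ^- 2).
    have -> : (fun y : R => y^-1 ^+ n) = (fun y : R => y^-1) ^+ n.
      by apply/funext => y; rewrite exprfctE.
    apply: (is_derive_eq (is_deriveX n di)).
    by rewrite -mulr_natl /GRing.scale.
  apply: (is_derive_eq (is_deriveM dp de)).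
  rewrite /flat_exp t0 -exprVn /GRing.scale /=.
  case: n dp => [|n] dp; first by rewrite mulr0n !mul0r mulr0 oppr0 mul0r add0r addr0 !expr0; ring.
  by rewrite [n.+1.-1]/= !exprS -natr1; ring.
- rewrite !flat_exp_le0// mulr0 addr0.
  apply: (@is_derive_sqr_bound _ (n.+2)`!%:R) => s.
  by rewrite ger0_norm ?flat_exp_ge0// flat_exp_le_sqr.
Unshelve. all: by end_near. Qed.

Lemma smooth_flat_exp n : smooth (flat_exp n).
Proof.
move=> k; elim: k n => [|k IH] n.
  by apply: derivable_continuous => x; have := is_derive_flat_exp n x; case.
apply: (smooth_uptoS (is_derive_flat_exp n)).
by apply: smooth_uptoD => //; apply: smooth_uptoM => //; exact: smooth_cst.
Qed.

(** With h(s) = exp(-1/s) for s > 0 and h(s) = 0 otherwise, this is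
    h(1/e - h(1 - t)) / h(1/e): the argument 1/e - h(1 - t) is nonpositive for
    t <= 0 and equal to 1/e for t >= 1. *)
Definition smooth_step t : R :=
  flat_exp 0 (expR (-1) - flat_exp 0 (1 - t)) / flat_exp 0 (expR (-1)).

Lemma smooth_step_le0 t : t <= 0 -> smooth_step t = 0.
Proof.
move=> t0; rewrite /smooth_step flat_exp_le0 ?mul0r// subr_le0.
have : flat_exp 0 1 <= flat_exp 0 (1 - t) by apply: le_flat_exp0; lra.
by rewrite {1}/flat_exp ltr01 expr0 mul1r invr1.
Qed.

Lemma smooth_step_ge1 t : 1 <= t -> smooth_step t = 1.
Proof.
move=> t1; rewrite /smooth_step (@flat_exp_le0 _ (1 - t)) ?subr_le0// subr0 divff//.
by rewrite gt_eqF// flat_exp_gt0// expR_gt0.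
Qed.

Lemma smooth_smooth_step : smooth smooth_step.
Proof.
have -> : smooth_step = (fun t => (flat_exp 0 (expR (-1)))^-1 * t) \o
    (flat_exp 0 \o ((fun t => (-1) * t + expR (-1)) \o (flat_exp 0 \o (fun t => (-1) * t + 1)))).
  apply/funext => t; rewrite /smooth_step /= mulrC !mulN1r; congr (_ * flat_exp _ _).
  by rewrite addrC; congr (- flat_exp _ _ + _); rewrite addrC.
apply: smooth_comp; first by apply: smoothZ; exact: smooth_id.
do 3 (apply: smooth_comp; [by [exact: smooth_flat_exp|exact: smooth_affine]|]).
exact: smooth_affine.
Qed.

Lemma bounded_of_continuous_const_tails f (c : R) :
  continuous f -> (forall t, t <= 0 -> f t = 0) -> (forall t, 1 <= t -> f t = c) ->
  exists2 C, 0 <= C & forall t, `|f t| <= C.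
Proof.
move=> cf f0 f1.
have cn : {within `[0, 1], continuous (fun t => `|f t|)}.
  by apply: continuous_subspaceT => x; apply: cvg_norm; exact: cf.
have [u _ hu] := @EVT_max R (fun t => `|f t|) 0 1 ler01 cn.
exists `|f u| => // t.
case: (lerP t 0) => [t0|t0]; first by rewrite f0// normr0.
case: (lerP 1 t) => [t1|t1].
  by rewrite f1// -(f1 1)// hu// in_itv/= lexx ler01.
by apply: hu; rewrite in_itv/= !ltW.
Qed.

End smooth_functions.


(** * Test functions of product form *)

Section product_test_functions.
Context {R : realType}.
Variable n : nat.
Implicit Types (g : 'I_n -> R -> R) (x : 'rV[R]_n).

Definition prodf g x : R := \prod_(j < n) g j (x ord0 j).

(** A partial derivative of a product function is a product function with one
    factor differentiated, so the products with smooth factors are closed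
    under differentiation. *)
Definition derive_factor (i : 'I_n) g : 'I_n -> R -> R :=
  fun j => if j == i then derive1 (g i) else g j.

Lemma continuous_row_coord (i : 'I_n) : continuous (fun x : 'rV[R]_n => x ord0 i).
Proof. exact: coord_continuous. Qed.

Lemma continuous_prodf g : (forall j, continuous (g j)) -> continuous (prodf g).
Proof.
move=> cg; rewrite /prodf; elim: (index_enum _) => [|j s IH] x.
  have -> : (fun x : 'rV[R]_n => \prod_(j <- [::]) g j (x ord0 j)) = cst 1.
    by apply/funext => y; rewrite big_nil.
  exact: cst_continuous.
have -> : (fun x : 'rV[R]_n => \prod_(j <- j :: s) g j (x ord0 j)) =
    (fun x => g j (x ord0 j) * \prod_(j <- s) g j (x ord0 j)).
  by apply/funext => y; rewrite big_cons.
apply: continuousM; last exact: IH.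
apply: (@continuous_comp _ _ _ (fun y : 'rV[R]_n => y ord0 j) (g j) x).
  exact: continuous_row_coord.
exact: cg.
Qed.

Lemma is_derive_prodf g (i : 'I_n) x : (forall t : R, derivable (g i) t 1) ->
  is_derive x (delta_mx ord0 i) (prodf g) (prodf (derive_factor i g) x).
Proof.
move=> dg; pose P := \prod_(j < n | j != i) g j (x ord0 j).
have E : (fun h : R => h^-1 *: ((prodf g \o shift x) (h *: delta_mx ord0 i) - prodf g x)) =
   (fun h : R => (h^-1 *: ((g i \o shift (x ord0 i)) (h *: (1 : R)) - g i (x ord0 i))) * P).
  apply/funext => h; rewrite /prodf /= (bigD1 i)//= [in X in _ - X](bigD1 i)//=.
  rewrite !mxE !eqxx mulr1.
  have -> : \prod_(j < n | j != i) g j ((h *: delta_mx ord0 i + x) ord0 j) = P.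
    by apply: eq_bigr => j ji; rewrite !mxE (negbTE ji) andbF mulr0 add0r.
  by rewrite -mulrBl /GRing.scale /= mulrA mulr1.
have C : (fun h : R => h^-1 *: ((prodf g \o shift x) (h *: delta_mx ord0 i) - prodf g x)) @ 0^' -->
   prodf (derive_factor i g) x.
  rewrite E /prodf (bigD1 i)//= {1}/derive_factor eqxx.
  have -> : \prod_(j < n | j != i) derive_factor i g j (x ord0 j) = P.
    by apply: eq_bigr => j ji; rewrite /derive_factor (negbTE ji).
  apply: cvgM; last exact: cvg_cst.
  rewrite derive1E; exact: dg.
apply: DeriveDef; first by apply/cvg_ex; eexists; exact: C.
exact/cvg_lim.
Qed.

Lemma continuously_differentiable_prodf k g :
  (forall j, smooth (g j)) -> continuously_differentiable k (prodf g).
Proof.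
elim: k g => [|k IH] g sg /=.
  by apply: continuous_prodf => j; exact: smooth_continuous.
move=> i; have dg x := is_derive_prodf (i := i) x (fun t => (sg i 1%N).1 t).
split; first by move=> x; have [] := dg x.
have -> : (fun x => 'D_(delta_mx ord0 i) (prodf g) x) = prodf (derive_factor i g).
  by apply/funext => x; have [] := dg x.
apply: IH => j; rewrite /derive_factor; case: ifPn => // _.
exact: smooth_derive1.
Qed.

Definition cbox (a b : 'I_n -> R) : set 'rV[R]_n :=
  [set x | forall i, a i <= x ord0 i <= b i].

Lemma compact_cbox a b : compact (cbox a b).
Proof.
have := @rV_compact R n (fun i => `[a i, b i]%classic) (fun i => @segment_compact _ _ _).
by congr compact; apply/seteqP; split => x h i; have := h i; rewrite /= in_itv.
Qed.

Lemma closed_cbox a b : closed (cbox a b).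
Proof. by apply: compact_closed; [exact: norm_hausdorff|exact: compact_cbox]. Qed.

Lemma test_function_prodf (D : set 'rV[R]_n) g (a b : 'I_n -> R) :
  (forall j, smooth (g j)) ->
  (forall j t, g j t != 0 -> a j <= t <= b j) -> cbox a b `<=` D ->
  test_function D (prodf g).
Proof.
move=> sg g0 KD.
have sub : closed_support (prodf g) `<=` cbox a b.
  rewrite /closed_support [X in _ `<=` X](closure_id _).1; last exact: closed_cbox.
  apply: closureS => x /= px i; apply: g0; apply: contra_neq px => gx.
  by rewrite /prodf (bigD1 i)//= gx mul0r.
split; first by move=> k; exact: continuously_differentiable_prodf.
  by apply: (subclosed_compact _ (@compact_cbox a b)) => //; exact: closed_closure.
exact: subset_trans sub KD.
Qed.

End product_test_functions.


(** * Boxes and integrals over them *)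

Section boxes.
Context {R : realType}.

Definition box n (a b : 'I_n -> R) : set 'rV[R]_n :=
  [set x | forall i, a i < x ord0 i <= b i].

Lemma measurable_coords n (A : 'I_n -> set R) : (forall i, measurable (A i)) ->
  measurable [set x : 'rV[R]_n | forall i, A i (x ord0 i)].
Proof.
move=> mA.
have -> : [set x : 'rV[R]_n | forall i, A i (x ord0 i)] =
    \bigcap_(i in [set: 'I_n]) ((fun x : 'rV[R]_n => x ord0 i) @^-1` A i).
  by apply/seteqP; split => x /= h i; [move=> _; exact: h|exact: h].
apply: fin_bigcap_measurable => // i _.
rewrite -[X in measurable X]setTI.
exact: measurable_row_coord.
Qed.

Lemma measurable_box n (a b : 'I_n -> R) : measurable (box a b).
Proof.
have := @measurable_coords n (fun i => `]a i, b i]%classic) (fun=> measurable_itv _).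
by congr measurable; apply/seteqP; split => x h i; have := h i; rewrite /= in_itv.
Qed.

Lemma measurable_cbox n (a b : 'I_n -> R) : measurable (cbox a b).
Proof.
have := @measurable_coords n (fun i => `[a i, b i]%classic) (fun=> measurable_itv _).
by congr measurable; apply/seteqP; split => x h i; have := h i; rewrite /= in_itv.
Qed.

Lemma lebesgue_row_box n (a b : 'I_n -> R) : (forall i, a i <= b i) ->
  lebesgue_row n (box a b) = (\prod_(i < n) (b i - a i))%:E.
Proof.
elim: n a b => [|n IH] a b ab.
  rewrite big_ord0 /= diracE mem_set//.
  by case.
have -> : lebesgue_row n.+1 (box a b) =
    (lebesgue_row n \x @lebesgue_measure R)%E (@row_snoc R n @^-1` box a b) by [].
pose a' j := a (lift ord_max j); pose b' j := b (lift ord_max j).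
have -> : @row_snoc R n @^-1` box a b = box a' b' `*` `]a ord_max, b ord_max]%classic.
  apply/seteqP; split => -[x t] /=.
    move=> h; split => [j|].
      by have := h (lift ord_max j); rewrite mxE liftK.
    by have := h ord_max; rewrite mxE unlift_none in_itv.
  move=> [h1 h2] i; rewrite mxE; case: unliftP => [j ->|->] /=; first exact: h1.
  by move: h2; rewrite in_itv.
rewrite product_measure1E//; last exact: measurable_box.
have im j : lift (@ord_max n) j = widen_ord (leqnSn n) j by exact/val_inj/lift_max.
set u := (X in (X * _)%E).
have -> : u = (\prod_(j < n) (b' j - a' j))%:E by apply: IH => j; exact: ab.
rewrite big_ord_recr/= EFinM; congr (_ * _)%E.
  by congr EFin; apply: eq_bigr => j _; rewrite /a' /b' im.
rewrite lebesgue_measure_itv/= lte_fin.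
have := ab ord_max; rewrite le_eqVlt => /orP[/eqP ->|->//].
by rewrite ltxx subrr.
Qed.

Lemma box_sub n (a b a' b' : 'I_n -> R) :
  (forall i, a' i <= a i) -> (forall i, b i <= b' i) -> box a b `<=` box a' b'.
Proof.
move=> ha hb x h i; have /andP[h1 h2] := h i.
by rewrite (le_lt_trans (ha i) h1) (le_trans h2 (hb i)).
Qed.

Lemma box_cbox n (a b : 'I_n -> R) : box a b `<=` cbox a b.
Proof. by move=> x h i; have /andP[/ltW -> ->] := h i. Qed.

End boxes.

Section integration_tools.
Context d (T : measurableType d) (R : realType) (mu : {measure set T -> \bar R}).
Implicit Types (D A : set T) (f g : T -> R).

Lemma cvg_Rintegral_dominated D (f_ : nat -> T -> R) f g :
  measurable D -> (forall m, measurable_fun D (f_ m)) -> measurable_fun D f ->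
  (forall x, D x -> f_ ^~ x @ \oo --> f x) ->
  mu.-integrable D (EFin \o g) -> (forall m x, D x -> `|f_ m x| <= g x) ->
  (fun m => \int[mu]_(x in D) f_ m x) @ \oo --> \int[mu]_(x in D) f x.
Proof.
move=> mD mf_ mf f_f ig fg.
have cE x : D x -> (fun m => (f_ m x)%:E) @ \oo --> (f x)%:E.
  by move=> Dx; apply: cvg_EFin; [exact: nearW|exact: f_f].
have [| | | | |intf _ cv] := @dominated_convergence _ _ _ mu D mD (fun m => EFin \o f_ m)
  (EFin \o f) (EFin \o g).
- by move=> m; exact/measurable_EFinP.
- exact/measurable_EFinP.
- by apply: aeW => x Dx; exact: cE.
- by [].
- by apply: aeW => x m Dx /=; rewrite lee_fin; exact: fg.
apply: fine_cvg.
rewrite fineK; first exact: cv.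
exact: integrable_fin_num.
Qed.

Lemma integrable_dominated D f g :
  measurable D -> measurable_fun D f -> mu.-integrable D (EFin \o g) ->
  (forall x, D x -> `|f x| <= g x) -> mu.-integrable D (EFin \o f).
Proof.
move=> mD mf ig fg; apply: le_integrable ig => //; first exact/measurable_EFinP.
move=> x Dx /=; rewrite lee_fin; apply: le_trans (fg x Dx) _; exact: ler_norm.
Qed.

Lemma Rintegral_indic D A f : A `<=` D ->
  \int[mu]_(x in D) (f x * \1_A x) = \int[mu]_(x in A) f x.
Proof.
move=> AD; rewrite -{2}(setIidr AD) Rintegral_mkcondr.
apply: eq_Rintegral => x _; rewrite /patch indicE.
by case: ifPn => _; rewrite ?mulr1 ?mulr0.
Qed.

Lemma integrable_indic D A f : measurable D -> measurable A -> A `<=` D ->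
  mu.-integrable A (EFin \o f) -> mu.-integrable D (EFin \o (fun x => f x * \1_A x)).
Proof.
move=> mD mA AD iA.
have -> : EFin \o (fun x => f x * \1_A x) = (EFin \o f) \_ A.
  apply/funext => x; rewrite /= /patch indicE.
  by case: ifPn => _; rewrite ?mulr1 ?mulr0.
apply: (integrableS measurableT) => //.
exact/(integrable_mkcond _ mA).
Qed.

Lemma Rintegral_sum D (I : Type) (s : seq I) (P : pred I) (F : I -> T -> R) :
  measurable D -> (forall i, P i -> mu.-integrable D (EFin \o F i)) ->
  mu.-integrable D (EFin \o (fun x => \sum_(i <- s | P i) F i x)) /\
  \int[mu]_(x in D) (\sum_(i <- s | P i) F i x) = \sum_(i <- s | P i) \int[mu]_(x in D) F i x.
Proof.
move=> mD iF; elim: s => [|i s [IH1 IH2]].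
  have -> : (fun x => \sum_(i <- [::] | P i) F i x) = cst 0.
    by apply/funext => x; rewrite big_nil.
  rewrite big_nil; split; last by rewrite Rintegral_cst// mul0r.
  exact: integrable0.
rewrite big_cons; case: ifPn => Pi.
  have -> : (fun x => \sum_(i <- i :: s | P i) F i x) =
      (fun x => F i x + \sum_(i <- s | P i) F i x).
    by apply/funext => x; rewrite big_cons Pi.
  split; last by rewrite RintegralD// ?IH2//; exact: iF.
  have := integrableD mD (iF i Pi) IH1.
  by congr (_.-integrable _ _).
have -> : (fun x => \sum_(i <- i :: s | P i) F i x) =
    (fun x => \sum_(i <- s | P i) F i x).
  by apply/funext => x; rewrite big_cons (negbTE Pi).
by split.
Qed.

End integration_tools.


(** * Smooth approximations of windows and tents *)

Section approximate_windows.
Context {R : realType}.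
Implicit Types (s t u c y M eps : R).

Lemma normr_diff4 (x1 x2 x3 x4 B : R) : `|x1| <= B -> `|x2| <= B ->
  `|x3| <= B -> `|x4| <= B -> `|x1 - x2 - (x3 - x4)| <= 4 * B.
Proof. by rewrite !ler_norml; lra. Qed.

Lemma smooth_step_itv t : 0 <= smooth_step t <= 1.
Proof.
have e0 : 0 < @flat_exp R 0 (expR (-1)) by rewrite flat_exp_gt0// expR_gt0.
rewrite /smooth_step divr_ge0 ?flat_exp_ge0//= ler_pdivrMr// mul1r.
by apply: le_flat_exp0; rewrite gerBl flat_exp_ge0.
Qed.

Lemma derive1_smooth_step_out t : t <= 0 \/ 1 <= t -> derive1 (@smooth_step R) t = 0.
Proof.
have ds x : derivable (@smooth_step R) x 1 by have [] := smooth_smooth_step (R := R) 1%N.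
have i01 x : 0 <= @smooth_step R x <= 1 by exact: smooth_step_itv.
have tt : t \in `]t - 1, t + 1[ by rewrite in_itv/=; apply/andP; split; lra.
have tl : t - 1 <= t + 1 by lra.
rewrite derive1E; move=> [t0|t1].
  have mint x : x \in `]t - 1, t + 1[ -> smooth_step t <= smooth_step x.
    by move=> _; rewrite (smooth_step_le0 t0); have /andP[] := i01 x.
  by have [_ ->] := @derive1_at_min R (@smooth_step R) _ _ t tl (fun x _ => ds x) tt mint.
have maxt x : x \in `]t - 1, t + 1[ -> smooth_step x <= smooth_step t.
  by move=> _; rewrite (smooth_step_ge1 t1); have /andP[] := i01 x.
by have [_ ->] := @derive1_at_max R (@smooth_step R) _ _ t tl (fun x _ => ds x) tt maxt.
Qed.

(** A smooth substitute for the positive part. It agrees with t for t >= 1, so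
    that a difference of two translates is constant far out and two such
    constants can be made to cancel. *)
Definition smooth_ramp t : R := t * smooth_step t.

Lemma smooth_smooth_ramp : smooth smooth_ramp.
Proof. by apply: smoothM; [exact: smooth_id|exact: smooth_smooth_step]. Qed.

Lemma derive1_smooth_ramp t :
  derive1 smooth_ramp t = t * derive1 (@smooth_step R) t + smooth_step t.
Proof.
have ds x : derivable (@smooth_step R) x 1 by have [] := smooth_smooth_step (R := R) 1%N.
rewrite derive1E; have := is_deriveM (is_derive_id t (1 : R)) (derivableP (ds t)).
move=> [_]; rewrite -[(_ * _)%R]/smooth_ramp => ->.
by rewrite derive1E /GRing.scale /= mulr1.
Qed.

Lemma derive1_smooth_ramp_le0 t : t <= 0 -> derive1 smooth_ramp t = 0.
Proof.
move=> t0; rewrite derive1_smooth_ramp derive1_smooth_step_out; last by left.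
by rewrite smooth_step_le0// mulr0 addr0.
Qed.

Lemma derive1_smooth_ramp_ge1 t : 1 <= t -> derive1 smooth_ramp t = 1.
Proof.
move=> t1; rewrite derive1_smooth_ramp derive1_smooth_step_out; last by right.
by rewrite smooth_step_ge1// mulr0 add0r.
Qed.

Lemma derive1_smooth_ramp_bounded :
  exists2 C, 0 <= C & forall t, `|derive1 smooth_ramp t| <= C.
Proof.
apply: (@bounded_of_continuous_const_tails _ _ 1).
- exact/smooth_continuous/smooth_derive1/smooth_smooth_ramp.
- exact: derive1_smooth_ramp_le0.
- exact: derive1_smooth_ramp_ge1.
Qed.

(** As M grows, step_at tends to the indicator of t > c and ramp_at to the
    positive part of t - c; dramp_at is the derivative of ramp_at. *)
Definition step_at M c t : R := smooth_step (M * (t - c)).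
Definition ramp_at M c t : R := M^-1 * smooth_ramp (M * (t - c)).
Definition dramp_at M c t : R := derive1 smooth_ramp (M * (t - c)).

Let affineE M c : (fun t => M * (t - c)) = (fun t => M * t + (- (M * c))).
Proof. by apply/funext => t; rewrite mulrBr. Qed.

Lemma smooth_step_at M c : smooth (step_at M c).
Proof.
apply: smooth_comp; first exact: smooth_smooth_step.
by rewrite affineE; exact: smooth_affine.
Qed.

Lemma smooth_ramp_at M c : smooth (ramp_at M c).
Proof.
apply: smoothZ; apply: smooth_comp; first exact: smooth_smooth_ramp.
by rewrite affineE; exact: smooth_affine.
Qed.

Lemma is_derive_ramp_at M c t : M != 0 ->
  is_derive t 1 (ramp_at M c) (dramp_at M c t).
Proof.
move=> M0.
have da : is_derive t 1 (fun t => M * (t - c)) M.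
  have := is_deriveZ M (is_deriveB (is_derive_id t (1 : R)) (is_derive_cst c t 1)).
  by rewrite subr0 /GRing.scale /= mulr1.
have dr : is_derive (M * (t - c)) 1 smooth_ramp (dramp_at M c t).
  exact: (smooth_is_derive smooth_smooth_ramp).
have := is_deriveZ M^-1 (is_derive1_comp (g := fun t => M * (t - c)) dr da).
by rewrite /GRing.scale /= mulrCA mulVf ?mulr1.
Qed.

Lemma ramp_atE M c t : M != 0 -> ramp_at M c t = (t - c) * step_at M c t.
Proof. by move=> M0; rewrite /ramp_at /smooth_ramp mulrA mulKf. Qed.

Definition window M a b t : R := step_at M a t - step_at M b t.

(** The derivative is close to the indicator of ]s, s + eps] minus that of
    ]u, u + eps]. Both pairs of ramps end at the constant eps, so their
    difference has compact support. *)
Definition bridge M s u eps t : R :=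
  ramp_at M s t - ramp_at M (s + eps) t - (ramp_at M u t - ramp_at M (u + eps) t).

Definition dbridge M s u eps t : R :=
  dramp_at M s t - dramp_at M (s + eps) t - (dramp_at M u t - dramp_at M (u + eps) t).

Lemma smooth_window M a b : smooth (window M a b).
Proof. by apply: smoothB; exact: smooth_step_at. Qed.

Lemma smooth_bridge M s u eps : smooth (bridge M s u eps).
Proof. by apply: smoothB; apply: smoothB; exact: smooth_ramp_at. Qed.

Lemma derive1_bridge M s u eps : M != 0 ->
  derive1 (bridge M s u eps) = dbridge M s u eps.
Proof.
move=> M0; apply/funext => t; rewrite derive1E.
have d c := is_derive_ramp_at c t M0.
by have [] := is_deriveB (is_deriveB (d s) (d (s + eps))) (is_deriveB (d u) (d (u + eps))).
Qed.

Section scale.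
Variables (del M : R).
Hypotheses (del0 : 0 < del) (M1 : 1 <= M * del).

Let M0 : 0 < M.
Proof. by rewrite -(pmulr_lgt0 _ del0); exact: lt_le_trans M1. Qed.
Let Mn0 : M != 0. Proof. by rewrite gt_eqF. Qed.

Let arg_le0 c t : t <= c -> M * (t - c) <= 0.
Proof. by move=> tc; rewrite mulr_ge0_le0 ?subr_le0// ltW. Qed.
Let arg_ge1 c t : c + del <= t -> 1 <= M * (t - c).
Proof. by move=> tc; apply: (le_trans M1); rewrite ler_pM2l//; lra. Qed.

Lemma window_support a b t : a <= b -> window M a b t != 0 -> a <= t <= b + del.
Proof.
move=> ab; apply: contraNT; rewrite negb_and -!ltNge => /orP[ta|tb]; apply/eqP; rewrite /window /step_at.
  by rewrite !smooth_step_le0 ?subrr//; apply: arg_le0; lra.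
by rewrite !smooth_step_ge1 ?subrr//; apply: arg_ge1; lra.
Qed.

Lemma window_bound a b t : `|window M a b t| <= 1.
Proof.
have := smooth_step_itv (M * (t - a)); have := smooth_step_itv (M * (t - b)).
rewrite /window /step_at; move: (smooth_step _) (smooth_step _) => x y.
by rewrite ler_norml => hx hy; lra.
Qed.

Section bridge.
Variables (a b s u eps : R).
Hypotheses (e0 : 0 <= eps) (as_ : a <= s) (sb : s + eps <= b) (au : a <= u) (ub : u + eps <= b).

Lemma bridge_support t : bridge M s u eps t != 0 -> a <= t <= b + del.
Proof.
have [d0 h0 [h1 h2] [h3 h4]] := And4 del0 e0 (conj as_ sb) (conj au ub).
apply: contraNT; rewrite negb_and -!ltNge => /orP[ta|tb]; apply/eqP.
  rewrite /bridge !(ramp_atE _ _ Mn0) /step_at.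
  by rewrite !smooth_step_le0 ?mulr0 ?subrr//; apply: arg_le0; lra.
rewrite /bridge !(ramp_atE _ _ Mn0) /step_at.
rewrite !smooth_step_ge1; [lra|apply: arg_ge1; lra..].
Qed.

Lemma dbridge_support t : dbridge M s u eps t != 0 -> a <= t <= b + del.
Proof.
have [d0 h0 [h1 h2] [h3 h4]] := And4 del0 e0 (conj as_ sb) (conj au ub).
apply: contraNT; rewrite negb_and -!ltNge => /orP[ta|tb]; apply/eqP; rewrite /dbridge /dramp_at.
  by rewrite !derive1_smooth_ramp_le0 ?subrr//; apply: arg_le0; lra.
by rewrite !derive1_smooth_ramp_ge1 ?subrr//; apply: arg_ge1; lra.
Qed.

Lemma bridge_bound t : `|bridge M s u eps t| <= 4 * (b + del - a).
Proof.
have [d0 h0 [h1 h2] [h3 h4]] := And4 del0 e0 (conj as_ sb) (conj au ub).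
have [->|/bridge_support/andP[t1 t2]] := eqVneq (bridge M s u eps t) 0.
  by rewrite normr0; lra.
have r c : a <= c -> c <= b -> `|ramp_at M c t| <= b + del - a.
  move=> ac cb; rewrite (ramp_atE _ _ Mn0) normrM.
  have /andP[s0 s1] := smooth_step_itv (M * (t - c)).
  rewrite -[leRHS]mulr1 ler_pM//; last by rewrite ger0_norm.
  by rewrite ler_norml; apply/andP; split; lra.
by rewrite /bridge; apply: normr_diff4; apply: r; lra.
Qed.

Lemma dbridge_bound C t : (forall t, `|derive1 smooth_ramp t| <= C) ->
  `|dbridge M s u eps t| <= 4 * C.
Proof.
by move=> hC; apply: normr_diff4; exact: hC.
Qed.

End bridge.
End scale.

Definition sharp_window a b t : R := (0 < t - a)%R%:R - (0 < t - b)%R%:R.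

(** The limit of bridge as M grows: a primitive of the difference of the
    indicators of ]s, s + eps] and ]u, u + eps]. *)
Definition tent s u eps t : R :=
  (t - s) * (0 < t - s)%R%:R - (t - (s + eps)) * (0 < t - (s + eps))%R%:R
  - ((t - u) * (0 < t - u)%R%:R - (t - (u + eps)) * (0 < t - (u + eps))%R%:R).

Lemma sharp_windowE a b t : a <= b -> sharp_window a b t = (a < t <= b)%R%:R.
Proof.
move=> ab; rewrite /sharp_window !subr_gt0; case: (ltP a t) => ta /=.
  by case: (ltP b t) => tb /=; rewrite ?subrr ?subr0.
by rewrite ltNge (le_trans ta ab)/= subrr.
Qed.

Lemma tent_bound a b s u eps t :
  0 <= eps -> a <= s -> s + eps <= b -> a <= u -> u + eps <= b ->
  `|tent s u eps t| <= eps * (a < t <= b)%R%:R.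
Proof.
move=> e0 as_ sb au ub.
pose clamp c := (t - c) * (0 < t - c)%R%:R - (t - (c + eps)) * (0 < t - (c + eps))%R%:R.
have c01 c : 0 <= clamp c <= eps.
  rewrite /clamp !subr_gt0; case: (ltP c t) => h1; case: (ltP (c + eps) t) => h2;
    rewrite /= ?mulr1 ?mulr0; apply/andP; split; lra.
have c0 c : t <= c -> clamp c = 0.
  move=> tc; rewrite /clamp !subr_gt0 ltNge tc/= ltNge (le_trans tc) ?lerDl//=.
  by rewrite !mulr0 subrr.
have c1 c : c + eps < t -> clamp c = eps.
  move=> tc; rewrite /clamp !subr_gt0 tc.
  have -> /= : c < t by apply: le_lt_trans tc; rewrite lerDl.
  by rewrite !mulr1; lra.
rewrite /tent -/(clamp s) -/(clamp u).
case: (ltP a t) => ta /=; last first.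
  by rewrite mulr0 !c0 ?subrr ?normr0//; [exact: le_trans ta au|exact: le_trans ta as_].
case: (lerP t b) => tb /=; last first.
  rewrite mulr0 !c1 ?subrr ?normr0//; [exact: le_lt_trans ub tb|exact: le_lt_trans sb tb].
have := c01 s; have := c01 u; rewrite mulr1 ler_norml; lra.
Qed.

Section limits.
Variable del : R.
Hypothesis del0 : 0 < del.

Definition scale_seq (m : nat) : R := m.+1%:R / del.

Lemma scale_seq_ge m : 1 <= scale_seq m * del.
Proof. by rewrite /scale_seq mulfVK ?gt_eqF// ler1n. Qed.

Lemma cvg_profile (h : R -> R) y : (forall t, t <= 0 -> h t = 0) ->
  (forall t, 1 <= t -> h t = 1) ->
  (fun m => h (scale_seq m * y)) @ \oo --> ((0 < y)%R%:R : R).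
Proof.
move=> h0 h1; case: (ltP 0 y) => y0 /=.
  apply: cvg_near_cst.
  near=> m; apply/h1.
  have : del / y <= m%:R by near: m; exact: nbhs_infty_ger.
  rewrite ler_pdivrMr// => hm.
  rewrite /scale_seq mulrAC ler_pdivlMr// mul1r (le_trans hm)//.
  by apply: ler_wpM2r; [exact: ltW|rewrite ler_nat].
apply: cvg_near_cst; apply: nearW => m; apply: h0.
rewrite mulr_ge0_le0// divr_ge0// ltW.
Unshelve. all: by end_near. Qed.

Lemma cvg_window a b t :
  (fun m => window (scale_seq m) a b t) @ \oo --> sharp_window a b t.
Proof.
by apply: cvgB; apply: cvg_profile => x; [exact: smooth_step_le0|exact: smooth_step_ge1
  |exact: smooth_step_le0|exact: smooth_step_ge1].
Qed.

Lemma cvg_bridge s u eps t :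
  (fun m => bridge (scale_seq m) s u eps t) @ \oo --> tent s u eps t.
Proof.
have r c : (fun m => ramp_at (scale_seq m) c t) @ \oo --> (t - c) * (0 < t - c)%R%:R.
  have -> : (fun m => ramp_at (scale_seq m) c t) =
      (fun m => (t - c) * smooth_step (scale_seq m * (t - c))).
    apply/funext => m; rewrite ramp_atE// gt_eqF//.
    by rewrite /scale_seq divr_gt0// ltr0n.
  apply: cvgMr; apply: cvg_profile => x; [exact: smooth_step_le0|exact: smooth_step_ge1].
by apply: cvgB; apply: cvgB; exact: r.
Qed.

Lemma cvg_dbridge s u eps t :
  (fun m => dbridge (scale_seq m) s u eps t) @ \oo -->
  sharp_window s (s + eps) t - sharp_window u (u + eps) t.
Proof.
have r c : (fun m => dramp_at (scale_seq m) c t) @ \oo --> ((0 < t - c)%R%:R : R).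
  apply: cvg_profile => x; [exact: derive1_smooth_ramp_le0|exact: derive1_smooth_ramp_ge1].
by apply: cvgB; apply: cvgB; exact: r.
Qed.

End limits.
End approximate_windows.


(** * Integrals of a weakly differentiable function over parallel slabs *)

Section products_of_factors.
Context {R : realType}.
Variable n : nat.
Implicit Types (g : 'I_n -> R -> R) (x : 'rV[R]_n).

Lemma cvg_prodf (u : nat -> 'I_n -> R -> R) g x :
  (forall j, (fun m => u m j (x ord0 j)) @ \oo --> g j (x ord0 j)) ->
  (fun m => prodf (u m) x) @ \oo --> prodf g x.
Proof.
move=> ug; rewrite /prodf; elim: (index_enum _) => [|j s IH].
  by rewrite big_nil; under eq_fun do rewrite big_nil; exact: cvg_cst.
by rewrite big_cons; under eq_fun do rewrite big_cons; apply: cvgM.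
Qed.

Lemma measurable_prodf g : (forall j, measurable_fun setT (g j)) ->
  measurable_fun setT (prodf g).
Proof.
move=> mg; rewrite /prodf; elim: (index_enum _) => [|j s IH].
  by under eq_fun do rewrite big_nil; exact: measurable_cst.
under eq_fun do rewrite big_cons.
apply: measurable_funM => //.
exact: (measurableT_comp (mg j) (measurable_row_coord j)).
Qed.

Lemma prodf_dominated g (a b : 'I_n -> R) (i : 'I_n) (B : R) x :
  (forall j, j != i -> `|g j (x ord0 j)| <= 1) -> `|g i (x ord0 i)| <= B ->
  (forall j t, g j t != 0 -> a j <= t <= b j) ->
  `|prodf g x| <= B * \1_(cbox a b) x.
Proof.
move=> g1 gB supp; rewrite indicE.
have [xK|xK] := boolP (x \in cbox a b).
  rewrite mulr1 /prodf (bigD1 i)//= normrM -[leRHS]mulr1 ler_pM//.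
  rewrite normr_prod; apply: prodr_ile1 => j ji; rewrite normr_ge0/=.
  exact: g1.
rewrite mulr0 normr_le0 /prodf; apply/eqP.
have [j jK] : exists j, ~ (a j <= x ord0 j <= b j).
  by apply/existsNP => h; move/negP: xK; apply; rewrite inE.
rewrite (bigD1 j)//=; suff -> : g j (x ord0 j) = 0 by rewrite mul0r.
by apply/eqP; apply: contra_notT jK; exact: supp.
Qed.

Lemma prod_sharp_window (a b : 'I_n -> R) x : (forall j, a j <= b j) ->
  prodf (fun j => sharp_window (a j) (b j)) x = \1_(box a b) x.
Proof.
move=> ab; rewrite indicE /prodf.
under eq_bigr do rewrite sharp_windowE//.
have [xB|xB] := boolP (x \in box a b).
  rewrite big1// => j _; move: xB; rewrite inE => /(_ j) -> //.
have [j jK] : exists j, ~ (a j < x ord0 j <= b j).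
  by apply/existsNP => h; move/negP: xB; apply; rewrite inE.
by rewrite (bigD1 j)//=; move/negP/negbTE: jK => ->; rewrite mul0r.
Qed.

End products_of_factors.

Section neighbouring_slabs.
Context {R : realType}.
Variables (n : nat) (D : set 'rV[R]_n) (f : 'rV[R]_n -> R) (G : 'rV[R]_n -> 'rV[R]_n).
Hypotheses (mD : measurable D) (lf : loc_integrable D f) (wG : is_weak_gradient D f G).
Local Notation mu := (lebesgue_row n).

Lemma loc_integrable_cbox (h : 'rV[R]_n -> R) (a b : 'I_n -> R) :
  loc_integrable D h -> cbox a b `<=` D -> mu.-integrable (cbox a b) (EFin \o h).
Proof.
move=> [mh ih] KD; apply/integrableP; split.
  by apply/measurable_EFinP; exact: measurable_funS mh.
by apply: ih => //; exact: compact_cbox.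
Qed.

Lemma loc_integrable_box (h : 'rV[R]_n -> R) (a b : 'I_n -> R) :
  loc_integrable D h -> cbox a b `<=` D -> mu.-integrable (box a b) (EFin \o h).
Proof.
move=> lh KD; apply: integrableS (loc_integrable_cbox lh KD).
- exact: measurable_cbox.
- exact: measurable_box.
- exact: box_cbox.
Qed.

Variables (c e : 'I_n -> R) (i : 'I_n) (s u eps del : R).
Hypotheses (del0 : 0 < del) (eps0 : 0 <= eps) (ce : forall j, c j <= e j).
Hypotheses (cs : c i <= s) (se : s + eps <= e i) (cu : c i <= u) (ue : u + eps <= e i).
Hypothesis KD : cbox c (fun j => e j + del) `<=` D.

Definition slab (v : R) : set 'rV[R]_n :=
  box (fun j => if j == i then v else c j) (fun j => if j == i then v + eps else e j).

Let K := cbox c (fun j => e j + del).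

Let approx m j : R -> R :=
  if j == i then bridge (scale_seq del m) s u eps
  else window (scale_seq del m) (c j) (e j).

Let approx_limit j : R -> R :=
  if j == i then tent s u eps else sharp_window (c j) (e j).

Let smooth_approx m j : smooth (approx m j).
Proof.
by rewrite /approx; case: ifPn => _; [exact: smooth_bridge|exact: smooth_window].
Qed.

Let M1 m := scale_seq_ge del0 m.

Let Mn0 m : scale_seq del m != 0.
Proof. by rewrite gt_eqF// /scale_seq divr_gt0// ltr0n. Qed.

Let approx_support m j t : approx m j t != 0 -> c j <= t <= e j + del.
Proof.
rewrite /approx; case: ifPn => [/eqP ->|_].
  exact: (bridge_support del0 (M1 m) eps0 cs se cu ue).
exact: (window_support del0 (M1 m) (ce j)).
Qed.

Let dapprox_support m j t : derive_factor i (approx m) j t != 0 -> c j <= t <= e j + del.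
Proof.
rewrite /derive_factor; case: ifPn => [/eqP ->|_]; last exact: approx_support.
rewrite /approx eqxx derive1_bridge//.
exact: (dbridge_support del0 (M1 m) eps0 cs se cu ue).
Qed.

Let test_approx m : test_function D (prodf (approx m)).
Proof.
apply: (test_function_prodf (a := c) (b := fun j => e j + del)) => //.
exact: approx_support.
Qed.

Let approx_bound m x : `|prodf (approx m) x| <= (4 * (e i + del - c i)) * \1_K x.
Proof.
apply: (prodf_dominated (i := i)) => [j ji| |]; last exact: approx_support.
  by rewrite /approx (negbTE ji); exact: window_bound.
rewrite /approx eqxx; exact: (bridge_bound del0 (M1 m) eps0 cs se cu ue).
Qed.

Let dapprox_bound C m x : (forall t, `|derive1 (@smooth_ramp R) t| <= C) ->
  `|prodf (derive_factor i (approx m)) x| <= (4 * C) * \1_K x.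
Proof.
move=> hC; apply: (prodf_dominated (i := i)) => [j ji| |]; last exact: dapprox_support.
  by rewrite /derive_factor /approx (negbTE ji); exact: window_bound.
rewrite /derive_factor /approx !eqxx derive1_bridge//; exact: dbridge_bound.
Qed.

Let cvg_approx x : (fun m => prodf (approx m) x) @ \oo --> prodf approx_limit x.
Proof.
apply: cvg_prodf => j; rewrite /approx_limit /approx.
by case: ifPn => _; [exact: cvg_bridge|exact: cvg_window].
Qed.

Let slab_window v : c i <= v -> v + eps <= e i ->
  forall x, \1_(slab v) x = sharp_window v (v + eps) (x ord0 i) *
    \prod_(j < n | j != i) sharp_window (c j) (e j) (x ord0 j) :> R.
Proof.
move=> h1 h2 x; rewrite -prod_sharp_window.
  rewrite /prodf (bigD1 i)//= eqxx; congr (_ * _).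
  by apply: eq_bigr => j /negbTE ->.
by move=> j; case: ifPn => _ //; rewrite lerDl.
Qed.

Let cvg_dapprox x : (fun m => prodf (derive_factor i (approx m)) x) @ \oo -->
  (\1_(slab s) x - \1_(slab u) x : R).
Proof.
rewrite !slab_window// -mulrBl.
pose g j := if j == i then fun t => sharp_window s (s + eps) t - sharp_window u (u + eps) t
  else sharp_window (c j) (e j).
have -> : (sharp_window s (s + eps) (x ord0 i) - sharp_window u (u + eps) (x ord0 i)) *
    \prod_(j < n | j != i) sharp_window (c j) (e j) (x ord0 j) = prodf g x.
  rewrite /prodf [RHS](bigD1 i)//= /g eqxx; congr (_ * _).
  by apply: eq_bigr => j /negbTE ->.
apply: cvg_prodf => j; rewrite /derive_factor /g; case: ifPn => ji.
  rewrite /approx eqxx; under eq_fun do rewrite derive1_bridge//.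
  exact: cvg_dbridge.
by rewrite /approx (negbTE ji); exact: cvg_window.
Qed.

Let measurable_smooth_prodf (g : 'I_n -> R -> R) :
  (forall j, smooth (g j)) -> measurable_fun D (prodf g).
Proof.
move=> sg; apply: (measurable_funS measurableT) => //.
apply: measurable_prodf => j.
by apply: continuous_measurable_fun; exact: smooth_continuous.
Qed.

Let smooth_dapprox m j : smooth (derive_factor i (approx m) j).
Proof.
rewrite /derive_factor; case: ifPn => _; last exact: smooth_approx.
exact/smooth_derive1/smooth_approx.
Qed.

Let mK : measurable K. Proof. exact: measurable_cbox. Qed.

Let integrable_dom (h : 'rV[R]_n -> R) (B : R) : loc_integrable D h ->
  mu.-integrable D (EFin \o (fun x => B * (`|h x| * \1_K x))).
Proof.
move=> lh.
have i1 : mu.-integrable D (EFin \o (fun x => `|h x| * \1_K x)).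
  apply: integrable_indic => //.
  exact: (integrable_norm (loc_integrable_cbox lh KD)).
have := integrableZl mD B i1.
by congr (_.-integrable _ _).
Qed.

Let measurable_slab v : measurable (slab v). Proof. exact: measurable_box. Qed.

Let slab_sub v : c i <= v -> v + eps <= e i -> slab v `<=` K.
Proof.
move=> h1 h2 x xs j; have := xs j; have d0 := del0.
by case: ifPn => [/eqP ->|_] => h; lra.
Qed.

Let measurable_D (h : 'rV[R]_n -> R) : loc_integrable D h -> measurable_fun D h.
Proof. by case. Qed.

Let wD : measurable_fun D (fun x => \1_(slab s) x - \1_(slab u) x : R).
Proof.
by apply: measurable_funB; apply: (measurable_funS measurableT) => //; exact: measurable_indic.
Qed.

Let mlim : measurable_fun D (prodf approx_limit).
Proof.
apply: (measurable_fun_cvg (h := fun m => prodf (approx m))) => //.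
  by move=> m; exact: measurable_smooth_prodf.
Qed.

Let slab_identity :
  \int[mu]_(x in D) (f x * (\1_(slab s) x - \1_(slab u) x)) =
  - \int[mu]_(x in D) (G x ord0 i * prodf approx_limit x).
Proof.
have [C C0 hC] := @derive1_smooth_ramp_bounded R.
have [lG wGi] := wG i.
have L : (fun m => \int[mu]_(x in D) (f x * prodf (derive_factor i (approx m)) x)) @ \oo -->
    \int[mu]_(x in D) (f x * (\1_(slab s) x - \1_(slab u) x)).
  apply: (cvg_Rintegral_dominated (g := fun x => (4 * C) * (`|f x| * \1_K x))) => //.
  - move=> m; apply: measurable_funM; first exact: measurable_D.
    exact: measurable_smooth_prodf.
  - by apply: measurable_funM => //; exact: measurable_D.
  - by move=> x _; apply: cvgMr; exact: cvg_dapprox.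
  - exact: integrable_dom.
  - by move=> m x _; rewrite normrM mulrCA ler_wpM2l// dapprox_bound.
have Rg : (fun m => - \int[mu]_(x in D) (G x ord0 i * prodf (approx m) x)) @ \oo -->
    - \int[mu]_(x in D) (G x ord0 i * prodf approx_limit x).
  apply: cvgN.
  apply: (cvg_Rintegral_dominated
    (g := fun x => (4 * (e i + del - c i)) * (`|G x ord0 i| * \1_K x))) => //.
  - move=> m; apply: measurable_funM; first exact: measurable_D.
    exact: measurable_smooth_prodf.
  - by apply: measurable_funM => //; exact: measurable_D.
  - by move=> x _; apply: cvgMr; exact: cvg_approx.
  - exact: integrable_dom.
  - by move=> m x _; rewrite normrM mulrCA ler_wpM2l// approx_bound.
apply: (cvg_unique _ L) => //=.
apply: cvg_trans Rg; apply: near_eq_cvg; apply: nearW => m.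
rewrite -(wGi _ (test_approx m)); congr Rintegral; apply/funext => x; congr (_ * _).
by have [_ ->] := is_derive_prodf (i := i) x (fun t => (smooth_approx m i 1%N).1 t).
Qed.

Let limit_bound x : `|prodf approx_limit x| <= eps * \1_(box c e) x.
Proof.
have -> : \1_(box c e) x = (c i < x ord0 i <= e i)%R%:R *
    \prod_(j < n | j != i) sharp_window (c j) (e j) (x ord0 j) :> R.
  by rewrite -prod_sharp_window// /prodf (bigD1 i)//= sharp_windowE.
rewrite /prodf (bigD1 i)//= {1}/approx_limit eqxx mulrA normrM.
apply: ler_pM => //; first exact: tent_bound.
rewrite ger0_norm.
  by apply: ler_prod => j /negbTE ji; rewrite /approx_limit ji sharp_windowE// ler0n lexx.
by apply: prodr_ge0 => j /negbTE ji; rewrite /approx_limit ji sharp_windowE.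
Qed.

(** The weak derivative is tested on the product of a bridge in the i-th
    variable with windows in the others. In the limit the i-th derivative of
    this product is the difference of the indicators of the two slabs, while
    the product itself is at most eps, whatever the distance of the slabs. *)
Lemma slab_difference :
  `|\int[mu]_(x in slab s) f x - \int[mu]_(x in slab u) f x|
  <= eps * \int[mu]_(x in box c e) `|G x ord0 i|.
Proof.
have [lG _] := wG i.
have sK v : c i <= v -> v + eps <= e i -> slab v `<=` D.
  by move=> h1 h2; exact: subset_trans (slab_sub h1 h2) KD.
have iv v : c i <= v -> v + eps <= e i -> mu.-integrable D (EFin \o (fun x => f x * \1_(slab v) x)).
  move=> h1 h2; apply: integrable_indic => //; first exact: sK.
  apply: integrableS (loc_integrable_cbox lf KD) => //.
  exact: slab_sub.
have bK : box c e `<=` K.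
  by apply: subset_trans (@box_cbox _ _ _ _) _ => x h j; have := h j; have := del0; lra.
have bD : box c e `<=` D by exact: subset_trans bK KD.
have iG : mu.-integrable D (EFin \o (fun x => `|G x ord0 i| * \1_(box c e) x)).
  apply: integrable_indic => //; first exact: measurable_box.
  apply: integrableS (integrable_norm (loc_integrable_cbox lG KD)) => //.
  exact: measurable_box.
rewrite -(Rintegral_indic _ _ (sK s cs se)) -(Rintegral_indic _ _ (sK u cu ue)).
rewrite -RintegralB//; [|exact: iv..].
have -> : \int[mu]_(x in D) (f x * \1_(slab s) x - f x * \1_(slab u) x) =
    \int[mu]_(x in D) (f x * (\1_(slab s) x - \1_(slab u) x)).
  by congr Rintegral; apply/funext => x; rewrite mulrBr.
rewrite slab_identity normrN.
have iE : mu.-integrable D (EFin \o (fun x => eps * (`|G x ord0 i| * \1_(box c e) x))).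
  have := integrableZl mD eps iG.
  by congr (_.-integrable _ _).
have bnd x : D x -> `|G x ord0 i * prodf approx_limit x| <= eps * (`|G x ord0 i| * \1_(box c e) x).
  by move=> _; rewrite normrM mulrCA ler_wpM2l// limit_bound.
have iP : mu.-integrable D (EFin \o (fun x => G x ord0 i * prodf approx_limit x)).
  apply: integrable_dominated iE bnd => //.
  by apply: measurable_funM => //; exact: measurable_D.
apply: (le_trans (le_normr_Rintegral mD iP)).
rewrite -(Rintegral_indic _ _ bD) -RintegralZl//.
apply: le_Rintegral => //.
exact: (integrable_norm iP).
Qed.

End neighbouring_slabs.


(** * Grids of cells *)

Section grid_poincare.
Context {R : realType}.
Variables (n L : nat).
Local Notation index := {ffun 'I_n -> 'I_L}.

Definition set_coord (r : index) (i : 'I_n) (t : 'I_L) : index :=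
  [ffun j => if j == i then t else r j].

Let mix (k : nat) (r s : index) : index := [ffun j : 'I_n => if (j < k)%N then s j else r j].

Lemma sum_pair_mix (k : nat) (T : index -> R) :
  \sum_(rs : index * index) T (mix k rs.1 rs.2) = \sum_(rs : index * index) T rs.1.
Proof.
pose h (rs : index * index) := (mix k rs.1 rs.2, mix k rs.2 rs.1).
have hK : involutive h.
  move=> [r s]; rewrite /h /=; congr pair; apply/ffunP => j; rewrite !ffunE;
    by case: (j < k)%N.
rewrite [RHS](reindex_inj (inv_inj hK)).
by [].
Qed.

(** Two indices are joined by changing one coordinate at a time; summed over
    all pairs of indices, every intermediate index is met equally often,
    because exchanging the tails of the pair is an involution. *)
Lemma grid_poincare (F : index -> R) (T : 'I_n -> index -> R) :
  (forall r i t, `|F r - F (set_coord r i t)| <= T i r) ->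
  \sum_(rs : index * index) `|F rs.1 - F rs.2| <=
  (#|{: index}|)%:R * \sum_(i < n) \sum_r T i r.
Proof.
move=> FT.
have step (rs : index * index) : `|F rs.1 - F rs.2| <= \sum_(i < n) T i (mix i rs.1 rs.2).
  case: rs => r s /=.
  have m0 : mix 0 r s = r by apply/ffunP => j; rewrite ffunE.
  have mn : mix n r s = s by apply/ffunP => j; rewrite ffunE ltn_ord.
  have mS (i : 'I_n) : mix i.+1 r s = set_coord (mix i r s) i (s i).
    apply/ffunP => j; rewrite !ffunE ltnS leq_eqVlt.
    have [/val_inj ->|] := eqVneq (j : nat) i; first by rewrite eqxx.
    by move=> ji; rewrite (_ : (j == i) = false)//; apply/negbTE; apply: contra ji => /eqP ->.
  have := telescope_sumr (fun k => F (mix k r s)) (leq0n n).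
  rewrite m0 mn big_mkord distrC => <-; apply: (le_trans (ler_norm_sum _ _ _)).
  by apply: ler_sum => i _; rewrite mS distrC; exact: FT.
apply: (le_trans (ler_sum _ (fun rs _ => step rs))).
rewrite exchange_big/= mulr_sumr; apply: ler_sum => i _.
rewrite sum_pair_mix -(pair_bigA _ (fun r _ => T i r))/= mulr_sumr.
by apply: ler_sum => r _; rewrite sumr_const mulr_natl.
Qed.

End grid_poincare.

Section cells.
Context {R : realType}.
Variables (n : nat) (a : 'I_n -> R).

Definition cell (L : nat) (eps : R) (r : {ffun 'I_n -> 'I_L}) : set 'rV[R]_n :=
  box (fun j => a j + eps * (r j)%:R) (fun j => a j + eps * (r j).+1%:R).

Lemma ord_ceil (L : nat) (y : R) : 0 < y <= L%:R ->
  exists t : 'I_L, t%:R < y <= t.+1%:R.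
Proof.
elim: L => [|L IH]; first by move=> /andP[h1 h2]; lra.
move=> /andP[y0 yL]; case: (lerP y L%:R) => h.
  have [|t ht] := IH; first by rewrite y0.
  by exists (widen_ord (leqnSn L) t).
by exists ord_max; rewrite h yL.
Qed.

Lemma nat_ceil_uniq (s t : nat) (y : R) :
  s%:R < y <= s.+1%:R -> t%:R < y <= t.+1%:R -> s = t.
Proof.
move=> /andP[s1 s2] /andP[t1 t2].
have : (s%:R : R) < t.+1%:R by exact: lt_le_trans t2.
have : (t%:R : R) < s.+1%:R by exact: lt_le_trans s2.
by rewrite !ltr_nat !ltnS => h1 h2; apply/eqP; rewrite eqn_leq h1 h2.
Qed.

Section cells_of_size.
Variables (L : nat) (eps : R).
Hypothesis eps0 : 0 < eps.
Implicit Types (r s : {ffun 'I_n -> 'I_L}).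

Lemma cellP r x : cell eps r x <->
  forall j, (r j)%:R < (x ord0 j - a j) / eps <= (r j).+1%:R.
Proof.
split=> h j; have := h j; rewrite ltr_pdivlMr// ler_pdivrMr//.
  by rewrite ltrBrDl lerBlDl ![eps * _]mulrC.
by rewrite ltrBrDl lerBlDl ![eps * _]mulrC.
Qed.

Lemma cell_uniq r s x : cell eps r x -> cell eps s x -> r = s.
Proof.
move=> /cellP hr /cellP hs; apply/ffunP => j; apply/val_inj.
exact: nat_ceil_uniq (hr j) (hs j).
Qed.

Lemma cell_exists x : box a (fun j => a j + eps * L%:R) x -> exists r, cell eps r x.
Proof.
move=> xU.
have /choice[t ht] j : exists t : 'I_L, t%:R < (x ord0 j - a j) / eps <= t.+1%:R.
  apply: ord_ceil; have /andP[h1 h2] := xU j.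
  by rewrite divr_gt0 ?subr_gt0//= ler_pdivrMr// lerBlDl mulrC.
by exists [ffun j => t j]; apply/cellP => j; rewrite ffunE.
Qed.

Lemma cell_sub r : cell eps r `<=` box a (fun j => a j + eps * L%:R).
Proof.
apply: box_sub => j; first by rewrite lerDl mulr_ge0// ltW.
by rewrite lerD2l ler_pM2l// ler_nat.
Qed.

Lemma lebesgue_row_cell r : lebesgue_row n (cell eps r) = (eps ^+ n)%:E.
Proof.
rewrite lebesgue_row_box; last first.
  by move=> j; rewrite lerD2l ler_pM2l// ler_nat.
congr EFin; rewrite -[n in RHS]card_ord -prodr_const.
apply: eq_bigr => j _; rewrite -natr1; ring.
Qed.

End cells_of_size.
End cells.

Section box_open_sets.
Context {R : realType}.
Variable n : nat.

(** Openness expressed with boxes, which is how the cells of a grid exhaust a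
    set. *)
Definition sup_open (A : set 'rV[R]_n) : Prop := forall x, A x ->
  exists2 del, 0 < del & forall y : 'rV[R]_n, (forall j, `|x ord0 j - y ord0 j| <= del) -> A y.

Lemma open_sup_open (A : set 'rV[R]_n) : open A -> sup_open A.
Proof.
move=> oA x Ax; have := open_nbhs_nbhs (conj oA Ax).
move=> /nbhs_ballP[e /= e0 he]; exists (e / 2); first by rewrite divr_gt0.
move=> y xy; apply: he; split => // i j; rewrite ord1 /ball /=.
by apply: (le_lt_trans (xy j)); rewrite ltr_pdivrMr// ltr_pMr// ltr1n.
Qed.

Variables (a : 'I_n -> R) (S : R).
Hypothesis S0 : 0 < S.
Let U := box a (fun j => a j + S).
Let eps (l : nat) : R := S / l.+1%:R.
Let eps0 l : 0 < eps l. Proof. by rewrite divr_gt0// ltr0n. Qed.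
Let epsM l : eps l * l.+1%:R = S. Proof. by rewrite mulfVK// pnatr_eq0. Qed.

Definition inner_cells (A : set 'rV[R]_n) (l : nat) : pred {ffun 'I_n -> 'I_l.+1} :=
  fun r => `[< cell a (eps l) r `<=` A >].

Let cell_subU l (r : {ffun 'I_n -> 'I_l.+1}) : cell a (eps l) r `<=` U.
Proof. by have := @cell_sub R n a _ _ (eps0 l) r; rewrite epsM. Qed.

Let inner_indic (A : set 'rV[R]_n) l x : R :=
  \sum_(r | @inner_cells A l r) \1_(cell a (eps l) r) x.

Let inner_indic_cell (A : set 'rV[R]_n) l (r : {ffun 'I_n -> 'I_l.+1}) x :
  cell a (eps l) r x -> inner_indic A l x = (inner_cells A r)%:R.
Proof.
move=> rx; rewrite /inner_indic.
have z s : s != r -> \1_(cell a (eps l) s) x = 0 :> R.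
  move=> sr; rewrite indicE memNset//; apply: contra_neq_not sr => sx.
  exact: (cell_uniq (eps0 l) sx rx).
have [Ar|Ar] := boolP (inner_cells A r).
  rewrite (bigD1 r)//= indicE mem_set// big1 ?addr0// => s /andP[_ sr]; exact: z.
by rewrite big1// => s As; apply: z; apply: contraNneq Ar => <-.
Qed.

Lemma inner_cells_eventually (A : set 'rV[R]_n) x : sup_open A -> A x ->
  \forall l \near \oo, forall r : {ffun 'I_n -> 'I_l.+1},
    cell a (eps l) r x -> inner_cells A r.
Proof.
move=> oA Ax; have [del del0 hdel] := oA _ Ax.
near=> l => r rx; apply/asboolP => y ry; apply: hdel => j.
have h1 := rx j; have h2 := ry j.
have : eps l <= del.
  rewrite /eps ler_pdivrMr ?ltr0n// -ler_pdivrMl//.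
  have : del^-1 * S <= l%:R by near: l; exact: nbhs_infty_ger.
  by move=> h; apply: (le_trans h); rewrite ler_nat.
move: h1 h2 => /=; rewrite -natr1 mulrDr mulr1 ler_norml.
move: (x ord0 j) (y ord0 j) (a j) (eps l * (r j)%:R) (eps l) => x1 y1 a1 p e.
lra.
Unshelve. all: by end_near. Qed.

Let cvg_inner_indic (A : set 'rV[R]_n) x : sup_open A -> U x ->
  inner_indic A ^~ x @ \oo --> (\1_A x : R).
Proof.
move=> oA Ux.
have ex l : exists r : {ffun 'I_n -> 'I_l.+1}, cell a (eps l) r x.
  by apply: cell_exists => //; rewrite epsM.
apply: cvg_near_cst; rewrite indicE; have [xA|xA] := boolP (x \in A).
  near=> l; have [r rx] := ex l; rewrite (inner_indic_cell A rx).
  suff -> : inner_cells A r by [].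
  move: r rx; near: l; apply: inner_cells_eventually => //.
  by rewrite inE in xA.
apply: nearW => l; have [r rx] := ex l; rewrite (inner_indic_cell A rx).
suff -> : inner_cells A r = false by [].
apply: contraNF xA => /asboolP h; rewrite inE; exact: h.
Unshelve. all: by end_near. Qed.

Let inner_indic_bound (A : set 'rV[R]_n) l x : U x -> `|inner_indic A l x| <= 1.
Proof.
move=> Ux; have [|r rx] := @cell_exists R n a l.+1 (eps l) (eps0 l) x; first by rewrite epsM.
by rewrite (inner_indic_cell A rx); case: (inner_cells A r); rewrite ?normr1 ?normr0.
Qed.

(** The sigma-algebra is generated by the coordinates, so an open set is seen
    to be measurable by writing it as a countable union of cells. *)
Lemma measurable_sup_openI (A : set 'rV[R]_n) : sup_open A -> measurable (A `&` U).
Proof.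
move=> oA.
have -> : A `&` U = \bigcup_l \bigcup_(r in [set r | @inner_cells A l r]) cell a (eps l) r.
  apply/seteqP; split => x.
    move=> [Ax Ux]; have [l _ hl] := inner_cells_eventually oA Ax.
    have [|r rx] := @cell_exists R n a l.+1 (eps l) (eps0 l) x; first by rewrite epsM.
    exists l => //; exists r => //=; exact: (hl l (leqnn l)).
  move=> [l _ [r /= /asboolP h rx]]; split; first exact: h.
  exact: (cell_subU (r := r)).
apply: bigcupT_measurable => l; apply: fin_bigcup_measurable => // r _.
exact: measurable_box.
Qed.

(** The cell of a point of A lies in A as soon as the grid is fine enough,
    and that of a point outside A never does: dominated convergence applies. *)
Lemma cvg_sum_inner_cells (A : set 'rV[R]_n) (h : 'rV[R]_n -> R) :
  sup_open A -> A `<=` U ->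
  (lebesgue_row n).-integrable U (EFin \o h) ->
  (fun l => \sum_(r | @inner_cells A l r)
     \int[lebesgue_row n]_(x in cell a (eps l) r) h x) @ \oo -->
  \int[lebesgue_row n]_(x in A) h x.
Proof.
move=> oA AU ih.
have mU : measurable U by exact: measurable_box.
have mA : measurable A by have := measurable_sup_openI oA; rewrite setIidl.
have mh : measurable_fun U h by apply/measurable_EFinP; exact: measurable_int ih.
have mi l : measurable_fun U (inner_indic A l).
  have -> : inner_indic A l = fun x => \sum_(r : {ffun 'I_n -> 'I_l.+1})
      (if inner_cells A r then \1_(cell a (eps l) r) x else 0).
    by apply/funext => x; rewrite /inner_indic big_mkcond.
  apply: measurable_sum => r; case: (inner_cells A r) => //=.
  apply: (measurable_funS measurableT) => //.
  by apply: measurable_indic; exact: measurable_box.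
have E l : \int[lebesgue_row n]_(x in U) (h x * inner_indic A l x) =
    \sum_(r | @inner_cells A l r) \int[lebesgue_row n]_(x in cell a (eps l) r) h x.
  have [|_ SE] := @Rintegral_sum _ _ _ (lebesgue_row n) U _
    (index_enum {ffun 'I_n -> 'I_l.+1}) (@inner_cells A l)
    (fun r x => h x * \1_(cell a (eps l) r) x) mU.
    move=> r _; apply: integrable_indic => //; first exact: measurable_box.
    apply: integrableS ih => //; exact: measurable_box.
  transitivity (\sum_(r | @inner_cells A l r)
      \int[lebesgue_row n]_(x in U) (h x * \1_(cell a (eps l) r) x)).
    by rewrite -SE; congr Rintegral; apply/funext => x; rewrite mulr_sumr.
  by apply: eq_bigr => r _; apply: Rintegral_indic; exact: cell_subU.
rewrite -(Rintegral_indic _ _ AU).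
under eq_fun do rewrite -E.
apply: (cvg_Rintegral_dominated (g := fun x => `|h x|)) => //.
- by move=> l; apply: measurable_funM.
- by apply: measurable_funM => //; exact: (measurable_funS measurableT).
- by move=> x Ux; apply: cvgMr; exact: cvg_inner_indic.
- exact: integrable_norm ih.
- move=> l x Ux; rewrite normrM -[leRHS]mulr1 ler_wpM2l//.
  exact: inner_indic_bound.
Qed.

End box_open_sets.


(** * Poincare's inequality for averages over open sets *)

Section poincare.
Context {R : realType}.
Variables (n : nat) (D : set 'rV[R]_n) (f : 'rV[R]_n -> R) (G : 'rV[R]_n -> 'rV[R]_n).
Hypotheses (mD : measurable D) (lf : loc_integrable D f) (wG : is_weak_gradient D f G).
Local Notation mu := (lebesgue_row n).
Variables (a : 'I_n -> R) (S del : R).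
Hypotheses (S0 : 0 < S) (del0 : 0 < del).
Hypothesis KD : cbox a (fun j => a j + S + del) `<=` D.
Let U := box a (fun j => a j + S).

Let UD : cbox a (fun j => a j + S) `<=` D.
Proof.
apply: subset_trans KD => x h j; have /andP[-> h2] := h j.
by rewrite (le_trans h2)// lerDl ltW.
Qed.

Let iU (h : 'rV[R]_n -> R) : loc_integrable D h -> mu.-integrable U (EFin \o h).
Proof. by move=> lh; exact: (loc_integrable_box mD lh UD). Qed.

Let mU : measurable U. Proof. exact: measurable_box. Qed.

Section grid.
Variable l : nat.
Let eps : R := S / l.+1%:R.
Let eps0 : 0 < eps. Proof. by rewrite divr_gt0// ltr0n. Qed.
Let epsM : eps * l.+1%:R = S. Proof. by rewrite mulfVK// pnatr_eq0. Qed.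
Local Notation index := {ffun 'I_n -> 'I_l.+1}.
Let strip (i : 'I_n) (r : index) : set 'rV[R]_n :=
  box (fun j => if j == i then a i else a j + eps * (r j)%:R)
      (fun j => if j == i then a i + S else a j + eps * (r j).+1%:R).
Let F (r : index) := \int[mu]_(x in cell a eps r) f x.

Let r_le (t : 'I_l.+1) : eps * t.+1%:R <= S.
Proof. by rewrite -epsM ler_pM2l// ler_nat. Qed.

Let r_ge (t : 'I_l.+1) : 0 <= eps * t%:R.
Proof. by rewrite mulr_ge0// ltW. Qed.

Let nextE (t : 'I_l.+1) : eps * t.+1%:R = eps * t%:R + eps.
Proof. by rewrite -natr1 mulrDr mulr1. Qed.

Let cell_step r i t :
  `|F r - F (set_coord r i t)| <= eps * \int[mu]_(x in strip i r) `|G x ord0 i|.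
Proof.
pose c j := if j == i then a i else a j + eps * (r j)%:R.
pose e j := if j == i then a i + S else a j + eps * (r j).+1%:R.
have ce j : c j <= e j.
  rewrite /c /e; case: ifP => _; first by rewrite lerDl ltW.
  by rewrite lerD2l ler_pM2l// ler_nat.
have ci : c i = a i by rewrite /c eqxx.
have ei : e i = a i + S by rewrite /e eqxx.
have cellE (s : index) : (forall j, j != i -> s j = r j) ->
  cell a eps s = slab c e i eps (a i + eps * (s i)%:R).
  move=> sr; rewrite /cell /slab; congr box; apply/funext => j; rewrite /c /e.
    by case: eqP => [->//|/eqP ji]; rewrite sr.
  by case: eqP => [->|/eqP ji]; [rewrite nextE addrA|rewrite sr].
have lo (q : 'I_l.+1) : c i <= a i + eps * q%:R by rewrite ci lerDl.
have hi (q : 'I_l.+1) : a i + eps * q%:R + eps <= e i.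
  by rewrite ei -addrA lerD2l -nextE.
rewrite /F (cellE r)// (cellE (set_coord r i t)); last first.
  by move=> j ji; rewrite ffunE (negbTE ji).
have KD' : cbox c (fun j => e j + del) `<=` D.
  apply: subset_trans KD => x h j; have /andP[h1 h2] := h j.
  have cj : a j <= c j by rewrite /c; case: eqP => [->//|_]; rewrite lerDl.
  have ej : e j <= a j + S by rewrite /e; case: eqP => [->//|_]; rewrite lerD2l.
  by rewrite (le_trans cj h1)/= (le_trans h2)// lerD2r.
exact: (slab_difference mD lf wG del0 (ltW eps0) ce (lo _) (hi _) (lo _) (hi _) KD').
Qed.

(** The indices of the strips through a given point agree except in the i-th
    coordinate. *)
Let strip_count i x : \sum_(r : index) \1_(strip i r) x <= l.+1%:R * \1_U x :> R.
Proof.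
have sU r : strip i r `<=` U.
  apply: box_sub => j; case: eqP => [->//|_]; first by rewrite lerDl.
  by rewrite lerD2l.
rewrite [X in _ * X]indicE; have [xU|xU] := boolP (x \in U); last first.
  rewrite mulr0 big1// => r _; rewrite indicE memNset// => xr.
  by move/negP: xU; apply; rewrite inE; exact: sU xr.
rewrite mulr1.
under eq_bigr do rewrite indicE.
rewrite -natr_sum ler_nat.
have -> : (\sum_(r : index) (x \in strip i r))%N = #|[pred r : index | x \in strip i r]|.
  by rewrite -sum1_card [RHS]big_mkcond/=; apply: eq_bigr => r _; rewrite inE; case: (x \in _).
rewrite -[leqRHS]card_ord -(@card_in_imset _ _ (fun r : index => r i)).
  exact: max_card.
move=> r s; rewrite !inE => xr xs rsi; apply/ffunP => j.
have [->//|ji] := eqVneq j i.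
apply/val_inj; have := xr j; have := xs j; rewrite (negbTE ji) => hs hr.
have q (t : index) : a j + eps * (t j)%:R < x ord0 j <= a j + eps * (t j).+1%:R ->
    (t j)%:R < (x ord0 j - a j) / eps <= (t j).+1%:R.
  by rewrite ltr_pdivlMr// ler_pdivrMr// ltrBrDl lerBlDl ![eps * _]mulrC.
exact: nat_ceil_uniq (q _ hr) (q _ hs).
Qed.

Let sum_strips i :
  \sum_(r : index) eps * \int[mu]_(x in strip i r) `|G x ord0 i| <=
  S * \int[mu]_(x in U) `|G x ord0 i|.
Proof.
have iG := integrable_norm (iU (wG i).1).
have sU r : strip i r `<=` U.
  apply: box_sub => j; case: eqP => [->//|_]; first by rewrite lerDl.
  by rewrite lerD2l.
have ms r : measurable (strip i r) by exact: measurable_box.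
have is_ r : mu.-integrable U (EFin \o (fun x => `|G x ord0 i| * \1_(strip i r) x)).
  apply: integrable_indic => //; exact: integrableS iG.
have [] := @Rintegral_sum _ _ _ mu U _ (index_enum index) xpredT
    (fun r x => `|G x ord0 i| * \1_(strip i r) x) mU (fun r _ => is_ r).
move=> iS SE.
rewrite -mulr_sumr -epsM -mulrA ler_pM2l// -RintegralZl//.
under eq_bigr => r _ do rewrite -(Rintegral_indic _ _ (sU r)).
rewrite -SE; apply: le_Rintegral => //.
  have := integrableZl mU l.+1%:R iG; by congr (_.-integrable _ _).
move=> x Ux; rewrite -mulr_sumr mulrC ler_wpM2r//.
by apply: (le_trans (strip_count i x)); rewrite indicE mem_set// mulr1.
Qed.

(** Weighting each sum by the other volume, instead of comparing quotients,
    keeps the estimate valid on coarse grids without any cell inside A or B. *)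
Lemma grid_mean_difference (A B : set 'rV[R]_n) :
  `| (\sum_(r | @inner_cells R n a S B l r) eps ^+ n) * (\sum_(r | @inner_cells R n a S A l r) F r)
   - (\sum_(r | @inner_cells R n a S A l r) eps ^+ n) * (\sum_(r | @inner_cells R n a S B l r) F r)|
  <= S ^+ n.+1 * \sum_(i < n) \int[mu]_(x in U) `|G x ord0 i|.
Proof.
set PA := @inner_cells R n a S A l; set PB := @inner_cells R n a S B l.
have -> : (\sum_(r | PB r) eps ^+ n) * (\sum_(r | PA r) F r)
   - (\sum_(r | PA r) eps ^+ n) * (\sum_(r | PB r) F r) =
   \sum_(r | PA r) \sum_(s | PB s) eps ^+ n * (F r - F s).
  under [RHS]eq_bigr do under eq_bigr do rewrite mulrBr.
  under [RHS]eq_bigr do rewrite sumrB.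
  rewrite sumrB; congr (_ - _).
    by rewrite mulr_sumr; apply: eq_bigr => r _; rewrite mulr_suml.
  rewrite mulr_suml; apply: eq_bigr => r _; rewrite mulr_sumr; exact: eq_bigr.
apply: (@le_trans _ _ (eps ^+ n * \sum_(rs : index * index) `|F rs.1 - F rs.2|)).
  apply: (le_trans (ler_norm_sum _ _ _)).
  rewrite -(pair_bigA _ (fun r s => `|F r - F s|))/= mulr_sumr [leLHS]big_mkcond/=.
  apply: ler_sum => r _; rewrite mulr_sumr.
  case: (PA r); last by apply: sumr_ge0 => s _; rewrite mulr_ge0// exprn_ge0// ltW.
  apply: (le_trans (ler_norm_sum _ _ _)); rewrite [leLHS]big_mkcond/=.
  apply: ler_sum => s _; case: (PB s).
    by rewrite normrM ger0_norm// exprn_ge0// ltW.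
  by rewrite mulr_ge0// exprn_ge0// ltW.
have := grid_poincare cell_step.
rewrite card_ffun !card_ord natrX => gp.
apply: (le_trans (ler_wpM2l _ gp)); first by rewrite exprn_ge0// ltW.
rewrite mulrA -exprMn epsM exprSr -mulrA ler_wpM2l//; first by rewrite exprn_ge0// ltW.
by rewrite mulr_sumr; apply: ler_sum => i _; exact: sum_strips.
Qed.

End grid.

Let vol (A : set 'rV[R]_n) : R := fine (mu A).

Let U_fin : (mu U < +oo)%E.
Proof. by rewrite lebesgue_row_box ?ltry// => j; rewrite lerDl ltW. Qed.

(** Subdividing U into small cells and averaging the comparison of cells
    over the pairs formed by a cell inside A and a cell inside B. *)
Lemma poincare_weighted (A B : set 'rV[R]_n) :
  sup_open A -> sup_open B -> A `<=` U -> B `<=` U ->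
  `|vol B * \int[mu]_(x in A) f x - vol A * \int[mu]_(x in B) f x| <=
  S ^+ n.+1 * \sum_(i < n) \int[mu]_(x in U) `|G x ord0 i|.
Proof.
move=> oA oB AU BU.
have i1 : mu.-integrable U (EFin \o cst 1).
  apply/integrableP; split; first exact/measurable_EFinP.
  under eq_integral do rewrite /= normr1.
  by rewrite integral_cst// mul1e.
have volE (C : set 'rV[R]_n) : sup_open C -> C `<=` U ->
    (fun l => \sum_(r | @inner_cells R n a S C l r) (S / l.+1%:R) ^+ n) @ \oo --> vol C.
  move=> oC CU; have mC : measurable C.
    by have := measurable_sup_openI a S0 oC; rewrite setIidl.
  have E l (r : {ffun 'I_n -> 'I_l.+1}) :
      (S / l.+1%:R) ^+ n = \int[mu]_(x in cell a (S / l.+1%:R) r) cst 1 x.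
    rewrite [RHS](@Rintegral_cst _ _ _ mu _ _ 1); last exact: measurable_box.
    rewrite mul1r; apply/esym.
    have l0 : 0 < S / l.+1%:R by rewrite divr_gt0.
    exact: (congr1 fine (lebesgue_row_cell a l0 r)).
  have -> : vol C = \int[mu]_(x in C) cst 1 x.
    by rewrite (@Rintegral_cst _ _ _ mu _ mC 1) mul1r.
  have -> : (fun l => \sum_(r | @inner_cells R n a S C l r) (S / l.+1%:R) ^+ n) =
      (fun l => \sum_(r | @inner_cells R n a S C l r) \int[mu]_(x in cell a (S / l.+1%:R) r) cst 1 x).
    by apply/funext => l; apply: eq_bigr => r _; exact: E.
  exact: cvg_sum_inner_cells.
pose I (C : set 'rV[R]_n) l := \sum_(r | @inner_cells R n a S C l r)
  \int[mu]_(x in cell a (S / l.+1%:R) r) f x.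
pose V (C : set 'rV[R]_n) l : R := \sum_(r | @inner_cells R n a S C l r) (S / l.+1%:R) ^+ n.
have cI (C : set 'rV[R]_n) : sup_open C -> C `<=` U -> I C @ \oo --> \int[mu]_(x in C) f x.
  by move=> oC CU; exact: (cvg_sum_inner_cells S0 oC CU (iU lf)).
have L : (fun l => `|V B l * I A l - V A l * I B l|) @ \oo -->
    `|vol B * \int[mu]_(x in A) f x - vol A * \int[mu]_(x in B) f x|.
  by apply: cvg_norm; apply: cvgB; apply: cvgM; by [exact: volE|exact: cI].
apply: (cvgr_to_le L); apply: nearW => l.
exact: grid_mean_difference.
Qed.

Lemma poincare_mean (A B : set 'rV[R]_n) :
  sup_open A -> sup_open B -> A `<=` U -> B `<=` U -> 0 < vol A -> 0 < vol B ->
  `|mean A f - mean B f| <=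
  S ^+ n.+1 / (vol A * vol B) * \sum_(i < n) \int[mu]_(x in U) `|G x ord0 i|.
Proof.
move=> oA oB AU BU vA vB.
have := poincare_weighted oA oB AU BU.
rewrite /mean -/(vol A) -/(vol B).
move: (Rintegral _ A _) (Rintegral _ B _) => IA IB h.
have -> : (vol A)^-1 * IA - (vol B)^-1 * IB = (vol B * IA - vol A * IB) / (vol A * vol B).
  by field; rewrite !gt_eqF.
rewrite normrM [`|(_ * _)^-1|]gtr0_norm ?invr_gt0 ?mulr_gt0//.
by rewrite mulrAC ler_wpM2r// invr_ge0 mulr_ge0// ltW.
Qed.

End poincare.


(** * Power inequalities and comparison of integrals *)

Section power_inequalities.
Context {R : realType}.
Implicit Types (p x y : R).

(** Young's inequality for the product of x and 1. *)
Lemma powR_bernoulli p x : 1 <= p -> 0 <= x -> 1 + p * (x - 1) <= x `^ p.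
Proof.
rewrite le_eqVlt => /predU1P[<- x0|p1 x0]; first by rewrite powRr1//; lra.
have p0 : 0 < p by lra.
have q0 : 0 < p / (p - 1) by rewrite divr_gt0// subr_gt0.
have := @conjugate_powR R x 1 p (p / (p - 1)) x0 ler01 p0 q0.
rewrite powR1 mulr1 => /(_ _)/wrap[].
  by rewrite invf_div; field; rewrite gt_eqF.
rewrite mul1r invf_div -mulrDl ler_pdivlMr//; lra.
Qed.

(** Convexity: the graph of x^p lies above its tangent at y. *)
Lemma powR_tangent p x y : 1 <= p -> 0 <= x -> 0 < y ->
  y `^ p + p * y `^ (p - 1) * (x - y) <= x `^ p.
Proof.
move=> p1 x0 y0.
have := powR_bernoulli p1 (divr_ge0 x0 (ltW y0)).
have yp : 0 < y `^ p by exact: powR_gt0.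
have E : y `^ p * (x / y) `^ p = x `^ p.
  rewrite -powRM ?divr_ge0 ?(ltW y0)//.
  by congr powR; field; rewrite gt_eqF.
rewrite -(ler_pM2l yp) E; apply: le_trans.
rewrite powRB ?(gt_eqF y0) ?implybT//.
rewrite (powRr1 (ltW y0)) le_eqVlt; apply/orP; left; apply/eqP.
by field; rewrite gt_eqF.
Qed.

(** Jensen's inequality: when the tangent inequality at the mean value is
    summed, the linear term vanishes. *)
Lemma powR_sum_weighted (I : Type) (s : seq I) (w x : I -> R) p : 1 <= p ->
  (forall i, 0 < w i) -> (forall i, 0 <= x i) ->
  (\sum_(i <- s) w i * x i) `^ p <=
  (\sum_(i <- s) w i) `^ (p - 1) * \sum_(i <- s) w i * x i `^ p.
Proof.
move=> p1 w0 x0; have p0 : p != 0 by rewrite gt_eqF// (lt_le_trans ltr01).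
case: s => [|i0 s]; first by rewrite !big_nil (powR0 p0) mulr0.
set W := \sum_(i <- _) w i; set X := \sum_(i <- _) w i * x i.
have W0 : 0 < W.
  by rewrite /W big_cons ltr_pwDl ?w0//; apply: sumr_ge0 => i _; rewrite ltW.
have X0 : 0 <= X by apply: sumr_ge0 => i _; rewrite mulr_ge0// ltW.
have S0 : 0 <= \sum_(i <- i0 :: s) w i * x i `^ p.
  by apply: sumr_ge0 => i _; rewrite mulr_ge0 ?powR_ge0// ltW.
move: X0; rewrite le_eqVlt => /predU1P[<-|X0].
  by rewrite (powR0 p0) mulr_ge0// powR_ge0.
set y := X / W; have y0 : 0 < y by rewrite divr_gt0.
have XE : X = W * y by rewrite /y mulrC divfK// gt_eqF.
have : \sum_(i <- i0 :: s) (w i * (y `^ p + p * y `^ (p - 1) * (x i - y))) <=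
    \sum_(i <- i0 :: s) w i * x i `^ p.
  by apply: ler_sum => i _; rewrite ler_pM2l//; exact: powR_tangent.
have -> : \sum_(i <- i0 :: s) (w i * (y `^ p + p * y `^ (p - 1) * (x i - y))) = W * y `^ p.
  transitivity (\sum_(i <- i0 :: s) ((y `^ p - p * y `^ (p - 1) * y) * w i +
      p * y `^ (p - 1) * (w i * x i))).
    by apply: eq_bigr => i _; ring.
  by rewrite big_split/= -!mulr_sumr -/W -/X XE; ring.
rewrite -(ler_pM2l (powR_gt0 (p - 1) W0)); apply: le_trans.
rewrite XE powRM ?(ltW W0) ?(ltW y0)// powRB ?(gt_eqF W0) ?implybT// (powRr1 (ltW W0)).
rewrite le_eqVlt; apply/orP; left; apply/eqP.
by field; rewrite gt_eqF.
Qed.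

Lemma powR_sum3 p (a b c : R) : 1 <= p -> 0 <= a -> 0 <= b -> 0 <= c ->
  (a + b + c) `^ p <= 3 `^ (p - 1) * (a `^ p + b `^ p + c `^ p).
Proof.
move=> p1 a0 b0 c0.
have := @powR_sum_weighted 'I_3 (index_enum _) (fun=> 1) (fun i => nth 0 [:: a; b; c] i) p p1
  (fun=> ltr01).
rewrite !big_ord_recr !big_ord0/= !add0r !mul1r => h.
have -> : 3 = 1 + 1 + 1 :> R by lra.
by apply: h => -[[|[|[|]]]].
Qed.

End power_inequalities.

Section jensen_integral.
Context d (T : measurableType d) (R : realType) (mu : {measure set T -> \bar R}).

(** The same tangent argument, integrated. *)
Lemma powR_integral (D : set T) (g : T -> R) (p : R) : 1 <= p -> measurable D ->
  (0 < mu D)%E -> (mu D < +oo)%E ->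
  mu.-integrable D (EFin \o g) -> (forall x, D x -> 0 <= g x) ->
  (((\int[mu]_(x in D) g x) `^ p)%:E <=
   (fine (mu D) `^ (p - 1))%:E * \int[mu]_(x in D) (g x `^ p)%:E)%E.
Proof.
move=> p1 mD D0 Dy ig g0; have p0 : p != 0 by rewrite gt_eqF// (lt_le_trans ltr01).
have V0 : 0 < fine (mu D) by rewrite fine_gt0// D0.
set V := fine (mu D) in V0 *.
have I0 : 0 <= \int[mu]_(x in D) g x by exact: Rintegral_ge0.
set I := \int[mu]_(x in D) g x in I0 *.
have mg : measurable_fun D g by apply/measurable_EFinP; exact: measurable_int ig.
have mgp : measurable_fun D (fun x => g x `^ p).
  exact: (measurableT_comp (measurable_powR p) mg).
have gp0 x : D x -> (0 <= (g x `^ p)%:E)%E by rewrite lee_fin powR_ge0.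
have J0 : (0 <= \int[mu]_(x in D) (g x `^ p)%:E)%E by exact: integral_ge0.
move: I0; rewrite le_eqVlt => /predU1P[I00|I0].
  by rewrite -I00 (powR0 p0) mule_ge0// lee_fin powR_ge0.
have [Jy|Jy] := eqVneq (\int[mu]_(x in D) (g x `^ p)%:E)%E +oo%E.
  by rewrite Jy gt0_muley ?leey// lte_fin powR_gt0.
have igp : mu.-integrable D (EFin \o (fun x => g x `^ p)).
  apply/integrableP; split; first exact/measurable_EFinP.
  under eq_integral do rewrite gee0_abs ?lee_fin ?powR_ge0//.
  by rewrite ltey.
have -> : (\int[mu]_(x in D) (g x `^ p)%:E)%E = (\int[mu]_(x in D) (g x `^ p))%:E.
  by rewrite /Rintegral fineK//; exact: integrable_fin_num.
rewrite -EFinM lee_fin.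
set y := I / V; have y0 : 0 < y by rewrite divr_gt0.
have IE : I = V * y by rewrite /y mulrC divfK// gt_eqF.
have i1 c : mu.-integrable D (EFin \o cst c).
  apply/integrableP; split; first exact/measurable_EFinP.
  under eq_integral do rewrite /=.
  by rewrite integral_cst// lte_mul_pinfty.
pose c1 := p * y `^ (p - 1); pose c2 := y `^ p - c1 * y.
have ic : mu.-integrable D (EFin \o (fun x => c1 * g x)).
  by have := integrableZl mD c1 ig; congr (_.-integrable _ _).
have ih : mu.-integrable D (EFin \o (fun x => c1 * g x + c2)).
  by have := integrableD mD ic (i1 c2); congr (_.-integrable _ _).
have : \int[mu]_(x in D) (c1 * g x + c2) <= \int[mu]_(x in D) (g x `^ p).
  apply: le_Rintegral => // x Dx.
  apply: le_trans (powR_tangent p1 (g0 x Dx) y0).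
  by rewrite /c2 /c1 le_eqVlt; apply/orP; left; apply/eqP; ring.
have -> : \int[mu]_(x in D) (c1 * g x + c2) = c1 * I + c2 * V.
  rewrite (RintegralD mD ic (i1 c2)); congr (_ + _); first exact: RintegralZl.
  exact: Rintegral_cst.
move=> /(ler_wpM2l (powR_ge0 V (p - 1))); apply: le_trans; rewrite IE.
rewrite /c2 powRM ?(ltW V0) ?(ltW y0)// [V `^ (p - 1)]powRB ?(gt_eqF V0) ?implybT// (powRr1 (ltW V0)).
rewrite le_eqVlt; apply/orP; left; apply/eqP.
by field; rewrite gt_eqF.
Qed.

End jensen_integral.

Section comparing_measures.
Context d (T : measurableType d) (R : realType).
Variables (m1 m2 : {measure set T -> \bar R}).
Import HBNNSimple.

(** A comparison of the measures on sets carries over to the simple functions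
    below f, and the integral is their supremum. *)
Lemma le_integral_measure (D : set T) (f : T -> \bar R) (c : R) :
  measurable D -> 0 < c -> (forall x, D x -> (0 <= f x)%E) ->
  (forall E, measurable E -> E `<=` D -> (c%:E * m1 E <= m2 E)%E) ->
  (c%:E * \int[m1]_(x in D) f x <= \int[m2]_(x in D) f x)%E.
Proof.
move=> mD c0 f0 m12; rewrite -lee_pdivlMl// ge0_integralE//.
apply: ge_ereal_sup => _ [h /= hf <-]; rewrite lee_pdivlMl//.
apply: (@le_trans _ _ (sintegral m2 h)); last first.
  by rewrite ge0_integralE//; apply: ereal_sup_ubound; exists h.
rewrite !sintegralE ge0_mule_fsumr; last first.
  by move=> r; exact: nnsfun_mulemu_ge0.
apply: lee_fsum => // r [x _ hxr].
have r0 : 0 <= r by rewrite -hxr.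
rewrite muleCA; move: r0; rewrite le_eqVlt => /predU1P[<-|r0]; first by rewrite !mul0e.
rewrite lee_pmul2l//; apply: m12 => // z /= hz; apply: contrapT => Dz.
have := hf z; rewrite /patch memNset// hz lee_fin => /(lt_le_trans r0).
by rewrite ltxx.
Qed.

End comparing_measures.


(** * Whitney neighbourhoods of dyadic cubes *)

Section euclidean_norm.
Context {R : realType}.

Lemma normr_le_enorm n (x : 'rV[R]_n) j : `|x ord0 j| <= enorm x.
Proof.
rewrite -sqrtr_sqr /enorm ler_wsqrtr// (bigD1 j)//= lerDl.
by apply: sumr_ge0 => i _; rewrite sqr_ge0.
Qed.

Lemma enorm_ge0 n (x : 'rV[R]_n) : 0 <= enorm x.
Proof. exact: sqrtr_ge0. Qed.

Lemma continuous_enormB n (z : 'rV[R]_n) : continuous (fun y : 'rV[R]_n => enorm (y - z)).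
Proof.
have c1 : continuous (fun y : 'rV[R]_n => \sum_(i < n) (y - z) ord0 i ^+ 2).
  elim: (index_enum _) => [|j s IH] x.
    have -> : (fun y : 'rV[R]_n => \sum_(i <- [::]) (y - z) ord0 i ^+ 2) = cst 0.
      by apply/funext => y; rewrite big_nil.
    exact: cst_continuous.
  have -> : (fun y : 'rV[R]_n => \sum_(i <- j :: s) (y - z) ord0 i ^+ 2) =
      (fun y => (y ord0 j - z ord0 j) ^+ 2 + \sum_(i <- s) (y - z) ord0 i ^+ 2).
    by apply/funext => y; rewrite big_cons !mxE.
  have cj : {for x, continuous (fun y : 'rV[R]_n => y ord0 j - z ord0 j)}.
    apply: (@continuousB _ _ _ (fun y : 'rV[R]_n => y ord0 j) (cst (z ord0 j))).
      exact: continuous_row_coord.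
    exact: cst_continuous.
  exact: (continuousD (continuousM cj cj) (IH x)).
move=> x; apply: (@continuous_comp _ _ _ (fun y : 'rV[R]_n => \sum_(i < n) (y - z) ord0 i ^+ 2)
  Num.sqrt x); first exact: c1.
exact: sqrt_continuous.
Qed.

Lemma measurable_enorm n (G : 'rV[R]_n -> 'rV[R]_n) (D : set 'rV[R]_n) :
  measurable D -> (forall i, measurable_fun D (fun x => G x ord0 i)) ->
  measurable_fun D (fun x => enorm (G x)).
Proof.
move=> mD mG.
have ms : measurable_fun setT (@Num.sqrt R).
  by apply: continuous_measurable_fun; exact: sqrt_continuous.
apply: (measurableT_comp ms).
by apply: measurable_sum => i; exact: measurable_funX.
Qed.

Lemma dist_set_lt n (y : 'rV[R]_n) (A : set 'rV[R]_n) (r : R) : A !=set0 ->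
  dist_set y A < r <-> exists2 z, A z & enorm (y - z) < r.
Proof.
move=> [z0 Az0].
have lb : has_lbound [set enorm (y - z) | z in A].
  by exists 0 => _ [z _ <-]; exact: enorm_ge0.
split=> [h|[z Az h]].
  have hi : has_inf [set enorm (y - z) | z in A] by split=> //; exists (enorm (y - z0)), z0.
  have [_ [z Az <-] hz] := inf_adherent (eps := r - dist_set y A) (ltac:(by rewrite subr_gt0)) hi.
  by exists z => //; move: hz; rewrite -/(dist_set y A) [X in _ < X]addrC subrK.
by apply: le_lt_trans h; apply: ge_inf => //; exists z.
Qed.

End euclidean_norm.

Section whitney_regions.
Context {R : realType}.
Variable d : nat.
Local Notation n := d.+1.
Implicit Types (k : nat) (m : 'rV[int]_d) (y : 'rV[R]_n).

Definition ell k : R := 2 ^- k.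

Lemma ellE k : (2 : R) ^ (- (k : int)) = ell k.
Proof. by rewrite /ell exprnN. Qed.

Lemma ell_gt0 k : 0 < ell k.
Proof. by rewrite invr_gt0 exprn_gt0. Qed.

Lemma ell0 : ell 0 = 1. Proof. by rewrite /ell expr0 invr1. Qed.

Lemma ellS k : ell k = 2 * ell k.+1.
Proof.
by rewrite /ell exprS invfM mulrA divff ?mul1r// pnatr_eq0.
Qed.

Definition qcube k m : set 'rV[R]_d := dyadic_cube k m.

Lemma qcubeE k m : qcube k m =
  box (fun i => ell k * (m ord0 i)%:~R) (fun i => ell k * ((m ord0 i)%:~R + 1)).
Proof. by rewrite /qcube /dyadic_cube ellE. Qed.

Definition snoc (u : 'I_d -> R) (t : R) (j : 'I_n) : R := oapp u t (unlift ord_max j).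

Lemma snoc_max u t : snoc u t ord_max = t.
Proof. by rewrite /snoc unlift_none. Qed.

Lemma snoc_lift u t i : snoc u t (lift ord_max i) = u i.
Proof. by rewrite /snoc liftK. Qed.

Lemma box_snoc u t u' t' : box (snoc u t) (snoc u' t') =
  [set y : 'rV[R]_n | box u u' (Defs.row_base y) /\ t < height y <= t'].
Proof.
apply/seteqP; split => y /=.
  move=> h; split => [i|]; last by have := h ord_max; rewrite !snoc_max.
  by have := h (lift ord_max i); rewrite !snoc_lift mxE.
move=> [h1 h2] j; case: (unliftP ord_max j) => [i ->|->]; last by rewrite !snoc_max.
by rewrite !snoc_lift; have := h1 i; rewrite mxE.
Qed.

Definition wlo k m := snoc (fun i => ell k * (m ord0 i)%:~R) (ell k).
Definition whi k m := snoc (fun i => ell k * ((m ord0 i)%:~R + 1)) (2 * ell k).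

Lemma whitneyE k m : whitney k (qcube k m) = box (wlo k m) (whi k m).
Proof.
rewrite /wlo /whi box_snoc /whitney -qcubeE.
have -> : (2 : R) ^ (- (k : int) + 1) = 2 * ell k.
  by rewrite expfzDr ?pnatr_eq0// ellE mulrC.
by rewrite ellE.
Qed.

Lemma whi_wlo k m j : whi k m j - wlo k m j = ell k.
Proof.
rewrite /whi /wlo; case: (unliftP ord_max j) => [i ->|->]; last by rewrite !snoc_max; ring.
by rewrite !snoc_lift; ring.
Qed.

Lemma whi_whitney k m : whitney k (qcube k m) (\row_j whi k m j).
Proof.
rewrite whitneyE => j; rewrite mxE lexx andbT -subr_gt0 whi_wlo; exact: ell_gt0.
Qed.

Definition nb k m : set 'rV[R]_n := whitney_nbhd k (qcube k m).

Lemma nbP k m y : nb k m y <-> 0 < height y /\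
  exists2 z, box (wlo k m) (whi k m) z & enorm (y - z) < ell k / 4.
Proof.
rewrite /nb /whitney_nbhd /= ellE -whitneyE dist_set_lt//.
by exists (\row_j whi k m j); exact: whi_whitney.
Qed.

Lemma nb_bounds k m y j : nb k m y ->
  wlo k m j - ell k / 4 < y ord0 j < whi k m j + ell k / 4.
Proof.
move=> /nbP[_ [z zw yz]]; have /andP[z1 z2] := zw j.
have := le_lt_trans (normr_le_enorm (y - z) j) yz; rewrite !mxE ltr_norml => /andP[h1 h2].
by apply/andP; split; lra.
Qed.

Lemma whitney_sub_nb k m : box (wlo k m) (whi k m) `<=` nb k m.
Proof.
move=> y yw; apply/nbP; split.
  have := yw ord_max; rewrite /wlo snoc_max => /andP[h _].
  exact: lt_trans (ell_gt0 k) h.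
exists y => //; rewrite subrr /enorm big1 ?sqrtr0 ?divr_gt0 ?ell_gt0// => i _.
by rewrite mxE expr0n.
Qed.

Lemma open_nb k m : open (nb k m).
Proof.
have -> : nb k m = [set y | 0 < height y] `&`
    \bigcup_(z in box (wlo k m) (whi k m)) ((fun y : 'rV[R]_n => enorm (y - z)) @^-1` [set t | t < ell k / 4]).
  apply/seteqP; split => y.
    by move=> /nbP[h [z zw yz]]; split => //; exists z.
  by move=> [h [z zw yz]]; apply/nbP; split => //; exists z.
apply: openI.
  apply: (@open_comp _ _ (fun y : 'rV[R]_n => y ord0 ord_max) [set t : R | 0 < t]).
    by move=> y _; exact: continuous_row_coord.
  exact: open_gt.
apply: bigcup_open => z _; apply: open_comp; last exact: open_lt.
by move=> y _; exact: continuous_enormB.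
Qed.

Lemma sup_open_nb k m : sup_open (nb k m).
Proof. exact/open_sup_open/open_nb. Qed.

(** The region of a cube is a box of side 5 * 2^-k that contains the Whitney
    neighbourhoods of the cube, of the cubes that touch it and of its children
    (nb_region_adjacent, nb_region_child), at heights between 2^-k / 4 and
    21/4 * 2^-k. Poincare's inequality will be used on it. *)
Definition ulo k m := snoc (fun i => ell k * ((m ord0 i)%:~R - 2)) (ell k / 4).
Definition region k m : set 'rV[R]_n := box (ulo k m) (fun j => ulo k m j + 5 * ell k).

Lemma measurable_region k m : measurable (region k m).
Proof. exact: measurable_box. Qed.

Lemma region_height k m y : region k m y -> ell k / 4 < height y <= 21 / 4 * ell k.
Proof.
move=> /(_ ord_max); rewrite /ulo snoc_max -/(height y) => /andP[h1 h2].
by rewrite h1/=; lra.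
Qed.

Lemma region_upper k m : region k m `<=` upper_half.
Proof.
move=> y /region_height/andP[h _]; apply: lt_trans h.
by rewrite divr_gt0// ell_gt0.
Qed.

Lemma closed_region_upper k m :
  cbox (ulo k m) (fun j => ulo k m j + 5 * ell k + 1) `<=` upper_half.
Proof.
move=> y /(_ ord_max) /andP[+ _]; rewrite /ulo snoc_max; apply: lt_le_trans.
by rewrite divr_gt0// ell_gt0.
Qed.

Lemma nb_region_adjacent k m m' :
  (forall i, m ord0 i - 1 <= m' ord0 i <= m ord0 i + 1) -> nb k m' `<=` region k m.
Proof.
move=> mm y /nb_bounds hy j; have /andP[h1 h2] := hy j.
have l0 := ell_gt0 k.
move: h1 h2; rewrite /wlo /whi /ulo; case: (unliftP ord_max j) => [i ->|->].
  rewrite !snoc_lift; have /andP[] := mm i.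
  rewrite -!(ler_int R) rmorphB rmorphD/=.
  move: (y ord0 _) ((m ord0 i)%:~R : R) ((m' ord0 i)%:~R : R) (ell k) l0 => y0 a b l l0.
  move=> ab ba h1 h2; apply/andP; split; nra.
rewrite !snoc_max; move: (y ord0 _) (ell k) l0 => y0 l l0 h1 h2.
apply/andP; split; lra.
Qed.

Lemma nb_region k m : nb k m `<=` region k m.
Proof. by apply: nb_region_adjacent => i; rewrite gerBl lerDl. Qed.

Lemma nb_region_child k m m' :
  (forall i, 2 * m ord0 i <= m' ord0 i <= 2 * m ord0 i + 1) -> nb k.+1 m' `<=` region k m.
Proof.
move=> mm y /nb_bounds hy j; have /andP[h1 h2] := hy j.
have l0 := ell_gt0 k.+1.
move: h1 h2; rewrite /wlo /whi /ulo; case: (unliftP ord_max j) => [i ->|->].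
  rewrite !snoc_lift (ellS k); have /andP[] := mm i.
  rewrite -!(ler_int R) rmorphD/= !rmorphM/=.
  move: (y ord0 _) ((m ord0 i)%:~R : R) ((m' ord0 i)%:~R : R) (ell k.+1) l0 => y0 a b l l0.
  move=> ab ba h1 h2; apply/andP; split; nra.
rewrite !snoc_max (ellS k); move: (y ord0 _) (ell k.+1) l0 => y0 l l0 h1 h2.
apply/andP; split; lra.
Qed.

Lemma lebesgue_row_region k m : lebesgue_row n (region k m) = ((5 * ell k) ^+ n)%:E.
Proof.
rewrite /region lebesgue_row_box => [|j]; last by rewrite lerDl mulr_ge0// ltW// ell_gt0.
congr EFin; under eq_bigr do rewrite addrC addKr.
by rewrite prodr_const card_ord.
Qed.

Lemma measurable_nb k m : measurable (nb k m).
Proof.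
have s0 : 0 < 5 * ell k by rewrite mulr_gt0// ell_gt0.
have := measurable_sup_openI (ulo k m) s0 (@sup_open_nb k m).
by rewrite setIidl//; exact: nb_region.
Qed.

Lemma nb_fin k m : (lebesgue_row n (nb k m) < +oo)%E.
Proof.
apply: (@le_lt_trans _ _ (lebesgue_row n (region k m))).
  apply: le_measure; rewrite ?inE; [exact: measurable_nb|exact: measurable_region|].
  exact: nb_region.
by rewrite lebesgue_row_region ltry.
Qed.

Lemma nb_vol k m : ell k ^+ n <= fine (lebesgue_row n (nb k m)).
Proof.
rewrite -lee_fin fineK; last by rewrite ge0_fin_numE// nb_fin.
have -> : (ell k ^+ n)%:E = lebesgue_row n (box (wlo k m) (whi k m)).
  rewrite lebesgue_row_box => [|j]; last by rewrite -subr_ge0 whi_wlo ltW// ell_gt0.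
  by congr EFin; under eq_bigr do rewrite whi_wlo; rewrite prodr_const card_ord.
apply: le_measure; rewrite ?inE; [exact: measurable_box|exact: measurable_nb|].
exact: whitney_sub_nb.
Qed.

Lemma nb_vol_child k m : ell k.+1 ^+ n <= fine (lebesgue_row n (nb k m)).
Proof.
apply: le_trans (nb_vol k m); rewrite lerXn2r ?nnegrE ?(ltW (ell_gt0 _))// [leRHS]ellS.
by rewrite ler_peMl ?(ltW (ell_gt0 _))// ler1n.
Qed.

End whitney_regions.


(** * The weight on the region of a cube *)

Section weight_on_regions.
Context {R : realType}.
Variable d : nat.
Local Notation n := d.+1.
Variables (p lambda : R).
Hypotheses (p1 : 1 <= p) (lam0 : 0 <= lambda).
Implicit Types (k : nat) (m : 'rV[int]_d).

(** The size of log^lambda (4/t) at heights t comparable to 2^-k. *)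
Definition logw k : R := k.+2%:R `^ lambda.

Lemma logw_gt0 k : 0 < logw k.
Proof. by rewrite powR_gt0. Qed.

Definition weight_cst : R := 4^-1 `^ (p - 1) * (ln 2 / 4) `^ lambda.

Lemma weight_cst_gt0 : 0 < weight_cst.
Proof. by rewrite mulr_gt0 ?powR_gt0 ?invr_gt0// divr_gt0// ln_gt0// ltr1n. Qed.

Lemma ln_pow2_le (j : nat) (s : R) : 2 ^+ j <= s -> j%:R * ln 2 <= ln s.
Proof.
move=> js; rewrite mulr_natl -lnXn//.
by rewrite ler_ln ?posrE ?exprn_gt0//; apply: lt_le_trans js; rewrite exprn_gt0.
Qed.

(** At height t <= 21/4 * 2^-k one has 4/t >= 2^(k-1), hence k - 1 factors
    log 2, which suffices for k >= 2. For k <= 6 the bound log (4/t) >= log 4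
    that comes from t <= 1 suffices. *)
Lemma log_height_ge k (t : R) : 0 < t -> t <= 21 / 4 * ell k -> t <= 1 ->
  ln 2 / 4 * k.+2%:R <= ln (4 / t).
Proof.
move=> t0 tk t1.
have l2 : 0 < ln 2 :> R by rewrite ln_gt0// ltr1n.
case: (leqP k 6) => k6.
  have : 2%:R * ln 2 <= ln (4 / t) :> R.
    apply: ln_pow2_le; rewrite ler_pdivlMr// expr2; lra.
  apply: le_trans; rewrite -[k.+2]addn2 natrD.
  have : k%:R <= 6%:R :> R by rewrite ler_nat.
  move: (k%:R : R) (ln 2 : R) l2 => x l l0 h; nra.
have : (k.-1)%:R * ln 2 <= ln (4 / t) :> R.
  apply: ln_pow2_le; rewrite ler_pdivlMr//.
  have : 2 ^+ k.-1 * (21 / 4 * ell k) <= 4 :> R.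
    have e1 : 2 ^+ k.-1 * ell k.-1 = 1 :> R.
      by rewrite /ell divff// expf_neq0// pnatr_eq0.
    have e2 : ell k.-1 = 2 * ell k :> R by rewrite ellS prednK// (leq_trans _ k6).
    move: e1; rewrite e2; move: (2 ^+ k.-1 : R) (ell k : R) => x y xy.
    have -> : x * (21 / 4 * y) = 21 / 8 * (x * (2 * y)) by field.
    by rewrite xy; lra.
  by apply: le_trans; rewrite ler_pM2l// exprn_gt0.
apply: le_trans.
have -> : (k.-1)%:R = k%:R - 1 :> R.
  by rewrite -[in RHS](prednK (leq_trans _ k6))// -natr1 addrK.
rewrite -[k.+2]addn2 natrD.
have : 6%:R <= k%:R :> R by rewrite ler_nat ltnW.
move: (k%:R : R) (ln 2 : R) l2 => x l l0 h; nra.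
Qed.

Lemma ell_powR_le1 k : ell k `^ (p - 1) <= 1 :> R.
Proof.
have l1 : ell k <= 1 :> R by rewrite invf_le1 ?exprn_gt0// exprn_ege1// ler1n.
rewrite [leRHS](_ : 1 = 1 `^ (p - 1)); last by rewrite powR1.
apply: ge0_ler_powR => //.
- by rewrite subr_ge0.
- by rewrite nnegrE ltW// ell_gt0.
- by rewrite nnegrE.
Qed.

(** Heights above 1, where the weight is constant, occur in a region only for
    k <= 2, and there all the factors are bounded. *)
Lemma omega_region_ge k m (y : 'rV[R]_n) : region k m y ->
  weight_cst * (ell k `^ (p - 1) * logw k) <= omega (p - 1) lambda y.
Proof.
move=> /region_height/andP[y1 y2].
have l0 := @ell_gt0 R k.
have t0 : 0 < height y by apply: lt_trans y1; rewrite divr_gt0.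
have l2 : 0 < ln 2 :> R by rewrite ln_gt0// ltr1n.
have nn x : 0 <= x -> x \is @Num.nneg R by rewrite nnegrE.
have -> : weight_cst * (ell k `^ (p - 1) * logw k) =
   (ell k / 4) `^ (p - 1) * (ln 2 / 4 * k.+2%:R) `^ lambda.
  rewrite /weight_cst /logw [(ell k / 4) `^ _]powRM ?(ltW l0)// [(_ * k.+2%:R) `^ _]powRM ?divr_ge0 ?(ltW l2)//.
  ring.
rewrite /omega gtr0_norm//; case: (leP (height y) 1) => t1.
  rewrite ler_pM ?powR_ge0//.
    by apply: ge0_ler_powR; [rewrite subr_ge0|apply: nn; rewrite divr_ge0// ltW|apply: nn; exact: ltW|exact: ltW].
  apply: ge0_ler_powR => //; last exact: log_height_ge.
    by apply: nn; rewrite mulr_ge0 ?divr_ge0// ltW.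
  apply: nn; apply: le_trans (log_height_ge t0 y2 t1).
  by rewrite mulr_ge0 ?divr_ge0// ltW.
have k2 : (k <= 2)%N.
  rewrite leqNgt; apply/negP => k3.
  have : ell k <= 8^-1 :> R.
    rewrite lef_pV2 ?posrE ?exprn_gt0//; apply: (@le_trans _ _ (2 ^+ 3)); last by rewrite ler_weXn2l// ler1n.
    by rewrite -natrX.
  move=> h; lra.
rewrite -[leRHS]mul1r ler_pM ?powR_ge0//.
  rewrite powRM ?(ltW l0)// -[leRHS]mulr1.
  rewrite ler_pM ?powR_ge0 ?ell_powR_le1//.
  rewrite [leRHS](_ : 1 = 1 `^ (p - 1)); last by rewrite powR1.
  apply: ge0_ler_powR => //.
  - by rewrite subr_ge0.
  - by apply: nn.
  - by apply: nn.
  - by rewrite invf_le1// ler1n.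
apply: ge0_ler_powR => //.
- by apply: nn; rewrite mulr_ge0 ?divr_ge0// ltW.
- by apply: nn; rewrite ln_ge0// ler1n.
apply: (@le_trans _ _ (ln 2)).
  rewrite -[leRHS]mulr1 -mulrA ler_pM2l//.
  rewrite mulrC ler_pdivrMr// mul1r ler_nat; lia.
by rewrite ler_ln ?posrE// ler_nat.
Qed.

Definition region_weight_cst : R := weight_cst / ln 4 `^ lambda.

Lemma region_weight_cst_gt0 : 0 < region_weight_cst.
Proof. by rewrite divr_gt0 ?weight_cst_gt0// powR_gt0// ln_gt0// ltr1n. Qed.

Definition region_weight k : R := region_weight_cst * (ell k `^ (p - 1) * logw k).

Lemma region_weight_gt0 k : 0 < region_weight k.
Proof.
by rewrite mulr_gt0 ?region_weight_cst_gt0// mulr_gt0 ?logw_gt0// powR_gt0// ell_gt0.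
Qed.

Lemma mu_weight_region_ge k m (E : set 'rV[R]_n) : measurable E -> E `<=` region k m ->
  ((region_weight k)%:E * lebesgue_row n E <= mu_weight (p - 1) lambda E)%E.
Proof.
move=> mE Em; rewrite /mu_weight setIidl; last first.
  by apply: subset_trans Em _; exact: region_upper.
have -> : region_weight k = (ln 4 `^ lambda)^-1 * (weight_cst * (ell k `^ (p - 1) * logw k)).
  by rewrite /region_weight /region_weight_cst; ring.
rewrite EFinM -muleA; apply: lee_wpmul2l; first by rewrite lee_fin invr_ge0 powR_ge0.
rewrite -integral_cst//; apply: ge0_le_integral => //.
- move=> y _; rewrite lee_fin mulr_ge0 ?(ltW weight_cst_gt0)//.
  by rewrite mulr_ge0 ?powR_ge0.
- apply/measurable_EFinP; apply: (measurable_funS measurableT) => //.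
  exact: measurable_omega.
- by move=> y /Em yk; rewrite lee_fin; exact: omega_region_ge yk.
Qed.

Lemma region_integral_le k m (g : 'rV[R]_n -> \bar R) :
  (forall y, region k m y -> (0 <= g y)%E) ->
  ((region_weight k)%:E * \int[lebesgue_row n]_(y in region k m) g y <=
   \int[mu_weight (p - 1) lambda]_(y in region k m) g y)%E.
Proof.
move=> g0; apply: le_integral_measure => //.
- exact: measurable_region.
- exact: region_weight_gt0.
- by move=> E mE Em; exact: mu_weight_region_ge Em.
Qed.

End weight_on_regions.


(** * Differences of averages and local energy *)

Section local_estimates.
Context {R : realType}.
Variable d : nat.
Local Notation n := d.+1.
Variables (p lambda : R).
Hypotheses (p1 : 1 <= p) (lam0 : 0 <= lambda).
Implicit Types (k : nat) (m : 'rV[int]_d).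
Local Notation mu := (@lebesgue_row R n).
Local Notation muw := (@mu_weight R d (p - 1) lambda).
Local Notation logw := (logw lambda).

Definition energy (g : 'rV[R]_n -> R) k m : \bar R :=
  (\int[muw]_(y in region k m) (`|g y| `^ p)%:E)%E.

Lemma energy_ge0 g k m : (0 <= energy g k m)%E.
Proof. by apply: integral_ge0 => y _; rewrite lee_fin powR_ge0. Qed.

Let region_pos k m : (0 < mu (region k m))%E.
Proof. by rewrite lebesgue_row_region lte_fin exprn_gt0// mulr_gt0// ell_gt0. Qed.

Let region_fin k m : (mu (region k m) < +oo)%E.
Proof. by rewrite lebesgue_row_region ltry. Qed.

(** Jensen's inequality on a Whitney region, followed by the passage from
    Lebesgue measure to the weighted measure. *)
Lemma integral_region_powR (h g : 'rV[R]_n -> R) k m :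
  mu.-integrable (region k m) (EFin \o h) ->
  measurable_fun (region k m) g ->
  (forall y, region k m y -> `|h y| <= `|g y|) ->
  (((\int[mu]_(y in region k m) `|h y|) `^ p)%:E <=
   (((5 * ell k) ^+ n) `^ (p - 1) / region_weight p lambda k)%:E * energy g k m)%E.
Proof.
move=> ih mg hg; have mr := measurable_region (R := R) k m.
have h0 y : region k m y -> 0 <= `|h y| by [].
have := powR_integral p1 mr (region_pos k m) (region_fin k m) (integrable_norm ih) h0.
rewrite (_ : fine _ = (5 * ell k) ^+ n); last exact: (congr1 fine (lebesgue_row_region k m)).
move=> H; apply: (le_trans H).
rewrite EFinM -muleA; apply: lee_wpmul2l; first by rewrite lee_fin powR_ge0.
rewrite lee_pdivlMl ?region_weight_gt0//.
have gp0 y : region k m y -> (0 <= (`|g y| `^ p)%:E)%E by rewrite lee_fin powR_ge0.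
refine (le_trans _ (region_integral_le p1 lam0 gp0)).
apply: lee_wpmul2l; first by rewrite lee_fin ltW// region_weight_gt0.
have mh : measurable_fun (region k m) h by apply/measurable_EFinP; exact: measurable_int ih.
apply: ge0_le_integral => //.
- by move=> y _; rewrite lee_fin powR_ge0.
- apply/measurable_EFinP.
  by apply: (measurableT_comp (measurable_powR p)); exact: measurableT_comp.
- apply/measurable_EFinP.
  by apply: (measurableT_comp (measurable_powR p)); exact: measurableT_comp.
- move=> y yr; rewrite lee_fin ge0_ler_powR ?nnegrE//; last exact: hg.
  by rewrite (le_trans ler01).
exact: normr_ge0.
Qed.

Let powR_exprn (x : R) j : 0 <= x -> (x ^+ j) `^ (p - 1) = (x `^ (p - 1)) ^+ j.
Proof.
move=> x0; elim: j => [|j IH]; first by rewrite !expr0 powR1.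
by rewrite !exprS powRM ?IH// exprn_ge0.
Qed.

Definition poincare_cst : R := 5 ^+ n.+1 * 4 ^+ n.

Definition gradient_cst : R :=
  poincare_cst `^ p * n%:R `^ p * (5 ^+ n) `^ (p - 1) / region_weight_cst p lambda.

Let poincare_cst_gt0 : 0 < poincare_cst.
Proof. by rewrite mulr_gt0 ?exprn_gt0. Qed.

Lemma gradient_cst_gt0 : 0 < gradient_cst.
Proof.
rewrite divr_gt0 ?region_weight_cst_gt0// mulr_gt0 ?powR_gt0 ?exprn_gt0//.
by rewrite mulr_gt0 ?powR_gt0.
Qed.

Variables (f : 'rV[R]_n -> R) (G : 'rV[R]_n -> 'rV[R]_n).
Hypotheses (lf : loc_integrable upper_half f) (wG : is_weak_gradient upper_half f G).
Let g y := enorm (G y).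

Let closed_region k m : cbox (ulo k m) (fun j => ulo k m j + 5 * ell k) `<=` @upper_half R d.
Proof.
apply: subset_trans (@closed_region_upper R d k m) => y hy j.
by have /andP[-> h] := hy j; rewrite (le_trans h)// lerDl.
Qed.

Lemma integrable_region (h : 'rV[R]_n -> R) k m : loc_integrable upper_half h ->
  mu.-integrable (region k m) (EFin \o h).
Proof.
move=> lh; have := loc_integrable_box (@measurable_upper_half R d) lh (@closed_region k m).
by [].
Qed.

Let mg k m : measurable_fun (region k m) g.
Proof.
apply: measurable_enorm; first exact: measurable_region.
move=> i; apply: (measurable_funS (@measurable_upper_half R d)).
  exact: region_upper.
by have [[]] := wG i.
Qed.

(** Poincare's inequality bounds the difference of the averages by 2^(kd)
    times the integral of the gradient over the region, of volume comparable
    to 2^(-k(d+1)); Jensen's inequality then brings in the p-th power. The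
    power p - 1 of the height in the weight is the one for which all the
    powers of 2^k cancel, and the logarithmic factor is all that remains. *)
Lemma mean_difference_energy k m (A B : set 'rV[R]_n) :
  sup_open A -> sup_open B -> A `<=` region k m -> B `<=` region k m ->
  ell k.+1 ^+ n <= fine (mu A) -> ell k.+1 ^+ n <= fine (mu B) ->
  ((ell k ^+ d * `|mean A f - mean B f| `^ p)%:E <=
   (gradient_cst / logw k)%:E * energy g k m)%E.
Proof.
move=> oA oB AU BU vA vB.
have e0 := @ell_gt0 R k.
have s0 : 0 < 5 * ell k :> R by rewrite mulr_gt0.
have v0 : 0 < ell k.+1 ^+ n :> R by rewrite exprn_gt0// ell_gt0.
have vA0 := lt_le_trans v0 vA; have vB0 := lt_le_trans v0 vB.
pose X i := \int[mu]_(y in region k m) `|G y ord0 i|.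
have X0 i : 0 <= X i by exact: Rintegral_ge0.
have SX0 : 0 <= \sum_(i < n) X i by apply: sumr_ge0 => i _; exact: X0.
have K0 := poincare_cst_gt0.
have ed0 : 0 < ell k ^+ d :> R by rewrite exprn_gt0.
have D1 : `|mean A f - mean B f| <= poincare_cst / ell k ^+ d * \sum_(i < n) X i.
  apply: (le_trans (poincare_mean (@measurable_upper_half R d) lf wG s0 ltr01
    (@closed_region_upper R d k m) oA oB AU BU vA0 vB0)).
  apply: ler_wpM2r; first exact: SX0.
  (* Both volumes are at least (ell k / 2)^n, which is where 4^n comes from. *)
  have vv : ell k.+1 ^+ n * ell k.+1 ^+ n <= fine (mu A) * fine (mu B).
    by rewrite ler_pM// ltW.
  apply: (@le_trans _ _ ((5 * ell k) ^+ n.+1 / (ell k.+1 ^+ n * ell k.+1 ^+ n))).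
    rewrite ler_pM2l ?exprn_gt0// lef_pV2 ?posrE ?mulr_gt0//.
  rewrite /poincare_cst le_eqVlt; apply/orP; left; apply/eqP.
  have -> : ell k.+1 = ell k / 2 :> R by rewrite [ell k]ellS mulrC mulKf// pnatr_eq0.
  have -> : (4 : R) = 2 * 2 by rewrite -natrM.
  move: (ell k : R) e0 => e e0'.
  rewrite !exprMn !exprVn [e ^+ n.+1]exprS [e ^+ n]exprS.
  have en : e != 0 by rewrite gt_eqF.
  have edn : e ^+ d != 0 by rewrite expf_neq0.
  have tn : (2 : R) ^+ n != 0 by rewrite expf_neq0// pnatr_eq0.
  move: (e ^+ d) edn (2 ^+ n : R) tn (5 ^+ n.+1 : R) => x x0 t t0 z.
  by field; rewrite x0 en t0.
have D2 : `|mean A f - mean B f| `^ p <=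
    (poincare_cst / ell k ^+ d) `^ p * (n%:R `^ (p - 1) * \sum_(i < n) X i `^ p).
  apply: (@le_trans _ _ ((poincare_cst / ell k ^+ d * \sum_(i < n) X i) `^ p)).
    apply: ge0_ler_powR; rewrite ?nnegrE//; first by rewrite (le_trans ler01).
    by rewrite mulr_ge0 ?SX0// divr_ge0// ltW.
  rewrite powRM ?SX0//; last by rewrite divr_ge0// ltW.
  apply: ler_wpM2l; first exact: powR_ge0.
  have := @powR_sum_weighted R 'I_n (index_enum _) (fun=> 1) X p p1 (fun=> ltr01) X0.
  rewrite sumr_const card_ord.
  by under eq_bigr do rewrite mul1r; under [X in _ <= _ * X]eq_bigr do rewrite mul1r.
have [->|Efin] := eqVneq (energy g k m) +oo%E.
  by rewrite gt0_muley ?leey// lte_fin divr_gt0 ?gradient_cst_gt0 ?logw_gt0.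
have [r r0 Er] : exists2 r, 0 <= r & energy g k m = r%:E.
  exists (fine (energy g k m)); first by rewrite fine_ge0// energy_ge0.
  by rewrite fineK// ge0_fin_numE ?energy_ge0// ltey.
pose c := ((5 * ell k) ^+ n) `^ (p - 1) / region_weight p lambda k.
have D3 : \sum_(i < n) X i `^ p <= n%:R * (c * r).
  have -> : n%:R * (c * r) = \sum_(i < n) c * r.
    by rewrite sumr_const card_ord mulr_natl.
  apply: ler_sum => i _; rewrite -lee_fin EFinM -Er.
  apply: integral_region_powR => //; first by apply: integrable_region; have [] := wG i.
  by move=> y _; rewrite [leRHS]ger0_norm ?enorm_ge0//; exact: normr_le_enorm.
rewrite Er -EFinM lee_fin.
apply: (@le_trans _ _ (ell k ^+ d * ((poincare_cst / ell k ^+ d) `^ p *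
    (n%:R `^ (p - 1) * (n%:R * (c * r)))))).
  rewrite ler_pM2l//; apply: (le_trans D2).
  by rewrite !ler_wpM2l ?powR_ge0.
rewrite le_eqVlt; apply/orP; left; apply/eqP.
have pE (x : R) : 0 < x -> x `^ p = x * x `^ (p - 1).
  by move=> x0; rewrite -{2}(powRr1 (ltW x0)) -powRD ?(gt_eqF x0) ?implybT// addrC subrK.
have nn0 : 0 < n%:R :> R by rewrite ltr0n.
have h1 : (poincare_cst / ell k ^+ d) `^ p =
    poincare_cst `^ p * ((ell k ^+ d)^-1 * ((ell k `^ (p - 1)) ^+ d)^-1).
  rewrite powRM ?invr_ge0 ?(ltW K0) ?(ltW ed0)//; congr (_ * _).
  rewrite pE ?invr_gt0//; congr (_ * _).
  rewrite -[X in X `^ _]powR_inv1 ?(ltW ed0)// -powRrM mulN1r powRN.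
  by rewrite powR_exprn// ltW.
have h2 : ((5 * ell k) ^+ n) `^ (p - 1) = (5 ^+ n) `^ (p - 1) * (ell k `^ (p - 1) * (ell k `^ (p - 1)) ^+ d).
  rewrite exprMn powRM ?exprn_ge0 ?(ltW e0)//; congr (_ * _).
  by rewrite powR_exprn ?(ltW e0)// exprS.
rewrite /c /gradient_cst /region_weight h1 h2 (pE _ nn0).
have en : ell k ^+ d != 0 :> R by rewrite gt_eqF.
have t0 : 0 < ell k `^ (p - 1) :> R by rewrite powR_gt0.
have tn : ell k `^ (p - 1) != 0 :> R by rewrite gt_eqF.
have tdn : (ell k `^ (p - 1)) ^+ d != 0 :> R by rewrite expf_neq0.
have rn : region_weight_cst p lambda != 0 by rewrite gt_eqF// region_weight_cst_gt0.
have ln_ : logw k != 0 by rewrite gt_eqF// logw_gt0.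
move: ((ell k `^ (p - 1)) ^+ d) tdn => td td0.
move: (ell k `^ (p - 1)) tn => t t1.
move: (ell k ^+ d) en => x x0.
move: (region_weight_cst p lambda) rn => a a0.
move: (logw k) ln_ => b b0.
move: (poincare_cst `^ p) (n%:R : R) (n%:R `^ (p - 1)) ((5 ^+ n) `^ (p - 1)) => q1 q2 q3 q4.
by field; rewrite x0 t1 td0 a0 b0.
Qed.

(** Jensen's inequality alone bounds the averages of generation 0, where the
    weight is bounded below. *)
Lemma mean_energy0 m : ((`|mean (nb 0 m) f| `^ p)%:E <=
  ((5 ^+ n) `^ (p - 1) / region_weight p lambda 0)%:E * energy f 0 m)%E.
Proof.
have NU : @nb R d 0 m `<=` region 0 m by exact: nb_region.
have := @nb_vol R d 0 m; rewrite ell0 expr1n => v1.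
have ir : mu.-integrable (region 0 m) (EFin \o f) by exact: integrable_region.
have iN : mu.-integrable (nb 0 m) (EFin \o f).
  by apply: integrableS ir => //; [exact: measurable_region|exact: measurable_nb].
have mf : measurable_fun (region 0 m) f by apply/measurable_EFinP; exact: measurable_int ir.
have := integral_region_powR ir mf (fun y _ => lexx _).
rewrite ell0 mulr1; apply: le_trans; rewrite lee_fin.
apply: ge0_ler_powR; rewrite ?nnegrE//; first by rewrite (le_trans ler01).
  exact: Rintegral_ge0.
rewrite /mean normrM ger0_norm ?invr_ge0 ?fine_ge0//.
apply: (@le_trans _ _ (1 * `|\int[mu]_(x in nb 0 m) f x|)).
  apply: ler_wpM2r => //; rewrite invf_le1//; exact: lt_le_trans v1.
rewrite mul1r; apply: (le_trans (le_normr_Rintegral (@measurable_nb R d 0 m) iN)).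
rewrite -(Rintegral_indic _ _ NU); apply: le_Rintegral.
- exact: measurable_region.
- apply: integrable_indic; [exact: measurable_region|exact: measurable_nb|exact: NU|].
  exact: integrable_norm.
- exact: integrable_norm.
- move=> x _; rewrite indicE; case: (x \in _); rewrite ?mulr1 ?mulr0//.
Qed.

Lemma adjacent_means k m m' :
  (forall i, m ord0 i - 1 <= m' ord0 i <= m ord0 i + 1) ->
  ((ell k ^+ d * `|mean (nb k m) f - mean (nb k m') f| `^ p)%:E <=
   (gradient_cst / logw k)%:E * energy g k m)%E.
Proof.
move=> mm; apply: mean_difference_energy.
- exact: sup_open_nb.
- exact: sup_open_nb.
- exact: nb_region.
- exact: nb_region_adjacent.
- exact: nb_vol_child.
- exact: nb_vol_child.
Qed.

Lemma child_means k m m' :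
  (forall i, 2 * m ord0 i <= m' ord0 i <= 2 * m ord0 i + 1) ->
  ((ell k ^+ d * `|mean (nb k.+1 m') f - mean (nb k m) f| `^ p)%:E <=
   (gradient_cst / logw k)%:E * energy g k m)%E.
Proof.
move=> mm; apply: mean_difference_energy.
- exact: sup_open_nb.
- exact: sup_open_nb.
- exact: nb_region_child.
- exact: nb_region.
- exact: nb_vol.
- exact: nb_vol_child.
Qed.

End local_estimates.


(** * Countable partitions and bounded overlap *)

Section countable_families.
Context d (T : measurableType d) (R : realType) (mu : {measure set T -> \bar R}).

Lemma esum_nat_embedding (I : countType) (a : I -> \bar R) :
  (forall i, 0 <= a i)%E ->
  (\sum_(0 <= l <oo) (if unpickle l is Some i then
      (if pickle i == l then a i else 0) else 0) = \esum_(i in [set: I]) a i)%E.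
Proof.
move=> a0; pose b (l : nat) : \bar R :=
  (if unpickle l is Some i then (if pickle i == l then a i else 0) else 0)%E.
have b0 l : (0 <= b l)%E by rewrite /b; case: (unpickle l) => // i; case: ifP.
have bE i : b (pickle i) = a i by rewrite /b pickleK eqxx.
rewrite -/b nneseries_esumT; last by move=> l; exact: b0.
transitivity (\esum_(l in range (@pickle I)) b l)%E.
  rewrite [RHS]esum_mkcond; apply: eq_esum => l _; case: ifPn => // /negP h.
  rewrite /b; case E : (unpickle l) => [i|//]; case: ifPn => // /eqP il.
  by exfalso; apply: h; rewrite inE; exists i.
rewrite (@reindex_esum R I nat setT (range (@pickle I)) (@pickle I)).
  by apply: eq_esum => i _.
split.
- by move=> i _; exists i.
- by move=> i j _ _ /(pcan_inj (@pickleK I)).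
- by move=> l.
Qed.

Lemma integral_partition (I : countType) (F : I -> set T) (f : T -> \bar R) :
  (forall i, measurable (F i)) -> trivIset setT F -> \bigcup_i F i = setT ->
  measurable_fun setT f -> (forall x, 0 <= f x)%E ->
  (\int[mu]_x f x = \esum_(i in [set: I]) \int[mu]_(x in F i) f x)%E.
Proof.
move=> mF tF UF mf f0.
pose F' (l : nat) : set T := if unpickle l is Some i then
  (if pickle i == l then F i else set0) else set0.
have mF' l : measurable (F' l).
  by rewrite /F'; case: (unpickle l) => // i; case: ifP.
have tF' : trivIset setT F'.
  apply/trivIsetP => l l' _ _ ll; rewrite /F'.
  case: (unpickle l) => [i|]; last by rewrite set0I.
  case: ifPn => [/eqP il|_]; last by rewrite set0I.
  case: (unpickle l') => [j|]; last by rewrite setI0.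
  case: ifPn => [/eqP jl|_]; last by rewrite setI0.
  move/trivIsetP : tF; apply => //; apply: contra_neq ll => ij.
  by rewrite -il -jl ij.
have UF' : \bigcup_l F' l = setT.
  rewrite -UF; apply/seteqP; split => x [l _].
    rewrite /F'; case: (unpickle l) => [i|//]; case: ifPn => // _ Fx.
    by exists i.
  by move=> Fx; exists (pickle l) => //; rewrite /F' pickleK eqxx.
rewrite -[in LHS]UF' ge0_integral_bigcup//; last by rewrite UF'.
rewrite -esum_nat_embedding; last by move=> i; exact: integral_ge0.
apply: eq_eseriesr => l _; rewrite /F'; case: (unpickle l) => [i|].
  by case: ifP => // _; rewrite integral_set0.
by rewrite integral_set0.
Qed.

(** When the sets that contain a given point have distinct labels in a finite
    type, there are at most as many of them as there are labels. *)
Lemma esum_integral_overlap (I : choiceType) (L : finType) (D : set T)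
    (U : I -> set T) (e : I -> L) (f : T -> \bar R) :
  measurable D -> (forall i, measurable (U i)) -> (forall i, U i `<=` D) ->
  (forall y i j, U i y -> U j y -> e i = e j -> i = j) ->
  measurable_fun D f -> (forall y, D y -> 0 <= f y)%E ->
  (\esum_(i in [set: I]) \int[mu]_(y in U i) f y <=
   #|L|%:R%:E * \int[mu]_(y in D) f y)%E.
Proof.
move=> mD mU UD eU mf f0; apply: ge_ereal_sup => _ [X [finX _] <-].
rewrite fsbig_finite//=; set s : seq I := finmap.enum_fset (fset_set X).
have us : uniq s by exact: finmap.fset_uniq.
have -> : (\sum_(i <- s) \int[mu]_(y in U i) f y = \int[mu]_(y in D) \sum_(i <- s) (f y * (\1_(U i) y)%:E))%E.
  rewrite ge0_integral_sum//.
  - apply: eq_bigr => i _.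
    rewrite -[in LHS](setIidr (UD i)) integral_mkcondr; apply: eq_integral => y _.
    by rewrite /patch indicE; case: (y \in U i); rewrite ?mule1 ?mule0.
  - move=> i; apply: emeasurable_funM => //; apply/measurable_EFinP.
    exact: (measurable_funS measurableT).
  - by move=> i y Dy; rewrite mule_ge0 ?f0// lee_fin indicE.
rewrite -ge0_integralZl//; apply: ge0_le_integral => //.
- by move=> y Dy; apply: sume_ge0 => i _; rewrite mule_ge0 ?f0// lee_fin indicE.
- apply: emeasurable_sum => i; apply: emeasurable_funM => //; apply/measurable_EFinP.
  exact: (measurable_funS measurableT).
- exact: measurable_funeM.
move=> y Dy; rewrite -ge0_sume_distrr; last by move=> i _; rewrite lee_fin indicE.
rewrite muleC; apply: lee_wpmul2r; first exact: f0.
rewrite sumEFin lee_fin.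
have -> : \sum_(i <- s) \1_(U i) y = (size [seq i <- s | y \in U i])%:R :> R.
  rewrite size_filter -sum1_count natr_sum [RHS]big_mkcond; apply: eq_bigr => i _.
  by rewrite indicE; case: (y \in U i).
rewrite ler_nat -(size_map e).
apply: (leq_trans _ (max_card [in map e [seq i <- s | y \in U i]])).
suff /card_uniqP -> : uniq (map e [seq i <- s | y \in U i]) by [].
rewrite map_inj_in_uniq ?filter_uniq// => i j.
rewrite !mem_filter => /andP[Ui _] /andP[Uj _].
by apply: (eU y); exact: set_mem.
Qed.

End countable_families.

Section dyadic_index.
Context {R : realType}.
Variable d : nat.
Implicit Types (k : nat) (m : 'rV[int]_d) (x : 'rV[R]_d).

(** Dyadic cubes are closed on the right, hence the ceiling. *)
Definition idx k x : 'rV[int]_d := \row_i (Num.ceil (x ord0 i / ell k) - 1).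

Lemma qcubeP k m x : qcube k m x <-> idx k x = m.
Proof.
have l0 := @ell_gt0 R k.
have E i : (ell k * (m ord0 i)%:~R < x ord0 i <= ell k * ((m ord0 i)%:~R + 1)) =
    (Num.ceil (x ord0 i / ell k) == m ord0 i + 1).
  rewrite ceil_eq addrK ltr_pdivlMr// ler_pdivrMr// ![_ * ell k]mulrC.
  by rewrite rmorphD.
rewrite qcubeE; split => [h|h i].
  by apply/rowP => i; rewrite mxE; have := h i; rewrite E => /eqP ->; rewrite addrK.
by rewrite /= E -h mxE subrK.
Qed.

Lemma idx_qcube k x : qcube k (idx k x) x.
Proof. exact/qcubeP. Qed.

Lemma measurable_qcube k m : measurable (@qcube R d k m).
Proof. by rewrite qcubeE; exact: measurable_box. Qed.

Lemma trivIset_qcube k : trivIset setT (@qcube R d k).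
Proof.
apply/trivIsetP => m m' _ _ mm; rewrite -subset0 => x [/qcubeP h /qcubeP h'].
by move: mm; rewrite -h -h' eqxx.
Qed.

Lemma bigcup_qcube k : \bigcup_m @qcube R d k m = setT.
Proof. by apply/seteqP; split => // x _; exists (idx k x) => //; exact: idx_qcube. Qed.

Lemma lebesgue_row_qcube k m : lebesgue_row d (@qcube R d k m) = (ell k ^+ d)%:E.
Proof.
have l0 := @ell_gt0 R k.
rewrite qcubeE lebesgue_row_box => [|i]; last by rewrite ler_pM2l// lerDl.
congr EFin; rewrite -[d in RHS]card_ord -prodr_const.
by apply: eq_bigr => i _; ring.
Qed.

Lemma measurable_idx d' (T : measurableType d') k (H : 'rV[int]_d -> T) :
  measurable_fun setT (fun x => H (idx k x)).
Proof.
move=> _ Y mY; rewrite setTI.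
have -> : (fun x => H (idx k x)) @^-1` Y =
    \bigcup_(m : 'rV[int]_d) (if `[< Y (H m) >] then qcube k m else set0).
  apply/seteqP; split => x /=.
    move=> Yx; exists (idx k x) => //; case: asboolP => // _; exact: idx_qcube.
  by move=> [m _]; case: asboolP => // Ym /qcubeP ->.
apply: countable_bigcupT_measurable => [|m]; first exact: countableP.
by case: ifP => _ //; exact: measurable_qcube.
Qed.

Lemma integral_idx k (H : 'rV[int]_d -> \bar R) : (forall m, 0 <= H m)%E ->
  (\int[lebesgue_row d]_x H (idx k x) =
   \esum_(m in [set: 'rV[int]_d]) (H m * (ell k ^+ d)%:E))%E.
Proof.
move=> H0.
rewrite (@integral_partition _ _ _ (lebesgue_row d) _ _ (fun x => H (idx k x))
  (measurable_qcube k) (@trivIset_qcube k) (bigcup_qcube k))//; last exact: measurable_idx.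
apply: eq_esum => m _.
rewrite (eq_integral (cst (H m))); last by move=> x; rewrite inE => /qcubeP ->.
rewrite integral_cst; last exact: measurable_qcube.
by congr (_ * _)%E; exact: lebesgue_row_qcube.
Qed.

Lemma idx_child k x i :
  2 * idx k x ord0 i <= idx k.+1 x ord0 i <= 2 * idx k x ord0 i + 1.
Proof.
rewrite !mxE; set t := x ord0 i / ell k.
have -> : x ord0 i / ell k.+1 = 2 * t.
  rewrite /t (ellS k) invfM mulrA; have := @ell_gt0 R k.+1; move: (ell k.+1) => e e0.
  by field; rewrite gt_eqF.
have /andP[h1 h2] := ceil_itv t.
have h3 : Num.ceil (2 * t) <= 2 * Num.ceil t.
  by rewrite ceil_le_int rmorphM/= ler_pM2l.
have h4 : 2 * (Num.ceil t - 1) < Num.ceil (2 * t).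
  by rewrite ceil_gt_int rmorphM/= ltr_pM2l.
move: h3 h4; move: (Num.ceil _) (Num.ceil _) => a b; lia.
Qed.

Lemma idx_coarser k j x z : idx (k + j) x = idx (k + j) z -> idx k x = idx k z.
Proof.
elim: j => [|j IH]; first by rewrite addn0.
rewrite addnS => h; apply: IH; apply/rowP => i.
have := idx_child (k + j) x i; have := idx_child (k + j) z i; rewrite h.
move: (idx _ x ord0 i) (idx _ z ord0 i) (idx _ z ord0 i) => a b c; lia.
Qed.

Lemma esum_shift (e : 'rV[int]_d) (a : 'rV[int]_d -> \bar R) :
  (\esum_(m in [set: 'rV[int]_d]) a (m + e)%R = \esum_(m in [set: 'rV[int]_d]) a m)%E.
Proof.
apply/esym/(@reindex_esum R _ _ setT setT (fun m => m + e)).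
split => //; first by move=> m m' _ _ /addIr.
by move=> m _; exists (m - e) => //; rewrite subrK.
Qed.

Lemma integral_idx_shift k (e : 'rV[int]_d) (H : 'rV[int]_d -> \bar R) : (forall m, 0 <= H m)%E ->
  (\int[lebesgue_row d]_x H (idx k x + e)%R = \int[lebesgue_row d]_x H (idx k x))%E.
Proof.
move=> H0; rewrite (integral_idx k (fun m => H0 (m + e))) (integral_idx k H0).
exact: (esum_shift e (fun m => H m * (ell k ^+ d)%:E)%E).
Qed.

End dyadic_index.


(** * A discrete Hardy inequality *)

Section series_estimates.
Context {R : realType}.
Implicit Types (p lambda gamma s x y : R).

Definition controls_tails p lambda (kap : nat -> nat -> R) : Prop :=
  forall x : nat -> R, (forall i, 0 <= x i) -> forall n N,
    (\sum_(n <= i < N) x i) `^ p <=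
    \sum_(n <= i < N) kap n i * (logw lambda i * x i `^ p).

(** Convexity of x^(1-s): over [i + 1, i + 2] it decreases at least at the
    rate it has at the right end, which makes the series telescope. *)
Lemma powR_tail_telescope s (i : nat) : 1 < s ->
  i.+2%:R `^ (- s) <= (i.+1%:R `^ (1 - s) - i.+2%:R `^ (1 - s)) / (s - 1).
Proof.
move=> s1; have s0 : 0 < s - 1 by rewrite subr_gt0.
have a0 : 0 < i.+1%:R :> R by rewrite ltr0n.
have b0 : 0 < i.+2%:R :> R by rewrite ltr0n.
have ab : i.+2%:R = i.+1%:R + 1 :> R by rewrite -natr1.
move: (i.+1%:R : R) (i.+2%:R : R) a0 b0 ab => a b a0 b0 ab.
rewrite ler_pdivlMr//.
have an : a != 0 by rewrite gt_eqF.
have bn : b != 0 by rewrite gt_eqF.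
rewrite /powR (negbTE an) (negbTE bn).
have lab : ln b - ln a >= b^-1.
  have := expR_ge1Dx (ln a - ln b).
  by rewrite expRB !lnK ?posrE// ab => h; have -> : (a + 1)^-1 = 1 - a / (a + 1);
    [field; rewrite -ab|lra].
have -> : - s * ln b = (1 - s) * ln b - ln b by ring.
have -> : (1 - s) * ln a = (1 - s) * ln b + (s - 1) * (ln b - ln a) by ring.
rewrite expRB expRD lnK ?posrE//.
rewrite -[X in _ <= _ - X]mulr1 -mulrBr -mulrA ler_pM2l ?expR_gt0//.
have := expR_ge1Dx ((s - 1) * (ln b - ln a)).
have : (s - 1) * b^-1 <= (s - 1) * (ln b - ln a) by rewrite ler_pM2l.
rewrite mulrC; lra.
Qed.

Lemma sum_powR_tail s (n N : nat) : 1 < s ->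
  \sum_(n <= i < N) i.+2%:R `^ (- s) <= n.+1%:R `^ (1 - s) / (s - 1).
Proof.
move=> s1; have s0 : 0 < s - 1 by rewrite subr_gt0.
case: (leqP N n) => [Nn|/ltnW nN].
  by rewrite big_geq// divr_ge0 ?powR_ge0// ltW.
apply: (@le_trans _ _ (\sum_(n <= i < N) (i.+1%:R `^ (1 - s) - i.+2%:R `^ (1 - s)) / (s - 1))).
  by apply: ler_sum => i _; exact: powR_tail_telescope.
rewrite -mulr_suml ler_wpM2r ?invr_ge0 ?(ltW s0)//.
under eq_bigr do rewrite -opprB.
rewrite sumrN (telescope_sumr (fun i => i.+1%:R `^ (1 - s)) nN) opprB.
by rewrite gerBl powR_ge0.
Qed.

Lemma sum_geometric_lt1 x (J : nat) : 0 <= x -> x < 1 -> \sum_(j < J) x ^+ j <= (1 - x)^-1.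
Proof.
move=> x0 x1; have h : 0 < 1 - x by rewrite subr_gt0.
rewrite -[leRHS]mul1r ler_pdivlMr//.
suff -> : (\sum_(j < J) x ^+ j) * (1 - x) = 1 - x ^+ J by rewrite gerBl exprn_ge0.
elim: J => [|J IH]; first by rewrite big_ord0 mul0r expr0 subrr.
by rewrite big_ord_recr/= mulrDl IH exprSr; ring.
Qed.

Lemma sum_geometric_gt1 x (J : nat) : 1 < x -> \sum_(j < J) x ^+ j <= x ^+ J / (x - 1).
Proof.
move=> x1; have h : 0 < x - 1 by rewrite subr_gt0.
rewrite ler_pdivlMr//.
suff -> : (\sum_(j < J) x ^+ j) * (x - 1) = x ^+ J - 1 by rewrite gerBl.
elim: J => [|J IH]; first by rewrite big_ord0 mul0r expr0 subrr.
by rewrite big_ord_recr/= mulrDl IH exprSr; ring.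
Qed.

Lemma powR_pow2 x (j : nat) : (2 ^+ j : R) `^ x = (2 `^ x) ^+ j.
Proof.
elim: j => [|j IH]; first by rewrite !expr0 powR1.
by rewrite !exprS powRM ?exprn_ge0// IH.
Qed.

Let pow2_gt1 gamma : 0 < gamma -> 1 < 2 `^ gamma :> R.
Proof.
move=> g0; have := @gt0_ltr_powR R gamma g0 1 2.
by rewrite powR1; apply; rewrite ?nnegrE// ltr1n.
Qed.

Lemma sum_dyadic_upto gamma (i J : nat) : 0 < gamma ->
  \sum_(j < J | (2 ^ j <= i)%N) (2 ^+ j : R) `^ gamma <=
  2 `^ gamma / (2 `^ gamma - 1) * i%:R `^ gamma.
Proof.
move=> g0; have x1 := pow2_gt1 g0; set x : R := 2 `^ gamma in x1 *.
have h : 0 < x - 1 by rewrite subr_gt0.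
elim: J => [|J IH].
  by rewrite big_ord0 mulr_ge0 ?powR_ge0// divr_ge0 ?(ltW h)// ltW// (lt_trans ltr01).
rewrite big_mkcond big_ord_recr/= -big_mkcond/=.
case: ifPn => [Ji|_]; last by rewrite addr0.
apply: (@le_trans _ _ (\sum_(j < J.+1) x ^+ j)).
  rewrite big_ord_recr/= -powR_pow2 lerD2r big_mkcond/=.
  apply: ler_sum => j _; rewrite powR_pow2 -/x; case: ifP => // _.
  by rewrite exprn_ge0// ltW// (lt_trans ltr01).
apply: (le_trans (sum_geometric_gt1 _ x1)).
rewrite exprS mulrAC; apply: ler_wpM2l.
  by rewrite divr_ge0 ?(ltW h)// ltW// (lt_trans ltr01).
rewrite /x -powR_pow2; apply: ge0_ler_powR; rewrite ?nnegrE ?exprn_ge0 ?(ltW g0)//.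
by rewrite -natrX ler_nat.
Qed.

(** A discrete Hardy inequality. The tails of a series are controlled in the
    p-th power by weighted p-th powers of its terms, and the tails that start
    at the indices 2^j can moreover be summed against (2^j + 2)^gamma. For
    p = 1 the weights 1 / logw i serve for all tails, and the sum over j
    up to log_2 i is geometric, of order i^gamma. For p > 1 Jensen's inequality
    with the summable weights (i + 2)^(-lambda / (p - 1)) gains the factor
    n^(p - 1 - lambda) on the tail from n on, and gamma < lambda - (p - 1)
    makes the sum over j a convergent geometric series. *)
Lemma hardy_weights p lambda gamma : 1 <= p -> 0 < gamma ->
  (1 < p -> gamma < lambda - (p - 1)) -> (p = 1 -> gamma <= lambda) ->
  exists (kap : nat -> nat -> R) (K : R),
  [/\ 0 < K,
      forall n i, 0 <= kap n i,
      controls_tails p lambda kap,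
      forall i J, \sum_(j < J | (2 ^ j <= i)%N)
        (2 ^+ j + 2) `^ gamma * kap (2 ^ j)%N i <= K &
      forall i, kap 0%N i <= K].
Proof.
move=> p1 g0 gp g1; move: p1; rewrite le_eqVlt => /predU1P[p1|p1].
  have gl := g1 (esym p1); rewrite -{}p1 {g1 gp}.
  have l0 : 0 < lambda by exact: lt_le_trans gl.
  have x1 := pow2_gt1 g0; have h : 0 < 2 `^ gamma - 1 :> R by rewrite subr_gt0.
  pose C : R := 3 `^ gamma * (2 `^ gamma / (2 `^ gamma - 1)).
  have C0 : 0 < C by rewrite mulr_gt0 ?powR_gt0// divr_gt0// powR_gt0.
  have w0 i : 0 < logw lambda i :> R by exact: logw_gt0.
  exists (fun _ i => (logw lambda i)^-1), (C + 1); split.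
  - by rewrite addr_gt0.
  - by move=> _ i; rewrite invr_ge0 ltW.
  - move=> x x0 n N; rewrite powRr1; last by apply: sumr_ge0 => i _.
    apply: ler_sum => i _; rewrite powRr1// mulKf// gt_eqF//; exact: w0.
  - move=> i J; rewrite -mulr_suml ler_pdivrMr//.
    apply: (@le_trans _ _ (C * i%:R `^ gamma)).
      rewrite /C -mulrA; apply: le_trans (ler_wpM2l (powR_ge0 3 gamma) (sum_dyadic_upto i J g0)).
      rewrite mulr_sumr; apply: ler_sum => j _; rewrite -powRM ?exprn_ge0//.
      apply: ge0_ler_powR; rewrite ?nnegrE ?addr_ge0 ?mulr_ge0 ?exprn_ge0 ?(ltW g0)//.
      have : 1 <= 2 ^+ j :> R by rewrite exprn_ege1// ler1n.
      move: (2 ^+ j : R) => y; lra.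
    apply: ler_pM; rewrite ?powR_ge0 ?(ltW C0)//; first by rewrite lerDl.
    apply: (@le_trans _ _ (i.+2%:R `^ gamma)).
      by apply: ge0_ler_powR; rewrite ?nnegrE ?(ltW g0)// ler_nat ltnW.
    by apply: ler_powR => //; rewrite ler1n.
  - move=> i; apply: (@le_trans _ _ 1); last by rewrite lerDr ltW.
    rewrite invf_le1 ?w0//; have : 1 <= i.+2%:R :> R by rewrite ler1n.
    by move=> /ler_powR/(_ 0 lambda (ltW l0)); rewrite powRr0.
have {}gp := gp p1; have p0 : 0 < p - 1 by rewrite subr_gt0.
pose del := lambda - (p - 1); have dg : gamma < del by [].
pose s := lambda / (p - 1).
have s1 : 1 < s by rewrite /s ltr_pdivlMr// mul1r; move: dg; rewrite /del; lra.
have s0 : 0 < s - 1 by rewrite subr_gt0.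
have sE : (1 - s) * (p - 1) = - del.
  by rewrite /s /del; field; rewrite gt_eqF.
pose c : R := ((s - 1)^-1) `^ (p - 1).
have c0 : 0 < c by rewrite powR_gt0// invr_gt0.
pose q : R := 2 `^ (gamma - del).
have q0 : 0 < q by rewrite powR_gt0.
have q1 : q < 1.
  rewrite /q -opprB powRN invf_lt1 ?powR_gt0//; apply: pow2_gt1.
  by rewrite subr_gt0.
pose kap (n i : nat) : R := n.+1%:R `^ (- del) * c.
have kapE n i : (n.+1%:R `^ (1 - s) / (s - 1)) `^ (p - 1) = kap n i.
  by rewrite powRM ?powR_ge0 ?invr_ge0 ?(ltW s0)// -powRrM sE.
exists kap, (2 `^ gamma / (1 - q) * c + c); split.
- rewrite addr_gt0// mulr_gt0// divr_gt0 ?powR_gt0//; by rewrite subr_gt0.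
- by move=> n i; rewrite mulr_ge0 ?powR_ge0// ltW.
- move=> x x0 n N.
  (* The sum of these weights from n on is of order (n + 1)^(1 - s), and
     (1 - s) (p - 1) = p - 1 - lambda. *)
  pose th (i : nat) : R := i.+2%:R `^ (- s).
  have th0 i : 0 < th i by rewrite powR_gt0.
  have := @powR_sum_weighted R nat (index_iota n N) th (fun i => x i / th i) p (ltW p1) th0
    (fun i => divr_ge0 (x0 i) (ltW (th0 i))).
  have -> : \sum_(n <= i < N) th i * (x i / th i) = \sum_(n <= i < N) x i.
    by apply: eq_bigr => i _; rewrite mulrC divfK// gt_eqF.
  have -> : \sum_(n <= i < N) th i * (x i / th i) `^ p =
      \sum_(n <= i < N) logw lambda i * x i `^ p.
    apply: eq_bigr => i _; rewrite powRM ?x0 ?invr_ge0 ?(ltW (th0 i))// mulrCA mulrC.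
    congr (_ * _); rewrite /th /logw.
    have y0 : 0 < i.+2%:R :> R by rewrite ltr0n.
    move: (i.+2%:R : R) y0 => y y0.
    rewrite -powRN -powRrM -powRD ?(gt_eqF y0) ?implybT//; congr powR.
    by rewrite /s; field; rewrite gt_eqF.
  move=> H; apply: (le_trans H); rewrite mulr_sumr.
  apply: ler_sum => i _; apply: ler_wpM2r; first by rewrite mulr_ge0 ?powR_ge0// ltW// logw_gt0.
  rewrite -(kapE n i); apply: ge0_ler_powR; rewrite ?nnegrE ?(ltW p0)//.
  + by apply: sumr_ge0 => j _; rewrite ltW.
  + by rewrite divr_ge0 ?powR_ge0// ltW.
  + exact: sum_powR_tail.
- move=> i J; apply: (@le_trans _ _ (2 `^ gamma / (1 - q) * c)); last by rewrite lerDl ltW.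
  rewrite /kap; under eq_bigr do rewrite mulrA.
  rewrite -mulr_suml ler_pM2r//.
  apply: (@le_trans _ _ (\sum_(j < J) 2 `^ gamma * q ^+ j)); last first.
    rewrite -mulr_sumr ler_pM2l ?powR_gt0//; exact: sum_geometric_lt1 (ltW q0) q1.
  rewrite big_mkcond; apply: ler_sum => j _; case: ifP => _; last first.
    by rewrite mulr_ge0 ?powR_ge0// exprn_ge0// ltW.
  have -> : (2 ^ j).+1%:R = 2 ^+ j + 1 :> R by rewrite -[LHS]natr1 natrX.
  rewrite /q -powR_pow2.
  have : 1 <= 2 ^+ j :> R by rewrite exprn_ege1// ler1n.
  move: (2 ^+ j : R) => y y1.
  have y0 : 0 < y by exact: lt_le_trans y1.
  apply: (@le_trans _ _ ((2 * (y + 1)) `^ gamma * (y + 1) `^ (- del))).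
    apply: ler_wpM2r; first exact: powR_ge0.
    by apply: ge0_ler_powR; rewrite ?nnegrE ?(ltW g0)//; lra.
  have z0 : 0 < y + 1 by rewrite addr_gt0.
  rewrite powRM ?(ltW z0)// -mulrA ler_pM2l ?powR_gt0//.
  rewrite -powRD ?(gt_eqF z0) ?implybT// -opprB !powRN lef_pV2 ?posrE ?powR_gt0//.
  by apply: ge0_ler_powR; rewrite ?nnegrE ?subr_ge0 ?(ltW dg) ?(ltW y0) ?(ltW z0)// lerDl.
- move=> i; rewrite /kap powR1 mul1r lerDr.
  by rewrite mulr_ge0 ?(ltW c0)// divr_ge0 ?powR_ge0// ltW// subr_gt0.
Qed.

End series_estimates.


(** * Convergence from weighted increments *)

Section convergence_from_weighted_increments.
Context {R : realType}.
Variables (p lambda : R) (kap : nat -> nat -> R).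
Hypotheses (p1 : 1 <= p) (kap0 : forall n i, 0 <= kap n i).
Hypothesis kapP : controls_tails p lambda kap.
Implicit Types (t : nat -> R) (n N i : nat).

Definition tail_term t n i : R :=
  if (n <= i)%N then kap n i * (logw lambda i * `|t i.+1 - t i| `^ p) else 0.

Lemma tail_term_ge0 t n i : 0 <= tail_term t n i.
Proof.
rewrite /tail_term; case: ifP => // _.
by rewrite mulr_ge0// mulr_ge0 ?powR_ge0// ltW// logw_gt0.
Qed.

Definition tail_bound t n : \bar R := (\sum_(0 <= i <oo) (tail_term t n i)%:E)%E.

Lemma increments_le_tail_bound t n N :
  (((\sum_(n <= i < N) `|t i.+1 - t i|) `^ p)%:E <= tail_bound t n)%E.
Proof.
apply: (@le_trans _ _ (\sum_(0 <= i < N) (tail_term t n i)%:E)%E); last first.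
  by apply: nneseries_lim_ge => i _ _; rewrite lee_fin tail_term_ge0.
rewrite sumEFin lee_fin.
have H := kapP (fun i => normr_ge0 (t i.+1 - t i)) n N.
apply: (le_trans H).
case: (leqP n N) => [nN|/ltnW Nn]; last first.
  by rewrite [leLHS]big_geq//; apply: sumr_ge0 => i _; exact: tail_term_ge0.
rewrite (@big_cat_nat _ _ _ n 0 N)//= -[leLHS]add0r; apply: lerD.
  by apply: sumr_ge0 => i _; exact: tail_term_ge0.
rewrite big_nat [leRHS]big_nat; apply: ler_sum => i /andP[ni _].
by rewrite /tail_term ni.
Qed.

Let p0 : 0 < p. Proof. exact: lt_le_trans p1. Qed.

(** The increments are absolutely summable. *)
Lemma cvg_of_tail_bound t : (tail_bound t 0 < +oo)%E -> cvgn t.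
Proof.
move=> tb; pose M := fine (tail_bound t 0).
have tbE : tail_bound t 0 = M%:E.
  rewrite fineK// ge0_fin_numE//; apply: nneseries_ge0 => i _ _.
  by rewrite lee_fin tail_term_ge0.
pose u i := t i.+1 - t i.
have bu N : \sum_(0 <= i < N) `|u i| <= 1 + M.
  have := increments_le_tail_bound t 0 N; rewrite tbE lee_fin.
  have : 0 <= \sum_(0 <= i < N) `|u i| by exact: sumr_ge0.
  rewrite -/u; move: (\sum_(0 <= i < N) `|u i|) => y y0 yM.
  have M0 : 0 <= M by apply: le_trans yM; exact: powR_ge0.
  case: (leP y 1) => [h|/ltW h]; first by rewrite (le_trans h)// lerDl.
  apply: (@le_trans _ _ (y `^ p)); last by rewrite (le_trans yM)// lerDr.
  by rewrite -[leLHS]powRr1//; apply: ler_powR.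
have cu : cvgn (series u).
  apply: normed_cvg; apply: nondecreasing_is_cvgn.
    by apply: nondecreasing_series => i _ _; exact: normr_ge0.
  by exists (1 + M) => _ [N _ <-]; exact: bu.
have tE : t = (fun N => t 0%N + series u N).
  apply/funext => N; rewrite /series/= /u telescope_sumr//.
  by rewrite addrC subrK.
rewrite tE; apply: is_cvgD => //; exact: is_cvg_cst.
Qed.

Lemma lim_sub_le_tail_bound t n : cvgn t ->
  ((`|limn t - t n| `^ p)%:E <= tail_bound t n)%E.
Proof.
move=> ct.
have tb0 : (0 <= tail_bound t n)%E.
  by apply: nneseries_ge0 => i _ _; rewrite lee_fin tail_term_ge0.
have [->|tby] := eqVneq (tail_bound t n) +oo%E; first by rewrite leey.
have tbE : tail_bound t n = (fine (tail_bound t n))%:E.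
  by rewrite fineK// ge0_fin_numE// ltey.
move: tbE tb0; set r := fine _ => tbE; rewrite tbE !lee_fin => r0.
have b N : (n <= N)%N -> `|t N - t n| <= r `^ p^-1.
  move=> nN.
  have : `|t N - t n| <= \sum_(n <= i < N) `|t i.+1 - t i|.
    by rewrite -telescope_sumr//; exact: ler_norm_sum.
  move=> h; apply: (le_trans h); have := increments_le_tail_bound t n N.
  have : 0 <= \sum_(n <= i < N) `|t i.+1 - t i| by apply: sumr_ge0 => i _.
  rewrite tbE lee_fin; move: (\sum_(n <= i < N) `|t i.+1 - t i|) => y y0 yr.
  have -> : y = (y `^ p) `^ p^-1 by rewrite -powRrM mulfV ?gt_eqF// powRr1.
  by apply: ge0_ler_powR; rewrite ?nnegrE ?invr_ge0 ?powR_ge0 ?(ltW p0).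
have lb : `|limn t - t n| <= r `^ p^-1.
  have c : (fun N => `|t N - t n|) @ \oo --> `|limn t - t n|.
    by apply: cvg_norm; apply: cvgB; [exact: ct|exact: cvg_cst].
  apply: (cvgr_to_le c); exists n => // N /=; exact: b.
have -> : r = (r `^ p^-1) `^ p by rewrite -powRrM mulVf ?gt_eqF// powRr1.
by apply: ge0_ler_powR; rewrite ?nnegrE ?powR_ge0 ?(ltW p0).
Qed.

End convergence_from_weighted_increments.

Section measurable_limits.
Context d (T : measurableType d) (R : realType).

Lemma cvgn_cauchy_nat (u : nat -> R) : cvgn u <->
  forall j : nat, exists N : nat, forall k : nat, `|u N - u (N + k)%N| < j.+1%:R^-1.
Proof.
split=> [/cvg_ex[l ul] j|h].
  have e0 : 0 < j.+1%:R^-1 / 2 :> R by rewrite divr_gt0// invr_gt0 ltr0n.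
  have /cvgrPdist_lt/(_ _ e0)[N _ hN] := ul.
  exists N => k; have h1 := hN N (leqnn N); have h2 := hN (N + k)%N (leq_addr k N).
  rewrite -(subrK l (u N)) -addrA; apply: (le_lt_trans (ler_normD _ _)).
  by rewrite [j.+1%:R^-1]splitr; apply: ltrD => //; rewrite distrC.
apply/cauchy_cvgP/cauchy_exP => e e0.
have [j je] : exists j : nat, j.+1%:R^-1 <= e.
  exists (Num.truncn e^-1); rewrite -[leRHS]invrK lef_pV2 ?posrE ?ltr0n ?invr_gt0//.
  by apply/ltW/truncnS_gt.
have [N hN] := h j; exists (u N); exists N => // n /= Nn.
by rewrite /ball /= -(subnKC Nn); exact: lt_le_trans (hN _) je.
Qed.

Lemma measurable_cvgn (u : nat -> T -> R) : (forall n, measurable_fun setT (u n)) ->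
  measurable [set x | cvgn (u ^~ x)].
Proof.
move=> mu.
have -> : [set x | cvgn (u ^~ x)] =
    \bigcap_j \bigcup_N \bigcap_k [set x | `|u N x - u (N + k)%N x| < j.+1%:R^-1].
  apply/seteqP; split => x /=.
    by move=> /cvgn_cauchy_nat h j _; have [N hN] := h j; exists N => // k _; exact: hN.
  move=> h; apply/cvgn_cauchy_nat => j; have [N _ hN] := h j Logic.I.
  by exists N => k; exact: hN.
apply: bigcapT_measurable => j; apply: bigcupT_measurable => N; apply: bigcapT_measurable => k.
have mf : measurable_fun setT (fun x => `|u N x - u (N + k)%N x|).
  by apply: measurableT_comp => //; exact: measurable_funB.
have := mf measurableT _ (measurable_itv `]-oo, j.+1%:R^-1[).
by rewrite setTI; congr measurable; apply/seteqP; split => x /=; rewrite in_itv.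
Qed.

(** Where there is no convergence, limn takes a constant default value, and
    the set of convergence is measurable by Cauchy's criterion. *)
Lemma measurable_limn (u : nat -> T -> R) : (forall n, measurable_fun setT (u n)) ->
  measurable_fun setT (fun x => limn (u ^~ x)).
Proof.
move=> mu; have mC := measurable_cvgn mu; set C := [set x | cvgn (u ^~ x)] in mC.
have mI : measurable_fun setT (\1_C : T -> R) by exact: measurable_indic.
have m1 : measurable_fun setT (fun x => limn (fun n => u n x * \1_C x)).
  apply: (measurable_fun_cvg (h := fun n x => u n x * \1_C x)).
  - by move=> n; exact: measurable_funM.
  - move=> x _; have [xC|xC] := boolP (x \in C).
      have E : (fun n => u n x * \1_C x) = u ^~ x.
        by apply/funext => n; rewrite indicE xC mulr1.
      by rewrite E; move: xC; rewrite inE.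
    have -> : (fun n => u n x * \1_C x) = cst 0.
      by apply/funext => n; rewrite indicE (negbTE xC) mulr0.
    by rewrite lim_cst//; exact: cvg_cst.
have -> : (fun x => limn (u ^~ x)) =
    (fun x => limn (fun n => u n x * \1_C x) * \1_C x + (point : R) * (1 - \1_C x)).
  apply/funext => x; have [xC|xC] := boolP (x \in C).
    have -> : (fun n => u n x * \1_C x) = u ^~ x.
      by apply/funext => n; rewrite indicE xC mulr1.
    by rewrite indicE xC mulr1 subrr mulr0 addr0.
  rewrite indicE (negbTE xC) mulr0 add0r subr0 mulr1; apply: dvgP => h.
  by move/negP: xC; apply; rewrite inE.
apply: measurable_funD; first exact: measurable_funM.
by apply: measurable_funM => //; exact: measurable_funB.
Qed.

End measurable_limits.


(** * Summing the local energies *)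

Section energies.
Context {R : realType}.
Variable d : nat.
Local Notation n := d.+1.
Variables (p lambda : R).
Hypotheses (p1 : 1 <= p) (lam0 : 0 <= lambda).
Implicit Types (k : nat) (m : 'rV[int]_d).
Local Notation muw := (@mu_weight R d (p - 1) lambda).

Lemma esumZ_le (I : choiceType) (c : R) (a : I -> \bar R) : 0 <= c ->
  (forall i, 0 <= a i)%E ->
  (\esum_(i in [set: I]) (c%:E * a i) <= c%:E * \esum_(i in [set: I]) a i)%E.
Proof.
move=> c0 a0; apply: ge_ereal_sup => _ [X [finX _] <-].
rewrite fsbig_finite//= -ge0_sume_distrr//; apply: lee_wpmul2l; first by rewrite lee_fin.
by apply: ereal_sup_ubound; exists X; rewrite ?fsbig_finite.
Qed.

Definition layer k : set 'rV[R]_n := [set y | ell k / 4 < height y <= 21 / 4 * ell k].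

Lemma measurable_layer k : measurable (layer k).
Proof.
have := @measurable_height R d measurableT _ (measurable_itv `]ell k / 4, 21 / 4 * ell k]).
by rewrite setTI; congr measurable; apply/seteqP; split => y /=; rewrite in_itv.
Qed.

Lemma layer_upper k : layer k `<=` upper_half.
Proof. by move=> y /andP[h _]; apply: lt_trans h; rewrite divr_gt0// ell_gt0. Qed.

Lemma region_layer k m : region k m `<=` layer k.
Proof. by move=> y /region_height. Qed.

(** Regions are five cubes wide, so the indices of two regions of the same
    generation that meet differ by less than 5 in every direction, and
    residues modulo 5 tell them apart. *)
Lemma region_label_inj k m m' (y : 'rV[R]_n) : region k m y -> region k m' y ->
  [ffun i : 'I_d => inord (`|(m ord0 i %% 5)%Z|%N) : 'I_5] =
  [ffun i : 'I_d => inord (`|(m' ord0 i %% 5)%Z|%N) : 'I_5] -> m = m'.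
Proof.
move=> hm hm' /ffunP h; apply/rowP => i.
have := h i; rewrite !ffunE => /(congr1 val) /=.
have l5 (a : int) : (`|(a %% 5)%Z| < 5)%N by lia.
rewrite !inordK// => lab.
have := hm (lift ord_max i); have := hm' (lift ord_max i); rewrite /ulo !snoc_lift.
have l0 := @ell_gt0 R k.
move=> /andP[a1 a2] /andP[b1 b2].
have ineq (a b : int) : ell k * (a%:~R - 2) < y ord0 (lift ord_max i) ->
    y ord0 (lift ord_max i) <= ell k * (b%:~R - 2) + 5 * ell k -> a < b + 5.
  move=> h1 h2; rewrite -(ltr_int R) rmorphD/= -subr_gt0 -(pmulr_lgt0 _ l0).
  move: (lt_le_trans h1 h2); move: (a%:~R : R) (b%:~R : R) (ell k : R) => x z l; lra.
have := ineq _ _ a1 b2; have := ineq _ _ b1 a2.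
move: (m ord0 i) (m' ord0 i) lab => a b; lia.
Qed.

(** Layers that are five generations or more apart are disjoint, because
    21/4 * 2^-5 < 1/4. *)
Lemma layer_label_inj (y : 'rV[R]_n) k k' : layer k y -> layer k' y ->
  inord (k %% 5)%N = inord (k' %% 5)%N :> 'I_5 -> k = k'.
Proof.
move=> hk hk' /(congr1 val) /=; rewrite !inordK ?ltn_mod// => kk.
have far (a b : nat) : layer a y -> layer b y -> (a + 5 <= b)%N -> False.
  move=> /andP[a1 _] /andP[_ b2] ab.
  have : ell b <= ell a / 32 :> R.
    have -> : ell a / 32 = ell (a + 5) :> R.
      have -> : 32 = 2 ^+ 5 :> R by rewrite -natrX.
      by rewrite /ell [in RHS]exprD [in RHS]invfM.
    by rewrite lef_pV2 ?posrE ?exprn_gt0// ler_weXn2l// ler1n.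
  have := @ell_gt0 R a; move: a1 b2; move: (height y) (ell a : R) (ell b : R) => h x z; lra.
have [k1 k2] : (k < k' -> k + 5 <= k')%N /\ (k' < k -> k' + 5 <= k)%N by lia.
case: (ltngtP k k') => // h; exfalso; [exact: (far k k' hk hk' (k1 h))|exact: (far k' k hk' hk (k2 h))].
Qed.

Definition scale_energy (g : 'rV[R]_n -> R) k : \bar R :=
  (\esum_(m in [set: 'rV[int]_d]) energy p lambda g k m)%E.

Lemma scale_energy_ge0 g k : (0 <= scale_energy g k)%E.
Proof. by apply: esum_ge0 => m _; exact: energy_ge0. Qed.

Definition total_energy (g : 'rV[R]_n -> R) : \bar R :=
  (\int[muw]_(y in upper_half) (`|g y| `^ p)%:E)%E.

Lemma total_energy_ge0 g : (0 <= total_energy g)%E.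
Proof. by apply: integral_ge0 => y _; rewrite lee_fin powR_ge0. Qed.

Section measurable_function.
Variable g : 'rV[R]_n -> R.
Hypothesis mg : measurable_fun upper_half g.

Let mgp (D : set 'rV[R]_n) : D `<=` upper_half ->
  measurable_fun D (fun y => (`|g y| `^ p)%:E).
Proof.
move=> DU; apply: (measurable_funS (@measurable_upper_half R d)) => //.
apply/measurable_EFinP; apply: (measurableT_comp (measurable_powR p)).
exact: measurableT_comp.
Qed.

Lemma scale_energy_le_layer k :
  (scale_energy g k <= (5 ^ d)%N%:R%:E * \int[muw]_(y in layer k) (`|g y| `^ p)%:E)%E.
Proof.
have -> : (5 ^ d)%N = #|{ffun 'I_d -> 'I_5}| by rewrite card_ffun !card_ord.
apply: (esum_integral_overlap _ (e := fun m => [ffun i : 'I_d => inord (`|(m ord0 i %% 5)%Z|%N) : 'I_5])).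
- exact: measurable_layer.
- by move=> m; exact: measurable_region.
- by move=> m; exact: region_layer.
- by move=> y m m'; exact: region_label_inj.
- by apply: mgp; exact: layer_upper.
- by move=> y _; rewrite lee_fin powR_ge0.
Qed.

Lemma scale_energy_le_total k : (scale_energy g k <= (5 ^ d)%N%:R%:E * total_energy g)%E.
Proof.
apply: (le_trans (scale_energy_le_layer k)); apply: lee_wpmul2l; first by rewrite lee_fin.
apply: ge0_subset_integral.
- exact: measurable_layer.
- exact: measurable_upper_half.
- exact: mgp.
- by move=> y _; rewrite lee_fin powR_ge0.
- exact: layer_upper.
Qed.

Lemma sum_scale_energy :
  (\sum_(0 <= k <oo) scale_energy g k <= (5 ^ d * 5)%N%:R%:E * total_energy g)%E.
Proof.
apply: (@le_trans _ _ (\sum_(0 <= k <oo)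
    ((5 ^ d)%N%:R%:E * \int[muw]_(y in layer k) (`|g y| `^ p)%:E))%E).
  apply: lee_nneseries => k *; [exact: scale_energy_ge0|exact: scale_energy_le_layer].
have i0 k : (0 <= \int[muw]_(y in layer k) (`|g y| `^ p)%:E)%E.
  by apply: integral_ge0 => y _; rewrite lee_fin powR_ge0.
rewrite nneseriesZl; last by move=> k _; exact: i0.
rewrite natrM EFinM -muleA; apply: lee_wpmul2l; first by rewrite lee_fin.
rewrite nneseries_esumT//.
have -> : 5%:R = #|'I_5|%:R :> R by rewrite card_ord.
apply: (esum_integral_overlap _ (e := fun k => inord (k %% 5)%N : 'I_5)).
- exact: measurable_upper_half.
- exact: measurable_layer.
- exact: layer_upper.
- by move=> y k k'; exact: layer_label_inj.
- exact: mgp.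
- by move=> y _; rewrite lee_fin powR_ge0.
Qed.

End measurable_function.

Lemma integral_le_energy (g : 'rV[R]_n -> R) k (c : R) (psi : 'rV[R]_d -> R) :
  0 <= c -> measurable_fun setT psi -> (forall x, 0 <= psi x) ->
  (forall x, ((ell k ^+ d * psi x)%:E <= c%:E * energy p lambda g k (idx k x))%E) ->
  (\int[lebesgue_row d]_x (psi x)%:E <= c%:E * scale_energy g k)%E.
Proof.
move=> c0 mpsi psi0 hpsi.
have l0 : 0 < ell k ^+ d :> R by rewrite exprn_gt0// ell_gt0.
pose H m : \bar R := (((ell k ^+ d)^-1)%:E * (c%:E * energy p lambda g k m))%E.
have H0 m : (0 <= H m)%E.
  by rewrite !mule_ge0 ?lee_fin ?energy_ge0// invr_ge0 ltW.
apply: (@le_trans _ _ (\int[lebesgue_row d]_x H (idx k x))%E).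
  apply: ge0_le_integral => //.
  - by move=> x _; rewrite lee_fin.
  - exact/measurable_EFinP.
  - exact: measurable_idx.
  - by move=> x _; rewrite /H lee_pdivlMl// -EFinM.
rewrite integral_idx//; apply: le_trans (esumZ_le c0 (energy_ge0 p lambda g k)).
apply: le_esum => m _; rewrite /H muleC muleA -EFinM divff ?mul1e//.
by rewrite gt_eqF.
Qed.

End energies.


(** * The trace *)

Section trace.
Context {R : realType}.
Variable d : nat.
Local Notation n := d.+1.
Implicit Types (f : 'rV[R]_n -> R) (k : nat) (m : 'rV[int]_d) (x : 'rV[R]_d).
Local Notation lebd := (@lebesgue_row R d).

Definition trace_step f k x : R := mean (nb k (idx k x)) f.

Lemma trace_approxE f k x : trace_approx f k x = trace_step f k x.
Proof.
rewrite /trace_approx -(fsbig_widen [set qcube k (idx k x)] (dyadic k)) /=.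
- by rewrite fsbig_set1 indicE mem_set ?mulr1//; exact: idx_qcube.
- by move=> _ ->; exists (idx k x).
- move=> _ [[m _ <-] h]; rewrite /= indicE memNset ?mulr0// => /qcubeP mx.
  by apply: h; rewrite /= mx.
Qed.

Lemma trace_funE f x : trace_fun f x = limn (trace_step f ^~ x).
Proof.
rewrite /trace_fun.
suff -> : (trace_approx f ^~ x) = (trace_step f ^~ x) by [].
by apply/funext => k; exact: trace_approxE.
Qed.

Lemma measurable_trace_step f k : measurable_fun setT (trace_step f k).
Proof. exact: (measurable_idx k (fun m => mean (nb k m) f)). Qed.

Lemma measurable_trace_fun f : measurable_fun setT (trace_fun f).
Proof.
have -> : trace_fun f = fun x => limn (trace_step f ^~ x).
  by apply/funext => x; exact: trace_funE.
by apply: measurable_limn => k; exact: measurable_trace_step.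
Qed.

Lemma measurable_powR_norm (h : 'rV[R]_d -> R) (p : R) : measurable_fun setT h ->
  measurable_fun setT (fun x => `|h x| `^ p).
Proof.
move=> mh; apply: (measurableT_comp (measurable_powR p)).
exact: measurableT_comp.
Qed.

Variables (p lambda : R).
Hypotheses (p1 : 1 <= p) (lam0 : 0 <= lambda).
Variables (f : 'rV[R]_n -> R) (G : 'rV[R]_n -> 'rV[R]_n).
Hypotheses (lf : loc_integrable upper_half f) (wG : is_weak_gradient upper_half f G).
Let g y := enorm (G y).
Let C1 := gradient_cst d p lambda.
Let E k := scale_energy p lambda g k.

Let C1_gt0 : 0 < C1. Proof. exact: gradient_cst_gt0. Qed.
Let w_gt0 k : 0 < logw lambda k :> R. Proof. exact: logw_gt0. Qed.

Lemma measurable_gradient_norm : measurable_fun upper_half g.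
Proof.
apply: measurable_enorm; first exact: measurable_upper_half.
by move=> i; have [[]] := wG i.
Qed.

Lemma integral_increment k :
  (\int[lebd]_x (`|trace_step f k.+1 x - trace_step f k x| `^ p)%:E <=
   (C1 / logw lambda k)%:E * E k)%E.
Proof.
apply: integral_le_energy.
- by rewrite divr_ge0 ?ltW.
- apply: measurable_powR_norm; apply: measurable_funB; exact: measurable_trace_step.
- by move=> x; exact: powR_ge0.
- by move=> x; apply: (child_means p1 lam0 lf wG) => i; exact: idx_child.
Qed.

Lemma integral_adjacent k (e : 'rV[int]_d) : (forall i, -1 <= e ord0 i <= 1) ->
  (\int[lebd]_x (`|trace_step f k x - mean (nb k (idx k x + e)) f| `^ p)%:E <=
   (C1 / logw lambda k)%:E * E k)%E.
Proof.
move=> he; apply: integral_le_energy.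
- by rewrite divr_ge0 ?ltW.
- apply: measurable_powR_norm; apply: measurable_funB; first exact: measurable_trace_step.
  exact: (measurable_idx k (fun m => mean (nb k (m + e)) f)).
- by move=> x; exact: powR_ge0.
- move=> x; apply: (adjacent_means p1 lam0 lf wG) => i.
  have -> : (idx k x + e) ord0 i = idx k x ord0 i + e ord0 i by rewrite [LHS]mxE.
  by rewrite !lerD2l; exact: he.
Qed.

Definition base_cst : R := (5 ^+ n) `^ (p - 1) / region_weight p lambda 0.

Lemma base_cst_ge0 : 0 <= base_cst.
Proof. by rewrite divr_ge0 ?powR_ge0// ltW// region_weight_gt0. Qed.

Lemma integral_base :
  (\int[lebd]_x (`|trace_step f 0 x| `^ p)%:E <=
   (base_cst * (5 ^ d)%N%:R)%:E * total_energy p lambda f)%E.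
Proof.
apply: (@le_trans _ _ (base_cst%:E * scale_energy p lambda f 0)%E).
  apply: integral_le_energy.
  - exact: base_cst_ge0.
  - by apply: measurable_powR_norm; exact: measurable_trace_step.
  - by move=> x; exact: powR_ge0.
  - by move=> x; rewrite ell0 expr1n mul1r; exact: mean_energy0.
rewrite [(base_cst * _)%:E]EFinM -muleA; apply: lee_wpmul2l; first by rewrite lee_fin base_cst_ge0.
exact: (scale_energy_le_total p1 lam0 lf.1).
Qed.

Section remainder.
Variables (kap : nat -> nat -> R) (K : R).
Hypotheses (kap0 : forall k i, 0 <= kap k i).
Hypothesis kapP : controls_tails p lambda kap.
Hypothesis kapK : forall i, kap 0%N i <= K.

Definition remainder_coef k i : R := if (k <= i)%N then kap k i * C1 else 0.

Definition remainder_bound k : \bar R :=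
  (\sum_(0 <= i <oo) (remainder_coef k i)%:E * E i)%E.

Let tb k x := tail_bound p lambda kap (trace_step f ^~ x) k.

Let mterm k i : measurable_fun setT (fun x => (tail_term p lambda kap (trace_step f ^~ x) k i)%:E).
Proof.
apply/measurable_EFinP; rewrite /tail_term; case: (k <= i)%N => //.
apply: measurable_funM => //; apply: measurable_funM => //.
apply: measurable_powR_norm; apply: measurable_funB; exact: measurable_trace_step.
Qed.

Let term0 k i x : (0 <= (tail_term p lambda kap (trace_step f ^~ x) k i)%:E)%E.
Proof. by rewrite lee_fin tail_term_ge0. Qed.

Lemma integral_tail_bound k : (\int[lebd]_x tb k x <= remainder_bound k)%E.
Proof.
rewrite integral_nneseries//.
apply: lee_nneseries => [i _ _|i _]; first by apply: integral_ge0.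
rewrite /remainder_coef /tail_term; case: ifP => _; last first.
  by rewrite integral0_eq// mul0e.
have mi : measurable_fun setT (fun x => (`|trace_step f i.+1 x - trace_step f i x| `^ p)%:E).
  apply/measurable_EFinP; apply: measurable_powR_norm.
  by apply: measurable_funB; exact: measurable_trace_step.
under eq_integral do rewrite mulrA EFinM.
rewrite ge0_integralZl//; last by rewrite lee_fin mulr_ge0// ltW.
have kw : 0 <= kap k i * logw lambda i by rewrite mulr_ge0// ltW.
apply: (le_trans (lee_wpmul2l _ (integral_increment i))); first by rewrite lee_fin.
rewrite muleA -EFinM.
suff -> : kap k i * logw lambda i * (C1 / logw lambda i) = kap k i * C1 by [].
by field; rewrite gt_eqF.
Qed.

Lemma remainder_bound0_le :
  (remainder_bound 0 <= (K * C1 * (5 ^ d * 5)%N%:R)%:E * total_energy p lambda g)%E.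
Proof.
have K0 : 0 <= K by apply: le_trans (kapK 0%N); exact: kap0.
apply: (@le_trans _ _ ((K * C1)%:E * \sum_(0 <= i <oo) E i)%E).
  rewrite -nneseriesZl; last by move=> i _; exact: scale_energy_ge0.
  apply: lee_nneseries => [i _ _|i _].
    rewrite mule_ge0 ?scale_energy_ge0// lee_fin /remainder_coef.
    by rewrite leq0n mulr_ge0// ltW.
  apply: lee_wpmul2r; first exact: scale_energy_ge0.
  by rewrite lee_fin /remainder_coef leq0n ler_pM2r.
rewrite (EFinM (K * C1)) -muleA; apply: lee_wpmul2l; first by rewrite lee_fin mulr_ge0// ltW.
exact: (sum_scale_energy p1 lam0 measurable_gradient_norm).
Qed.

Hypothesis finite_energy : (total_energy p lambda g < +oo)%E.

Lemma remainder_bound0_fin : (remainder_bound 0 < +oo)%E.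
Proof.
apply: (le_lt_trans remainder_bound0_le); apply: lte_mul_pinfty => //.
have K0 : 0 <= K by apply: le_trans (kapK 0%N); exact: kap0.
by rewrite lee_fin mulr_ge0// mulr_ge0// ltW.
Qed.

Let mtb k : measurable_fun setT (tb k).
Proof. exact: ge0_emeasurable_sum. Qed.

(** The tail bound has a finite integral, so it is finite almost everywhere. *)
Lemma ae_cvg_trace_step : {ae lebd, forall x, cvgn (trace_step f ^~ x)}.
Proof.
have itb : lebd.-integrable setT (tb 0).
  apply/integrableP; split => //.
  under eq_integral do rewrite gee0_abs ?nneseries_ge0//.
  exact: le_lt_trans (integral_tail_bound 0) remainder_bound0_fin.
have := integrable_ae measurableT itb.
apply: filterS => x /(_ Logic.I); rewrite ge0_fin_numE; last exact: nneseries_ge0.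
exact: (cvg_of_tail_bound p1 kap0 kapP).
Qed.

Lemma trace_remainder k :
  (\int[lebd]_x (`|trace_fun f x - trace_step f k x| `^ p)%:E <= remainder_bound k)%E.
Proof.
apply: le_trans (integral_tail_bound k).
apply: ae_ge0_le_integral => //.
- apply/measurable_EFinP; apply: measurable_powR_norm; apply: measurable_funB.
    exact: measurable_trace_fun.
  exact: measurable_trace_step.
- by move=> x _; exact: nneseries_ge0.
apply: filterS ae_cvg_trace_step => x cx _.
rewrite trace_funE; exact: (lim_sub_le_tail_bound p1 kap0 kapP).
Qed.

End remainder.
End trace.


(** * Averages of the trace over cubes *)

Section cube_averages.
Context {R : realType}.
Variable d : nat.
Implicit Types (k : nat) (m : 'rV[int]_d) (x : 'rV[R]_d).
Local Notation lebd := (@lebesgue_row R d).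
Variables (p : R) (T : 'rV[R]_d -> R) (a : nat -> 'rV[int]_d -> R).
Hypothesis p1 : 1 <= p.
Hypothesis mT : measurable_fun setT T.
Hypothesis iT : forall k m, lebd.-integrable (qcube k m) (EFin \o T).

Let p0 : 0 <= p. Proof. exact: le_trans p1. Qed.

Lemma powR_norm_sum3 (u v w : R) :
  `|u + v + w| `^ p <= 3 `^ (p - 1) * (`|u| `^ p + `|v| `^ p + `|w| `^ p).
Proof.
apply: le_trans (powR_sum3 p1 (normr_ge0 u) (normr_ge0 v) (normr_ge0 w)).
apply: ge0_ler_powR; rewrite ?nnegrE ?addr_ge0//.
apply: (le_trans (ler_normD _ _)); rewrite lerD2r; exact: ler_normD.
Qed.

(** Jensen's inequality for the average of T - b. *)
Lemma mean_cube_jensen k m (b : R) :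
  ((`|mean (qcube k m) T - b| `^ p * ell k ^+ d)%:E <=
   \int[lebd]_(x in qcube k m) (`|T x - b| `^ p)%:E)%E.
Proof.
have mQ := @measurable_qcube R d k m.
have V0 : 0 < ell k ^+ d :> R by rewrite exprn_gt0// ell_gt0.
have QE : fine (lebd (qcube k m)) = ell k ^+ d.
  exact: (congr1 fine (lebesgue_row_qcube k m)).
have Q0 : (0 < lebd (qcube k m))%E by rewrite lebesgue_row_qcube lte_fin.
have Qy : (lebd (qcube k m) < +oo)%E by rewrite lebesgue_row_qcube ltry.
have ib : lebd.-integrable (qcube k m) (EFin \o cst b).
  apply/integrableP; split; first exact/measurable_EFinP.
  under eq_integral do rewrite /=.
  by rewrite integral_cst// lte_mul_pinfty.
have iTb : lebd.-integrable (qcube k m) (EFin \o (fun x => T x - b)).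
  by have := integrableB mQ (iT k m) ib; congr (_.-integrable _ _).
have := powR_integral p1 mQ Q0 Qy (integrable_norm iTb) (fun x _ => normr_ge0 (T x - b)).
rewrite QE; set I := \int[lebd]_(x in qcube k m) `|T x - b| => J.
have I0 : 0 <= I by exact: Rintegral_ge0.
set V := ell k ^+ d in V0 QE J *.
have c0 : 0 < V `^ (p - 1) by exact: powR_gt0.
have D1 : `|mean (qcube k m) T - b| <= V^-1 * I.
  have -> : mean (qcube k m) T - b = V^-1 * \int[lebd]_(x in qcube k m) (T x - b).
    rewrite (RintegralB mQ (iT k m) ib) /mean QE.
    rewrite (@Rintegral_cst _ _ _ lebd _ mQ b) QE.
    by field; rewrite gt_eqF.
  rewrite normrM gtr0_norm ?invr_gt0// ler_pM2l ?invr_gt0//.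
  exact: (le_normr_Rintegral mQ iTb).
apply: (@le_trans _ _ ((V `^ (p - 1))^-1%:E * (I `^ p)%:E)%E); last first.
  by rewrite lee_pdivrMl.
rewrite -EFinM lee_fin.
apply: (@le_trans _ _ ((V^-1 * I) `^ p * V)).
  by rewrite ler_pM2r//; apply: ge0_ler_powR; rewrite ?nnegrE ?mulr_ge0 ?invr_ge0 ?(ltW V0).
rewrite powRM ?invr_ge0 ?(ltW V0)// -(powR_inv1 (ltW V0)) -powRrM mulN1r powRN.
have -> : V `^ p = V `^ (p - 1) * V.
  by rewrite -{3}(powRr1 (ltW V0)) -powRD ?(gt_eqF V0) ?implybT// subrK.
rewrite le_eqVlt; apply/orP; left; apply/eqP.
by field; rewrite !gt_eqF.
Qed.

Let mpow (h : 'rV[R]_d -> R) : measurable_fun setT h ->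
  measurable_fun setT (fun x => (`|h x| `^ p)%:E).
Proof. by move=> mh; apply/measurable_EFinP; exact: measurable_powR_norm. Qed.

Let pw0 (y : R) : (0 <= (`|y| `^ p)%:E)%E. Proof. by rewrite lee_fin powR_ge0. Qed.

Definition distance k : \bar R := (\int[lebd]_x (`|T x - a k (idx k x)| `^ p)%:E)%E.

Definition corner k m : 'rV[R]_d := \row_i (ell k * ((m ord0 i)%:~R + 1)).

Lemma idx_corner k m : idx k (corner k m) = m.
Proof.
apply/qcubeP; rewrite qcubeE => i; rewrite mxE lexx andbT.
by rewrite ltr_pM2l ?ell_gt0// ltrDl.
Qed.

(** Averaging T over finer cubes does not increase its distance to a function
    that is constant on the coarser cubes. *)
Lemma average_distance k j :
  (\int[lebd]_x (`|mean (qcube (k + j) (idx (k + j) x)) T - a k (idx k x)| `^ p)%:E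
   <= distance k)%E.
Proof.
pose H m : \bar R := (`|mean (qcube (k + j) m) T - a k (idx k (corner (k + j) m))| `^ p)%:E.
have idxE x m : idx (k + j) x = m -> idx k x = idx k (corner (k + j) m).
  by move=> xm; apply: (@idx_coarser _ _ _ j); rewrite idx_corner.
rewrite (eq_integral (fun x => H (idx (k + j) x))); last first.
  by move=> x _; rewrite /H -(idxE x).
rewrite integral_idx; last by move=> m; exact: pw0.
rewrite /distance (integral_partition _ (measurable_qcube (k + j)) (@trivIset_qcube _ _ (k + j)) (@bigcup_qcube R d (k + j)))//.
- apply: le_esum => m _; rewrite /H -EFinM; apply: (le_trans (mean_cube_jensen _ _ _)).
  rewrite le_eqVlt; apply/orP; left; apply/eqP; apply: eq_integral => x.
  by rewrite inE => /qcubeP xm; rewrite (idxE x m).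
- apply: mpow; apply: measurable_funB => //.
  exact: measurable_idx.
Qed.

Lemma average_distance_shift k (e : 'rV[int]_d) :
  (\int[lebd]_x (`|a k (idx k x + e) - mean (qcube k (idx k x + e)) T| `^ p)%:E <= distance k)%E.
Proof.
rewrite (integral_idx_shift k e (H := fun m => (`|a k m - mean (qcube k m) T| `^ p)%:E)).
  apply: le_trans (average_distance k 0); rewrite addn0.
  rewrite le_eqVlt; apply/orP; left; apply/eqP; apply: eq_integral => x _.
  by rewrite distrC.
by move=> m; exact: pw0.
Qed.

Lemma average_difference k j (e : 'rV[int]_d) (A : \bar R) :
  (\int[lebd]_x (`|a k (idx k x) - a k (idx k x + e)| `^ p)%:E <= A)%E ->
  (\int[lebd]_x (`|mean (qcube (k + j) (idx (k + j) x)) T - mean (qcube k (idx k x + e)) T| `^ p)%:E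
   <= (3 `^ (p - 1))%:E * (distance k + A + distance k))%E.
Proof.
move=> hA.
pose u x := mean (qcube (k + j) (idx (k + j) x)) T - a k (idx k x).
pose v x := a k (idx k x) - a k (idx k x + e).
pose w x := a k (idx k x + e) - mean (qcube k (idx k x + e)) T.
have m1 : measurable_fun setT (fun x => mean (qcube (k + j) (idx (k + j) x)) T).
  exact: (measurable_idx (k + j) (fun m => mean (qcube (k + j) m) T)).
have m2 : measurable_fun setT (fun x => a k (idx k x)) by exact: measurable_idx.
have m3 : measurable_fun setT (fun x => a k (idx k x + e)).
  exact: (measurable_idx k (fun m => a k (m + e))).
have m4 : measurable_fun setT (fun x => mean (qcube k (idx k x + e)) T).
  exact: (measurable_idx k (fun m => mean (qcube k (m + e)) T)).
have mu : measurable_fun setT u by exact: measurable_funB.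
have mv : measurable_fun setT v by exact: measurable_funB.
have mw : measurable_fun setT w by exact: measurable_funB.
apply: (@le_trans _ _ (\int[lebd]_x ((3 `^ (p - 1))%:E *
    ((`|u x| `^ p)%:E + (`|v x| `^ p)%:E + (`|w x| `^ p)%:E)))%E).
  apply: ge0_le_integral => //.
  - by apply: mpow; exact: measurable_funB.
  - apply: measurable_funeM; apply: emeasurable_funD; last exact: mpow.
    by apply: emeasurable_funD; exact: mpow.
  - move=> x _; rewrite -!EFinD -EFinM lee_fin.
    apply: le_trans (powR_norm_sum3 (u x) (v x) (w x)).
    have -> : u x + v x + w x = mean (qcube (k + j) (idx (k + j) x)) T - mean (qcube k (idx k x + e)) T.
      by rewrite /u /v /w; ring.
    by [].
rewrite ge0_integralZl//; last 2 first.
- apply: emeasurable_funD; last exact: mpow.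
  by apply: emeasurable_funD; exact: mpow.
- by move=> x _; rewrite !adde_ge0.
rewrite lee_pmul2l ?lte_fin ?powR_gt0//.
rewrite ge0_integralD//; last 3 first.
- by move=> x _; rewrite adde_ge0.
- by apply: emeasurable_funD; exact: mpow.
- exact: mpow.
rewrite ge0_integralD//; [|exact: mpow..].
apply: leeD; last exact: average_distance_shift.
by apply: leeD => //; exact: average_distance.
Qed.

End cube_averages.


(** * One scale of the Besov seminorm *)

Section neighbouring_cubes.
Context {R : realType}.
Variable d : nat.
Implicit Types (k : nat) (m : 'rV[int]_d) (x : 'rV[R]_d).

Definition coarse_scale (j : nat) : nat := (2 ^ j.-1)%N.

Lemma prev_scaleE j : prev_scale j = coarse_scale j :> int.
Proof. by case: j. Qed.

Lemma coarse_scale_le j : (coarse_scale j <= 2 ^ j)%N.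
Proof. by rewrite leq_exp2l// leq_pred. Qed.

(** The offsets between the indices of touching cubes of one generation, listed
    by a finite type. *)
Definition unit_shift (q : {ffun 'I_d -> 'I_3}) : 'rV[int]_d := \row_i ((q i : nat)%:Z - 1).

Lemma unit_shift_itv q i : -1 <= unit_shift q ord0 i <= 1.
Proof. by rewrite mxE; case: (q i) => -[|[|[|]]]. Qed.

Lemma unit_shift_ex m m' : (forall i, m ord0 i - 1 <= m' ord0 i <= m ord0 i + 1) ->
  exists q, m' = m + unit_shift q.
Proof.
move=> h; exists [ffun i => inord (absz (m' ord0 i - m ord0 i + 1))].
apply/rowP => i; rewrite !mxE ffunE; have := h i.
move: (m ord0 i) (m' ord0 i) => u v uv; rewrite inordK; lia.
Qed.

(** Choosing one label for each point of S, distinct points get distinct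
    labels; the remaining labels only add nonnegative terms. *)
Lemma esum_finite_cover (X : choiceType) (L : finType) (S : set X) (phi : L -> X)
    (F : X -> \bar R) : (forall z, 0 <= F z)%E -> S `<=` range phi ->
  (\esum_(z in S) F z <= \sum_(l : L) F (phi l))%E.
Proof.
move=> F0 Sphi; apply: ge_ereal_sup => _ [Y [finY YS] <-].
rewrite fsbig_finite//=; set s : seq X := finmap.enum_fset (fset_set Y).
have us : uniq s by exact: finmap.fset_uniq.
have sS z : z \in s -> exists l, phi l == z.
  move=> zs; have : Y z by move: zs; rewrite in_fset_set// inE.
  by move=> /YS/Sphi[l _ <-]; exists l.
have [l0|noL] := pselect (exists l0 : L, True); last first.
  have -> : s = [::].
    by case: s sS {us} => // z s /(_ z (mem_head _ _)) [l _]; exfalso; apply: noL; exists l.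
  by rewrite big_nil; apply: sume_ge0.
have [l1 _] := l0.
pose lab z := odflt l1 [pick l | phi l == z].
have labP z : z \in s -> phi (lab z) = z.
  move=> /sS[l hl]; rewrite /lab; case: pickP => [l' /eqP//|/(_ l)].
  by rewrite hl.
have -> : (\sum_(z <- s) F z = \sum_(l <- map lab s) F (phi l))%E.
  by rewrite big_map; apply: eq_big_seq => z zs; rewrite labP.
have ul : uniq (map lab s).
  by rewrite map_inj_in_uniq// => z z' zs zs' ll; rewrite -(labP z zs) ll labP.
rewrite big_uniq//= [leLHS]big_mkcond/=; apply: lee_sum => l _.
by case: ifP.
Qed.

Lemma closure_qcube_sub k m :
  closure (@qcube R d k m) `<=` cbox (fun i => ell k * (m ord0 i)%:~R) (fun i => ell k * ((m ord0 i)%:~R + 1)).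
Proof.
rewrite [X in _ `<=` X](closure_id _).1; last exact: closed_cbox.
apply: closureS.
by rewrite qcubeE; exact: box_cbox.
Qed.

Lemma qcube_in_coarse k j m (M := idx k (@corner R d (k + j) m)) i :
  ell k * (M ord0 i)%:~R <= ell (k + j) * (m ord0 i)%:~R :> R /\
  ell (k + j) * ((m ord0 i)%:~R + 1) <= ell k * ((M ord0 i)%:~R + 1) :> R.
Proof.
have := @idx_qcube R d k (corner (k + j) m); rewrite -/M qcubeE => /(_ i).
have -> : corner (k + j) m ord0 i = ell (k + j) * ((m ord0 i)%:~R + 1) :> R by rewrite mxE.
move: (M ord0 i) (m ord0 i) => {M m} u v.
have -> : ell k = (2 ^ j)%N%:R * ell (k + j) :> R.
  by rewrite /ell exprD natrX invfM mulrCA divff ?mulr1// expf_neq0// pnatr_eq0.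
have e0 := @ell_gt0 R (k + j); move: (ell (k + j) : R) e0 => e e0.
have -> (y : R) : (2 ^ j)%N%:R * e * y = e * ((2 ^ j)%N%:R * y) by ring.
have -> (y : R) : (2 ^ j)%N%:R * e * y = e * ((2 ^ j)%N%:R * y) by ring.
rewrite !(ler_pM2l e0) !(ltr_pM2l e0) => /andP[h1 h2]; split => //.
have : ((2 ^ j)%N%:Z * u < v + 1)%R.
  by rewrite -(ltr_int R) rmorphM rmorphD.
by rewrite ltzD1 -(ler_int R) rmorphM.
Qed.

(** A neighbour of the coarser generation that touches Q also touches the cube
    of its own generation that contains Q. Hence every neighbour is one of the
    3^d cubes around Q or one of the 3^d cubes around that larger cube. *)
Lemma selected_neighbors_cover j m
    (M := idx (coarse_scale j) (@corner R d (2 ^ j) m))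
    (phi := fun l : bool * {ffun 'I_d -> 'I_3} =>
      if l.1 then @qcube R d (2 ^ j) (m + unit_shift l.2)
      else qcube (coarse_scale j) (M + unit_shift l.2)) :
  selected_neighbors j (qcube (2 ^ j) m) `<=` range phi.
Proof.
have meet k i0 m' (M' := idx k (@corner R d (k + i0) m)) :
    closure (@qcube R d (k + i0) m) `&` closure (@qcube R d k m') !=set0 ->
    exists q, m' = M' + unit_shift q.
  move=> [x [/closure_qcube_sub hx /closure_qcube_sub hx']].
  apply: unit_shift_ex => i; have [n1 n2] := qcube_in_coarse k i0 m i.
  rewrite -/M' in n1 n2.
  have /andP[a1 a2] := hx i; have /andP[b1 b2] := hx' i.
  have e0 := @ell_gt0 R k.
  have : ell k * (M' ord0 i)%:~R <= ell k * ((m' ord0 i)%:~R + 1) :> R.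
    by apply: (le_trans n1); apply: (le_trans a1).
  have : ell k * (m' ord0 i)%:~R <= ell k * ((M' ord0 i)%:~R + 1) :> R.
    by apply: (le_trans b1); apply: (le_trans a2).
  rewrite !(ler_pM2l e0) -[1]/(1%:~R) -!rmorphD !ler_int => c1 c2.
  by move: c1 c2; move: (m' ord0 i) (M' ord0 i) => u v; lia.
move=> Q [[|]]; rewrite ?prev_scaleE => -[m' _ <-] hc.
  have [q mq] := meet (2 ^ j)%N 0%N m' (ltac:(by rewrite addn0)).
  exists (true, q) => //=; rewrite mq; congr (qcube _ (_ + _)).
  by rewrite addn0 idx_corner.
have := meet (coarse_scale j) (2 ^ j - coarse_scale j)%N m'.
rewrite subnKC ?coarse_scale_le// => /(_ hc)[q mq].
by exists (false, q) => //=; rewrite mq.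
Qed.

End neighbouring_cubes.

Section scale_differences.
Context {R : realType}.
Variable d : nat.
Implicit Types (k : nat) (m : 'rV[int]_d) (x : 'rV[R]_d).
Local Notation lebd := (@lebesgue_row R d).
Variables (p : R) (T : 'rV[R]_d -> R) (a : nat -> 'rV[int]_d -> R) (A : nat -> \bar R).
Hypothesis p1 : 1 <= p.
Hypothesis mT : measurable_fun setT T.
Hypothesis iT : forall k m, lebd.-integrable (qcube k m) (EFin \o T).
Hypothesis hA : forall k (e : 'rV[int]_d), (forall i, -1 <= e ord0 i <= 1) ->
  (\int[lebd]_x (`|a k (idx k x) - a k (idx k x + e)| `^ p)%:E <= A k)%E.
Hypothesis A0 : forall k, (0 <= A k)%E.

(** Two neighbouring averages of T are compared in three steps: from T to a on
    the first cube, from a to a across the cubes, and back from a to T. *)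
Definition scale_defect k : \bar R := (distance p T a k + A k + distance p T a k)%E.

Lemma distance_ge0 k : (0 <= distance p T a k)%E.
Proof. by apply: integral_ge0 => x _; rewrite lee_fin powR_ge0. Qed.

Lemma scale_defect_ge0 k : (0 <= scale_defect k)%E.
Proof.
by apply: adde_ge0; [apply: adde_ge0 => //|]; exact: distance_ge0.
Qed.

Definition besov_scale_term (j : nat) : \bar R :=
  (\esum_(Q in @dyadic R d (2 ^ j)%N) (lebd Q *
     \esum_(Q' in selected_neighbors j Q) (`|mean Q T - mean Q' T| `^ p)%R%:E))%E.

Definition scale_cst : R := (3 ^ d)%N%:R * 3 `^ (p - 1).

Lemma besov_scale_term_le j :
  (besov_scale_term j <= scale_cst%:E * (scale_defect (2 ^ j)%N + scale_defect (coarse_scale j)))%E.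
Proof.
pose L := (bool * {ffun 'I_d -> 'I_3})%type.
pose M m := idx (coarse_scale j) (@corner R d (2 ^ j) m).
pose phi m (l : L) := if l.1 then @qcube R d (2 ^ j) (m + unit_shift l.2)
      else qcube (coarse_scale j) (M m + unit_shift l.2).
pose F m (l : L) : \bar R := (`|mean (qcube (2 ^ j) m) T - mean (phi m l) T| `^ p)%:E.
have F0 m l : (0 <= F m l)%E by rewrite lee_fin powR_ge0.
pose H m : \bar R := (\sum_(l : L) F m l)%E.
have H0 m : (0 <= H m)%E by apply: sume_ge0 => l _.
have step1 : (besov_scale_term j <= \int[lebd]_x H (idx (2 ^ j) x))%E.
  rewrite integral_idx// /besov_scale_term.
  rewrite (_ : dyadic _ = [set qcube (2 ^ j) m | m in [set: 'rV[int]_d]])//.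
  rewrite (esum_image [set: 'rV[int]_d] (fun m => @qcube R d (2 ^ j) m)).
    apply: le_esum => m _; rewrite lebesgue_row_qcube muleC.
    apply: lee_wpmul2r; first by rewrite lee_fin exprn_ge0// ltW// ell_gt0.
    apply: (esum_finite_cover (phi := phi m)) => [Q'|].
      by rewrite lee_fin powR_ge0.
    exact: selected_neighbors_cover.
  move=> m m' _ _ mm.
  have /qcubeP := @idx_corner R d (2 ^ j) m.
  by rewrite mm => /qcubeP; rewrite idx_corner.
apply: (le_trans step1).
have mF l : measurable_fun setT (fun x => F (idx (2 ^ j) x) l).
  exact: (measurable_idx (2 ^ j) (fun m => F m l)).
rewrite /H ge0_integral_sum//.
apply: (@le_trans _ _ (\sum_(l : L) ((3 `^ (p - 1))%:E *
    scale_defect (if l.1 then (2 ^ j)%N else coarse_scale j)))%E).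
  apply: lee_sum => -[[|] q] _ /=; rewrite /F /phi/=.
    have := @average_difference R d p T a p1 mT iT (2 ^ j)%N 0 (unit_shift q) (A (2 ^ j)%N).
    rewrite addn0; apply; apply: hA; exact: unit_shift_itv.
  have := @average_difference R d p T a p1 mT iT (coarse_scale j) (2 ^ j - coarse_scale j)%N
    (unit_shift q) (A (coarse_scale j)).
  rewrite subnKC ?coarse_scale_le// => /(_ (hA _ (unit_shift_itv q))).
  have ME (x : 'rV[R]_d) : M (idx (2 ^ j) x) = idx (coarse_scale j) x.
    apply/esym; apply: (@idx_coarser R d (coarse_scale j) (2 ^ j - coarse_scale j)).
    by rewrite subnKC ?coarse_scale_le// idx_corner.
  by under [X in _ -> (X <= _)%E]eq_integral do rewrite ME.
rewrite -(pair_bigA _ (fun b (q : {ffun 'I_d -> 'I_3}) => ((3 `^ (p - 1))%:E *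
    scale_defect (if b then (2 ^ j)%N else coarse_scale j))%E))/=.
have sumc (c : \bar R) : (\sum_(q : {ffun 'I_d -> 'I_3}) c = (3 ^ d)%N%:R%:E * c)%E.
  by rewrite sumr_const card_ffun !card_ord mule_natl.
rewrite big_bool/= !sumc.
move: (scale_defect_ge0 (2 ^ j)) (scale_defect_ge0 (coarse_scale j)).
move: (scale_defect _) (scale_defect _) => u v u0 v0.
rewrite ge0_muleDr// /scale_cst; move: (3 ^ d)%N%:R (3 `^ (p - 1)) => r s.
by rewrite EFinM !muleA.
Qed.

End scale_differences.


(** * The Besov seminorm of the trace *)

Section sums_over_scales.
Context {R : realType}.
Implicit Types (E X : nat -> \bar R).

Lemma sum_weighted_series E (c : nat -> nat -> R) (B : R) J :
  (forall i, 0 <= E i)%E -> (forall j i, 0 <= c j i) ->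
  (forall i, \sum_(0 <= j < J) c j i <= B) ->
  (\sum_(0 <= j < J) \sum_(0 <= i <oo) (c j i)%:E * E i <= B%:E * \sum_(0 <= i <oo) E i)%E.
Proof.
move=> E0 c0 cB; rewrite -nneseries_sum_nat; last by move=> j i; rewrite mule_ge0// lee_fin.
rewrite -nneseriesZl//; apply: lee_nneseries => [i _ _|i _].
  by apply: sume_ge0 => j _; rewrite mule_ge0// lee_fin.
rewrite -ge0_sume_distrl; last by move=> j _; rewrite lee_fin.
by rewrite sumEFin; apply: lee_wpmul2r => //; rewrite lee_fin.
Qed.

Lemma sum_eq_pow2 J i : (\sum_(0 <= j < J) (i == 2 ^ j) <= (i < 2 ^ J))%N.
Proof.
elim: J => [|J ih]; first by rewrite big_nil.
rewrite big_nat_recr//=; apply: (leq_trans (leq_add ih (leqnn _))).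
have : (2 ^ J < 2 ^ J.+1)%N by rewrite ltn_exp2l.
move: (2 ^ J)%N (2 ^ J.+1)%N => u v uv.
by case: (ltngtP i u) => [iu|//|->]; rewrite ?uv// (ltn_trans iu uv).
Qed.

Lemma sum_along_pow2 E J : (forall i, 0 <= E i)%E ->
  (\sum_(0 <= j < J) E (2 ^ j)%N <= \sum_(0 <= i <oo) E i)%E.
Proof.
move=> E0; rewrite -[leRHS]mul1e.
have e0 j i : (0 <= ((i == (2 ^ j)%N)%:R : R)%:E * E i)%E by rewrite mule_ge0// lee_fin.
apply: le_trans (sum_weighted_series (B := 1) (c := fun j i => (i == (2 ^ j)%N)%:R) (J := J) E0 _ _) => //.
  apply: lee_sum => j _.
  apply: le_trans (nneseries_lim_ge (2 ^ j).+1 (fun i _ _ => e0 j i)).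
  rewrite big_nat_recr//= eqxx mul1e leeDr//.
  by apply: sume_ge0 => i _.
move=> i; rewrite -natr_sum lern1.
by apply: (leq_trans (sum_eq_pow2 J i)); case: (_ < _)%N.
Qed.

(** The weights of consecutive scales differ by a factor 2^gamma at most, and
    the scales 0 and 1 share the same coarser generation, which accounts for
    the additional 1. *)
Lemma sum_coarse_scale (gamma : R) X (B : \bar R) J : 0 <= gamma ->
  (forall k, 0 <= X k)%E ->
  (forall J', (\sum_(0 <= j < J') ((2 ^+ j + 2) `^ gamma)%:E * X (2 ^ j)%N <= B)%E) ->
  (\sum_(0 <= j < J) ((2 ^+ j + 2) `^ gamma)%:E * X (coarse_scale j) <=
   (1 + 2 `^ gamma)%:E * B)%E.
Proof.
move=> g0 X0 XB.
have B0 : (0 <= B)%E by apply: le_trans (XB 0%N); rewrite big_nil.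
case: J => [|J]; first by rewrite big_nil mule_ge0// lee_fin addr_ge0// powR_ge0.
rewrite big_nat_recl//= EFinD ge0_muleDl// ?lee_fin ?powR_ge0// mul1e; apply: leeD.
  by apply: le_trans (XB 1%N); rewrite big_nat_recl// big_nil adde0.
apply: le_trans (lee_wpmul2l _ (XB J)); last by rewrite lee_fin powR_ge0.
rewrite ge0_sume_distrr; last by move=> j _; rewrite mule_ge0// lee_fin powR_ge0.
apply: lee_sum => j _; rewrite muleA -EFinM -powRM ?addr_ge0 ?exprn_ge0//.
apply: lee_wpmul2r; first exact: X0.
rewrite lee_fin; apply: ge0_ler_powR; rewrite ?nnegrE ?mulr_ge0 ?addr_ge0 ?exprn_ge0//.
by rewrite exprS; move: (2 ^+ j : R) => t; lra.
Qed.

Lemma nneseries_le_partial X (B : \bar R) : (forall j, 0 <= X j)%E ->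
  (forall J, (\sum_(0 <= j < J) X j <= B)%E) -> (\sum_(0 <= j <oo) X j <= B)%E.
Proof.
move=> X0 XB; apply: lime_le; first by apply: is_cvg_nneseries => j _ _.
by apply: nearW => J; exact: XB.
Qed.

End sums_over_scales.

Section besov_bound.
Context {R : realType}.
Variable d : nat.
Local Notation n := d.+1.
Local Notation lebd := (@lebesgue_row R d).
Variables (p lambda gamma : R).
Hypotheses (p1 : 1 <= p) (lam0 : 0 <= lambda) (g0 : 0 < gamma) (gl : gamma <= lambda).
Variables (kap : nat -> nat -> R) (K : R).
Hypotheses (K0 : 0 < K) (kap0 : forall k i, 0 <= kap k i).
Hypothesis kapP : controls_tails p lambda kap.
Hypothesis kapS : forall i J, \sum_(j < J | (2 ^ j <= i)%N)
  (2 ^+ j + 2) `^ gamma * kap (2 ^ j)%N i <= K.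
Hypothesis kapK : forall i, kap 0%N i <= K.
Variables (f : 'rV[R]_n -> R) (G : 'rV[R]_n -> 'rV[R]_n).
Hypotheses (lf : loc_integrable upper_half f) (wG : is_weak_gradient upper_half f G).
Let g y := enorm (G y).
Hypothesis finite_energy : (total_energy p lambda g < +oo)%E.
Hypothesis iT : forall k m, lebd.-integrable (qcube k m) (EFin \o trace_fun f).

Let C1 : R := gradient_cst d p lambda.
Let E k := scale_energy p lambda g k.
Let a k m := mean (nb k m) f.
Let A k : \bar R := ((C1 / logw lambda k)%:E * E k)%E.
Let T := trace_fun f.

Let C1_gt0 : 0 < C1. Proof. exact: gradient_cst_gt0. Qed.
Let w_gt0 k : 0 < logw lambda k :> R. Proof. exact: logw_gt0. Qed.
Let E0 k : (0 <= E k)%E. Proof. exact: scale_energy_ge0. Qed.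
Let A0 k : (0 <= A k)%E.
Proof. by rewrite mule_ge0// lee_fin divr_ge0// ltW. Qed.

Definition besov_cst : R :=
  scale_cst d p * (1 + (1 + 2 `^ gamma)) * ((2 * K + 1) * C1 * (5 ^ d * 5)%N%:R).

Let distance_le k : (distance p T a k <= remainder_bound p lambda G kap k)%E.
Proof. exact: (trace_remainder p1 lam0 lf wG kap0 kapP kapK finite_energy). Qed.

Let rc j i : R := (2 ^+ j + 2) `^ gamma * remainder_coef d p lambda kap (2 ^ j)%N i.

Let rc0 j i : 0 <= rc j i.
Proof.
rewrite mulr_ge0 ?powR_ge0// /remainder_coef; case: (_ <= _)%N => //.
by rewrite mulr_ge0// ltW.
Qed.

Let rcE k i : (0 <= (remainder_coef d p lambda kap k i)%:E * E i)%E.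
Proof.
rewrite mule_ge0// lee_fin /remainder_coef; case: (_ <= _)%N => //.
by rewrite mulr_ge0// ltW.
Qed.

(** After exchanging the two sums, the coefficient of the energy of generation
    i is the sum over the scales with 2^j <= i that kapS bounds. *)
Lemma sum_distance J :
  (\sum_(0 <= j < J) ((2 ^+ j + 2) `^ gamma)%:E * distance p T a (2 ^ j) <=
   (K * C1)%:E * \sum_(0 <= i <oo) E i)%E.
Proof.
apply: (@le_trans _ _ (\sum_(0 <= j < J) \sum_(0 <= i <oo) (rc j i)%:E * E i)%E).
  apply: lee_sum => j _.
  apply: (le_trans (lee_wpmul2l _ (distance_le (2 ^ j)))); first by rewrite lee_fin powR_ge0.
  rewrite -nneseriesZl; last by move=> i _; exact: rcE.
  rewrite le_eqVlt; apply/orP; left; apply/eqP; apply: eq_eseriesr => i _.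
  by rewrite muleA -EFinM.
apply: sum_weighted_series => // i.
apply: (@le_trans _ _ ((\sum_(j < J | (2 ^ j <= i)%N) (2 ^+ j + 2) `^ gamma * kap (2 ^ j)%N i) * C1)).
  rewrite big_mkord [in leRHS]big_mkcond/= mulr_suml le_eqVlt; apply/orP; left; apply/eqP.
  apply: eq_bigr => j _; rewrite /rc /remainder_coef.
  by case: (_ <= _)%N; rewrite ?mulrA ?mulr0 ?mul0r.
by rewrite ler_pM2r.
Qed.

(** As gamma <= lambda, the weight of the scale is absorbed by the logarithmic
    gain (2^j + 2)^-lambda in the comparison of adjacent averages. *)
Lemma sum_adjacent J :
  (\sum_(0 <= j < J) ((2 ^+ j + 2) `^ gamma)%:E * A (2 ^ j) <=
   C1%:E * \sum_(0 <= i <oo) E i)%E.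
Proof.
apply: (@le_trans _ _ (C1%:E * \sum_(0 <= j < J) E (2 ^ j)%N)%E); last first.
  by apply: lee_wpmul2l; [rewrite lee_fin ltW|exact: sum_along_pow2].
rewrite ge0_sume_distrr//; apply: lee_sum => j _; rewrite /A muleA -EFinM.
apply: lee_wpmul2r => //; rewrite lee_fin mulrA ler_pdivrMr// mulrC ler_pM2l//.
rewrite /logw -(addn2 (2 ^ j)) natrD natrX.
apply: ler_powR => //; have : 1 <= 2 ^+ j :> R by rewrite exprn_ege1// ler1n.
by move: (2 ^+ j : R) => t; lra.
Qed.

Let SE := (\sum_(0 <= i <oo) E i)%E.
Let SE0 : (0 <= SE)%E. Proof. exact: nneseries_ge0. Qed.

Let S k := scale_defect p T a A k.
Let S0 k : (0 <= S k)%E. Proof. exact: scale_defect_ge0. Qed.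
Let B : \bar R := (((2 * K + 1) * C1)%:E * SE)%E.
Let B0 : (0 <= B)%E.
Proof. by rewrite mule_ge0// lee_fin mulr_ge0 ?(ltW C1_gt0)// addr_ge0// mulr_ge0// ltW. Qed.

Lemma sum_scale_defect J :
  (\sum_(0 <= j < J) ((2 ^+ j + 2) `^ gamma)%:E * S (2 ^ j) <= B)%E.
Proof.
have c0 j : (0 <= ((2 ^+ j + 2) `^ gamma : R)%:E)%E by rewrite lee_fin powR_ge0.
have D0 := distance_ge0 p T a.
have SEq j : (((2 ^+ j + 2) `^ gamma)%:E * S (2 ^ j) =
    ((2 ^+ j + 2) `^ gamma)%:E * distance p T a (2 ^ j) +
    ((2 ^+ j + 2) `^ gamma)%:E * A (2 ^ j) +
    ((2 ^+ j + 2) `^ gamma)%:E * distance p T a (2 ^ j))%E.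
  move: (c0 j) (D0 (2 ^ j)%N) (A0 (2 ^ j)); rewrite /S /scale_defect.
  move: (_%:E) (distance _ _ _ _) (A _) => c u v hc hu hv.
  by rewrite ge0_muleDr ?adde_ge0// ge0_muleDr.
rewrite (eq_bigr _ (fun (j : nat) _ => SEq j)).
rewrite !big_split/=.
apply: (le_trans (leeD (leeD (sum_distance J) (sum_adjacent J)) (sum_distance J))).
have KC : (0 <= (K * C1)%:E)%E by rewrite lee_fin mulr_ge0 ?ltW.
have C0 : (0 <= C1%:E)%E by rewrite lee_fin ltW.
rewrite -/SE -!ge0_muleDl ?adde_ge0// -!EFinD /B.
by rewrite (_ : K * C1 + C1 + K * C1 = (2 * K + 1) * C1)//; ring.
Qed.

Lemma besov_sum_le :
  (\sum_(0 <= j <oo) ((2 ^+ j + 2) `^ gamma)%:E * besov_scale_term p T j <=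
   besov_cst%:E * total_energy p lambda g)%E.
Proof.
have bs0 j : (0 <= besov_scale_term p T j)%E.
  apply: esum_ge0 => Q _; rewrite mule_ge0//; apply: esum_ge0 => Q' _.
  by rewrite lee_fin powR_ge0.
have sc0 : 0 <= scale_cst d p by rewrite mulr_ge0 ?powR_ge0.
have c0 j : (0 <= ((2 ^+ j + 2) `^ gamma : R)%:E)%E by rewrite lee_fin powR_ge0.
have BE : (B <= ((2 * K + 1) * C1 * (5 ^ d * 5)%N%:R)%:E * total_energy p lambda g)%E.
  rewrite [X in (_ <= X%:E * _)%E]mulrC [X in (_ <= X * _)%E]EFinM -muleA muleCA.
  apply: lee_wpmul2l; first by rewrite lee_fin mulr_ge0 ?(ltW C1_gt0)// addr_ge0// mulr_ge0// ltW.
  exact: (sum_scale_energy p1 lam0 (measurable_gradient_norm wG)).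
rewrite /besov_cst EFinM -muleA; apply: (@le_trans _ _
  ((scale_cst d p * (1 + (1 + 2 `^ gamma)))%:E * B)%E); last first.
  by apply: lee_wpmul2l BE; rewrite lee_fin mulr_ge0// !addr_ge0// powR_ge0.
apply: nneseries_le_partial => [j|J]; first by rewrite mule_ge0.
have m1 : measurable_fun setT T by exact: measurable_trace_fun.
have hA k (e : 'rV[int]_d) : (forall i, -1 <= e ord0 i <= 1) ->
    (\int[lebd]_x (`|a k (idx k x) - a k (idx k x + e)| `^ p)%:E <= A k)%E.
  exact: (integral_adjacent p1 lam0 lf wG).
apply: (@le_trans _ _ ((scale_cst d p)%:E *
   (\sum_(0 <= j < J) ((2 ^+ j + 2) `^ gamma)%:E * S (2 ^ j)%N +
    \sum_(0 <= j < J) ((2 ^+ j + 2) `^ gamma)%:E * S (coarse_scale j)))%E).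
  rewrite -big_split/= ge0_sume_distrr; last by move=> j _; rewrite adde_ge0// mule_ge0.
  apply: lee_sum => j _; rewrite -ge0_muleDr// muleCA; apply: lee_wpmul2l => //.
  exact: besov_scale_term_le.
rewrite (EFinM (scale_cst d p)) -muleA; apply: lee_wpmul2l; first by rewrite lee_fin.
rewrite EFinD ge0_muleDl ?lee_fin ?addr_ge0 ?powR_ge0// mul1e; apply: leeD.
  exact: sum_scale_defect.
by apply: (sum_coarse_scale J (ltW g0) S0); exact: sum_scale_defect.
Qed.

End besov_bound.


(** * The L^p norm of the trace *)

Section local_integrability.
Context {R : realType}.

(** The integral of a nonnegative function is a supremum over simple functions,
    which is monotone along arbitrary sets, compact ones in particular. *)
Lemma ge0_le_integral_subset dd (T : measurableType dd) (mu : {measure set T -> \bar R})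
    (A B : set T) (f : T -> \bar R) : A `<=` B -> (forall x, 0 <= f x)%E ->
  (\int[mu]_(x in A) f x <= \int[mu]_(x in B) f x)%E.
Proof.
move=> AB f0; rewrite !ge0_integralE//; apply: le_ereal_sup => _ [h hf <-].
exists h => // x; apply: (le_trans (hf x)); rewrite !patchE.
by case: ifPn; [move=> /[!inE] /AB xB; rewrite mem_set|move=> _; case: ifP].
Qed.

Lemma le_1_powR (p x : R) : 1 <= p -> 0 <= x -> x <= 1 + x `^ p.
Proof.
move=> p1 x0; have [x1|/ltW x1] := leP x 1.
  by rewrite (le_trans x1)// lerDl powR_ge0.
by rewrite (le_trans (le1r_powR x1 p1))// lerDr.
Qed.

Lemma integrable_of_powR dd (X : measurableType dd) (mu : {measure set X -> \bar R})
    (D : set X) (h : X -> R) (p : R) : 1 <= p -> measurable D -> (mu D < +oo)%E ->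
  measurable_fun setT h -> (\int[mu]_x (`|h x| `^ p)%:E < +oo)%E ->
  mu.-integrable D (EFin \o h).
Proof.
move=> p1 mD Dy mh hp.
have mp : measurable_fun setT (fun x => `|h x| `^ p).
  by apply: (measurableT_comp (measurable_powR p)); exact: measurableT_comp.
have mhD : measurable_fun D (EFin \o h).
  by apply/measurable_EFinP; exact: (measurable_funS measurableT).
apply/integrableP; split => //.
apply: (@le_lt_trans _ _ (\int[mu]_(x in D) (1 + (`|h x| `^ p)%:E))%E).
  apply: ge0_le_integral => //.
  - exact: measurableT_comp.
  - apply: emeasurable_funD => //; apply/measurable_EFinP.
    exact: (measurable_funS measurableT).
  - by move=> x _ /=; rewrite lee_fin le_1_powR.
rewrite ge0_integralD//; last by apply/measurable_EFinP; exact: (measurable_funS measurableT).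
rewrite integral_cst// mul1e; apply: lte_add_pinfty => //.
by apply: le_lt_trans hp; exact: ge0_le_integral_subset.
Qed.

Lemma compact_sub_cbox d (K : set 'rV[R]_d) : compact K ->
  exists a b : 'I_d -> R, (forall i, a i <= b i) /\ K `<=` cbox a b.
Proof.
move=> /compact_bounded [M [_ hM]].
pose N := `|M| + 1.
have N0 : 0 < N by rewrite ltr_pwDr.
exists (fun=> - (N + 1)), (fun=> N + 1); split => [i|x Kx i].
  by rewrite ge0_cp// addr_ge0// ltW.
have MN : M < N by rewrite (le_lt_trans (ler_norm M))// ltrDl.
have := hM N MN x Kx => xN.
have : ball (0 : 'rV[R]_d) (N + 1) x.
  by rewrite mx_norm_ball /ball_/= sub0r normrN (le_lt_trans xN)// ltrDl.
move=> [_ /(_ ord0 i)]; rewrite /ball/= mxE sub0r normrN => /ltW.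
by rewrite ler_norml.
Qed.

Lemma loc_integrable_of_powR d (h : 'rV[R]_d -> R) (p : R) : 1 <= p ->
  measurable_fun setT h -> (\int[lebesgue_row d]_x (`|h x| `^ p)%:E < +oo)%E ->
  loc_integrable setT h.
Proof.
move=> p1 mh hp; split => // K _ /compact_sub_cbox[a [b [ab Kab]]].
pose a' i := a i - 1; have ab' i : a' i <= b i by rewrite lerBlDr (le_trans (ab i))// lerDl.
have Kbox : K `<=` box a' b.
  move=> x /Kab xab i; have /andP[h1 h2] := xab i.
  by rewrite h2 andbT (lt_le_trans _ h1)// ltrBlDr ltrDl.
apply: le_lt_trans (ge0_le_integral_subset _ Kbox _) _ => [x|]; first by rewrite lee_fin.
have fin : (lebesgue_row d (box a' b) < +oo)%E by rewrite lebesgue_row_box// ltry.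
by have /integrableP[] := integrable_of_powR p1 (measurable_box a' b) fin mh hp.
Qed.

End local_integrability.

Section trace_norm.
Context {R : realType}.
Variable d : nat.
Local Notation n := d.+1.
Local Notation lebd := (@lebesgue_row R d).
Variables (p lambda : R).
Hypotheses (p1 : 1 <= p) (lam0 : 0 <= lambda).
Variables (kap : nat -> nat -> R) (K : R).
Hypothesis (kap0 : forall k i, 0 <= kap k i).
Hypothesis kapP : controls_tails p lambda kap.
Hypothesis kapK : forall i, kap 0%N i <= K.
Variables (f : 'rV[R]_n -> R) (G : 'rV[R]_n -> 'rV[R]_n).
Hypotheses (lf : loc_integrable upper_half f) (wG : is_weak_gradient upper_half f G).
Let g y := enorm (G y).
Hypothesis finite_energy : (total_energy p lambda g < +oo)%E.
Let T := trace_fun f.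

Definition trace_cst : R := 3 `^ (p - 1) *
  (K * gradient_cst d p lambda * (5 ^ d * 5)%N%:R + base_cst d p lambda * (5 ^ d)%N%:R).

Lemma trace_cst_ge0 : 0 <= trace_cst.
Proof.
have K0 : 0 <= K by apply: le_trans (kapK 0%N); exact: kap0.
have C0 := @gradient_cst_gt0 R d p lambda.
rewrite mulr_ge0 ?powR_ge0// addr_ge0// mulr_ge0// ?base_cst_ge0//.
by rewrite mulr_ge0// ltW.
Qed.

(** The trace is split into the averages of generation 0, bounded by f, and
    the remainder, bounded by the gradient. *)
Lemma trace_powR_integral :
  (\int[lebd]_x (`|T x| `^ p)%:E <=
   trace_cst%:E * (total_energy p lambda g + total_energy p lambda f))%E.
Proof.
have mT : measurable_fun setT T := measurable_trace_fun f.
have m0 := measurable_trace_step f 0.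
have mp (h : 'rV[R]_d -> R) : measurable_fun setT h -> measurable_fun setT (fun x => (`|h x| `^ p)%:E).
  by move=> mh; apply/measurable_EFinP; exact: measurable_powR_norm.
have mB := mp _ (measurable_funB mT m0).
have pw (y : R) : (0 <= (`|y| `^ p)%:E)%E by rewrite lee_fin powR_ge0.
apply: (@le_trans _ _ (\int[lebd]_x ((3 `^ (p - 1))%:E *
    ((`|T x - trace_step f 0 x| `^ p)%:E + (`|trace_step f 0 x| `^ p)%:E)))%E).
  apply: ge0_le_integral => //.
  - exact: mp.
  - by apply: measurable_funeM; apply: emeasurable_funD => //; exact: mp.
  - move=> x _; rewrite -EFinD -EFinM lee_fin.
    have := powR_norm_sum3 p1 (T x - trace_step f 0 x) (trace_step f 0 x) 0.
    rewrite normr0 addr0 subrK powR0 ?addr0//.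
    by rewrite gt_eqF// (lt_le_trans _ p1).
rewrite ge0_integralZl//; last 2 first.
- by apply: emeasurable_funD => //; exact: mp.
- by move=> x _; rewrite adde_ge0.
rewrite ge0_integralD//; last exact: mp.
rewrite /trace_cst EFinM -muleA; apply: lee_wpmul2l; first by rewrite lee_fin powR_ge0.
have K0 : 0 <= K by apply: le_trans (kapK 0%N); exact: kap0.
have C0 := @gradient_cst_gt0 R d p lambda.
set c1 := K * _ * _; set c2 := base_cst _ _ _ * _.
have c10 : 0 <= c1 by rewrite mulr_ge0// mulr_ge0// ltW.
have c20 : 0 <= c2 by rewrite mulr_ge0// base_cst_ge0.
have TE h := @total_energy_ge0 R d p lambda h.
apply: (@le_trans _ _ (c1%:E * total_energy p lambda g + c2%:E * total_energy p lambda f)%E).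
  apply: leeD; last exact: integral_base.
  apply: le_trans (remainder_bound0_le p1 lam0 wG kap0 kapK).
  exact: (trace_remainder p1 lam0 lf wG kap0 kapP kapK finite_energy).
move: (TE g) (TE f); move: (total_energy _ _ _) (total_energy _ _ _) => u v u0 v0.
rewrite ge0_muleDr//; apply: leeD; apply: lee_wpmul2r; rewrite // lee_fin.
  by rewrite lerDl.
by rewrite lerDr.
Qed.

Hypothesis finite_base : (total_energy p lambda f < +oo)%E.

Lemma trace_powR_fin : (\int[lebd]_x (`|T x| `^ p)%:E < +oo)%E.
Proof.
apply: (le_lt_trans trace_powR_integral); apply: lte_mul_pinfty => //.
  by rewrite lee_fin trace_cst_ge0.
exact: lte_add_pinfty.
Qed.

Lemma integrable_trace k m : lebd.-integrable (qcube k m) (EFin \o T).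
Proof.
apply: integrable_of_powR trace_powR_fin => //.
- exact: measurable_qcube.
- have h : (lebd (qcube k m) < +oo)%E by rewrite lebesgue_row_qcube ltry.
  exact: h.
- exact: measurable_trace_fun.
Qed.

Lemma loc_integrable_trace : loc_integrable setT T.
Proof. exact: loc_integrable_of_powR p1 (measurable_trace_fun f) trace_powR_fin. Qed.

End trace_norm.


(** * Boundedness and linearity *)

Section norms.
Context {R : realType}.
Variable d : nat.
Local Notation n := d.+1.
Local Notation lebd := (@lebesgue_row R d).
Variables (p lambda gamma : R).
Hypotheses (p1 : 1 <= p).
Local Notation muw := (@mu_weight R d (p - 1) lambda).

Let p0 : p != 0. Proof. by rewrite gt_eqF// (lt_le_trans _ p1). Qed.

Lemma Lnorm_energy (h : 'rV[R]_n -> R) :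
  ('N[muw]_(p%:E)[(EFin \o h) \_ upper_half] `^ p = total_energy p lambda h)%E.
Proof.
rewrite (poweR_Lnorm _ _ p0) /total_energy [RHS]integral_mkcond.
apply: eq_integral => y _; rewrite !patchE; case: ifP => _ //.
by rewrite abse0 poweR0r.
Qed.

Lemma poweR_root_le (S X : \bar R) (c : R) : 0 <= c -> (0 <= S)%E -> (0 <= X)%E ->
  (S <= c%:E * X `^ p)%E -> (S `^ p^-1 <= (c `^ p^-1)%:E * X)%E.
Proof.
move=> c0 S0 X0 SX.
have pV0 : 0 <= p^-1 by rewrite invr_ge0 (le_trans _ p1).
apply: (@le_trans _ _ ((c%:E * X `^ p) `^ p^-1)%E).
  apply: gt0_ler_poweR => //; rewrite in_itv/= leey andbT//.
  by rewrite mule_ge0// poweR_ge0.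
rewrite poweRM ?poweR_ge0// ?lee_fin// -poweRrM mulfV// poweRe1//.
Qed.

Variable f : 'rV[R]_n -> R.
Hypothesis sf : sobolev p (p - 1) lambda f.
Let G := weak_gradient upper_half f.
Let X := sobolev_norm p (p - 1) lambda f.

Lemma sobolev_weak_gradient : is_weak_gradient upper_half f G.
Proof. by have [_ exG _] := sf; exact: xgetPex. Qed.

Let le_energy (h : 'rV[R]_n -> R) :
  ('N[muw]_(p%:E)[(EFin \o h) \_ upper_half] <= X)%E -> (total_energy p lambda h <= X `^ p)%E.
Proof.
move=> hX; rewrite -Lnorm_energy.
apply: gt0_ler_poweR; rewrite ?(le_trans _ p1)// in_itv/= leey andbT.
  exact: Lnorm_ge0.
by apply: le_trans hX; exact: Lnorm_ge0.
Qed.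

Lemma energy_le_sobolev : (total_energy p lambda f <= X `^ p)%E.
Proof. by apply: le_energy; rewrite /X /sobolev_norm leeDl// Lnorm_ge0. Qed.

Lemma gradient_energy_le_sobolev :
  (total_energy p lambda (fun y => enorm (G y)) <= X `^ p)%E.
Proof. by apply: le_energy; rewrite /X /sobolev_norm leeDr// Lnorm_ge0. Qed.

Lemma energy_fin : (total_energy p lambda f < +oo)%E.
Proof.
by apply: (le_lt_trans energy_le_sobolev); apply: poweR_lty; have [] := sf.
Qed.

Lemma gradient_energy_fin : (total_energy p lambda (fun y => enorm (G y)) < +oo)%E.
Proof.
by apply: (le_lt_trans gradient_energy_le_sobolev); apply: poweR_lty; have [] := sf.
Qed.

Lemma sobolev_norm_ge0 : (0 <= X)%E.
Proof. by rewrite adde_ge0// Lnorm_ge0. Qed.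

Hypotheses (lam0 : 0 <= lambda) (g0 : 0 < gamma) (gl : gamma <= lambda).
Variables (kap : nat -> nat -> R) (K : R).
Hypotheses (K0 : 0 < K) (kap0 : forall k i, 0 <= kap k i).
Hypothesis kapP : controls_tails p lambda kap.
Hypothesis kapS : forall i J, \sum_(j < J | (2 ^ j <= i)%N)
  (2 ^+ j + 2) `^ gamma * kap (2 ^ j)%N i <= K.
Hypothesis kapK : forall i, kap 0%N i <= K.

Let lf : loc_integrable upper_half f. Proof. by have [] := sf. Qed.

Lemma sobolev_cvg_trace_step : {ae lebd, forall x, cvgn (trace_step f ^~ x)}.
Proof.
exact: (ae_cvg_trace_step p1 lam0 lf sobolev_weak_gradient kap0 kapP kapK gradient_energy_fin).
Qed.

Lemma sobolev_loc_integrable_trace : loc_integrable setT (trace_fun f).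
Proof.
exact: (loc_integrable_trace p1 lam0 kap0 kapP kapK lf sobolev_weak_gradient
  gradient_energy_fin energy_fin).
Qed.

Definition bound_cst : R := (2 * trace_cst d p lambda K) `^ p^-1 +
  (besov_cst d p lambda gamma K) `^ p^-1.

Lemma besov_norm_le_sobolev : (besov_norm p gamma (trace_fun f) <= bound_cst%:E * X)%E.
Proof.
have X0 := sobolev_norm_ge0.
have tc0 : 0 <= trace_cst d p lambda K by exact: (trace_cst_ge0 d p lambda kap0 kapK).
have C0 := @gradient_cst_gt0 R d p lambda.
have bc0 : 0 <= besov_cst d p lambda gamma K.
  rewrite mulr_ge0//.
    by rewrite mulr_ge0// ?addr_ge0 ?powR_ge0// mulr_ge0 ?powR_ge0.
  by rewrite mulr_ge0// mulr_ge0 ?(ltW C0)// addr_ge0// mulr_ge0// ltW.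
rewrite /bound_cst EFinD ge0_muleDl ?lee_fin ?powR_ge0//; apply: leeD.
  have -> : (Lnorm lebd p%:E (EFin \o trace_fun f) =
      (Lnorm lebd p%:E (EFin \o trace_fun f) `^ p) `^ p^-1)%E.
    by rewrite -poweRrM mulfV// poweRe1// Lnorm_ge0.
  apply: poweR_root_le => //; [exact: mulr_ge0|exact: poweR_ge0|].
  rewrite (poweR_Lnorm _ _ p0).
  apply: le_trans (trace_powR_integral p1 lam0 kap0 kapP kapK lf sobolev_weak_gradient
    gradient_energy_fin) _.
  rewrite (mulrC 2) (EFinM (trace_cst _ _ _ _)) -muleA; apply: lee_wpmul2l; first by rewrite lee_fin.
  apply: le_trans (leeD gradient_energy_le_sobolev energy_le_sobolev) _.
  by rewrite mule_natl.
apply: poweR_root_le => //.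
  apply: nneseries_ge0 => j _ _; rewrite mule_ge0 ?lee_fin ?powR_ge0//.
  apply: esum_ge0 => Q _; rewrite mule_ge0//; apply: esum_ge0 => Q' _.
  by rewrite lee_fin powR_ge0.
apply: le_trans (lee_wpmul2l _ gradient_energy_le_sobolev); last by rewrite lee_fin.
apply: (besov_sum_le p1 lam0 g0 gl K0 kap0 kapP kapS kapK lf sobolev_weak_gradient
  gradient_energy_fin) => k m.
exact: (integrable_trace p1 lam0 kap0 kapP kapK lf sobolev_weak_gradient
  gradient_energy_fin energy_fin).
Qed.

Lemma sobolev_besov_trace : besov p gamma (trace_fun f).
Proof.
split; first exact: sobolev_loc_integrable_trace.
apply: (le_lt_trans besov_norm_le_sobolev).
apply: lte_mul_pinfty => //; last by have [] := sf.
by rewrite lee_fin addr_ge0 ?powR_ge0.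
Qed.

End norms.

Section linearity.
Context {R : realType}.
Variable d : nat.
Local Notation n := d.+1.
Variables (f h : 'rV[R]_n -> R).
Hypotheses (lf : loc_integrable upper_half f) (lh : loc_integrable upper_half h).

Lemma integrable_nb (u : 'rV[R]_n -> R) k m : loc_integrable upper_half u ->
  (lebesgue_row n).-integrable (nb k m) (EFin \o u).
Proof.
move=> lu; apply: integrableS (integrable_region k m lu).
- exact: measurable_region.
- exact: measurable_nb.
- exact: nb_region.
Qed.

Lemma trace_step_linear (a : R) k (x : 'rV[R]_d) :
  trace_step (fun y => a * f y + h y) k x = a * trace_step f k x + trace_step h k x.
Proof.
have mN := @measurable_nb R d k (idx k x).
have iF := integrable_nb k (idx k x) lf; have ih := integrable_nb k (idx k x) lh.
have iaf : (lebesgue_row n).-integrable (nb k (idx k x)) (EFin \o (fun y => a * f y)).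
  by have := integrableZl mN a iF; congr (_.-integrable _ _).
rewrite /trace_step /mean.
rewrite (RintegralD mN iaf ih) (RintegralZl a mN iF).
by ring.
Qed.

End linearity.

Theorem theorem1p3 (R : realType) (d : nat) (p lambda gamma : R) :
  (1 <= d)%N ->
  Gamma (p, lambda) ->
  0 < gamma ->
  (1 < p -> gamma < lambda - (p - 1)) ->
  (p = 1 -> gamma <= lambda) ->
  [/\ forall f : 'rV[R]_d.+1 -> R,
        sobolev p (p - 1) lambda f -> trace_exists f,
      forall f : 'rV[R]_d.+1 -> R,
        sobolev p (p - 1) lambda f -> besov p gamma (trace_fun f),
      forall (a : R) (f g : 'rV[R]_d.+1 -> R),
        sobolev p (p - 1) lambda f -> sobolev p (p - 1) lambda g ->
        {ae lebesgue_row d, forall x,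
          trace_fun (fun y => a * f y + g y) x =
          a * trace_fun f x + trace_fun g x} &
      exists C : R, 0 <= C /\
        forall f : 'rV[R]_d.+1 -> R, sobolev p (p - 1) lambda f ->
          (besov_norm p gamma (trace_fun f) <=
           C%:E * sobolev_norm p (p - 1) lambda f)%E].
Proof.
move=> _ hG g0 gp g1.
have p1 : 1 <= p by case: hG => -[/= h _]; [exact: ltW|rewrite h].
have gl : gamma <= lambda.
  move: p1; rewrite le_eqVlt => /predU1P[/esym/g1//|p1].
  by have := gp p1; lra.
have lam0 : 0 <= lambda by rewrite (le_trans (ltW g0)).
have [kap [K [K0 kap0 kapP kapS kapK]]] := hardy_weights p1 g0 gp g1.
have cvg_step (f : 'rV[R]_d.+1 -> R) : sobolev p (p - 1) lambda f ->
    {ae lebesgue_row d, forall x, cvgn (trace_step f ^~ x)}.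
  by move=> sf; exact: (sobolev_cvg_trace_step p1 sf lam0 kap0 kapP kapK).
split.
- move=> f /cvg_step; apply: filterS => x.
  by congr (cvgn _); apply/funext => k; rewrite trace_approxE.
- by move=> f sf; exact: (sobolev_besov_trace p1 sf lam0 g0 gl K0 kap0 kapP kapS kapK).
- move=> a f g sf sg; have [lf _ _] := sf; have [lg _ _] := sg.
  move: (cvg_step f sf) (cvg_step g sg); apply: filterS2 => x cf cg.
  rewrite !trace_funE; apply: cvg_lim => //.
  have -> : (trace_step (fun y => a * f y + g y) ^~ x) =
      (fun k => a * trace_step f k x + trace_step g k x).
    by apply/funext => k; exact: trace_step_linear.
  by apply: cvgD => //; exact: cvgMl_tmp.
- exists (bound_cst d p lambda gamma K); split.
    by rewrite addr_ge0 ?powR_ge0.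
  by move=> f sf; exact: (besov_norm_le_sobolev p1 sf lam0 g0 gl K0 kap0 kapP kapS kapK).
Qed.
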